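(* Let $k\in\mathbb{N}$ with $k\ge 2$, and for $n\ge 1$ let $t_k(n)$ denote the number of $k$-noncrossing tangled-diagrams over the vertices $1,\dots,n$ (isolated points allowed), i.e. $$t_k(n)=\sum_{r=0}^{n}\binom{n}{r}\sum_{\ell=0}^{n-r}\binom{n-r}{\ell}\,f_k(2(n-r)-\ell),$$ where $f_k(m)$ is the number of $k$-noncrossing perfect matchings on $m$ vertices. Then there exists a constant $c_k>0$, depending only on $k$, such that, as $n\to\infty$, $$t_k(n)\;\sim\; c_k\; n^{-\left((k-1)^2+\frac{k-1}{2}\right)}\,\left(4(k-1)^2+2(k-1)+1\right)^n .$$
   Context: Matchings. For $m\ge 0$, $f_k(m)$ is the number of $k$-noncrossing (perfect) matchings on the vertex set $\{1,\dots,m\}$, i.e. perfect matchings with no $k$ mutually crossing arcs $(i_1,j_1),\dots,(i_k,j_k)$, $i_1<i_2<\dots<i_k<j_1<j_2<\dots<j_k$. Here $f_k(0)=1$ and $f_k(m)=0$ for $m$ odd. Equivalently, $f_k(m)$ is the number of lattice walks of $m$ unit steps $\pm e_i$ ($1\le i\le k-1$) in $\mathbb{Z}^{k-1}$ that start and end at the origin and stay in the region $x_1\ge x_2\ge\dots\ge x_{k-1}\ge 0$. Tangled-diagrams. A tangled-diagram over $[n]$ is a labeled graph on the vertices $1,\dots,n$, each of degree at most $2$, drawn in increasing order on a horizontal line, with arcs drawn in the upper halfplane with a particular notion of crossings and nestings; isolated points are allowed. The number of $k$-noncrossing tangled-diagrams over $[n]$ without isolated points is $\tilde t_k(n)=\sum_{i=0}^{n}\binom{n}{i}f_k(2n-i)$,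 and the number with isolated points allowed is $t_k(n)=\sum_{i=0}^{n}\binom{n}{i}\tilde t_k(n-i)$, which together give the formula for $t_k(n)$ in the claim. For the purposes of the claim, this formula is to be taken as the definition of $t_k(n)$. Equivalently, $t_k(n)$ is the number of walks from the origin back to the origin in the region $x_1\ge x_2\ge\dots\ge x_{k-1}\ge 0$ of $\mathbb{Z}^{k-1}$ taking $n$ days, where on each day the walker either stays in place, or makes one unit step, or makes two consecutive unit steps (every unit step being of the form $\pm e_i$ and remaining in the region; walks are distinguished by the sequence of steps made on each day). Asymptotic notation: $a_n\sim b_n$ means $\lim_{n\to\infty}a_n/b_n=1$. *)

(* Defs.v *)
From mathcomp Require Import all_boot.
Set Implicit Arguments.
Unset Strict Implicit.
Unset Printing Implicit Defensive.

(* A matching is the set of its arcs (i, j), i < j; the vertices 1, ..., m are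
   represented by 0, ..., m - 1. *)
Definition perfect_matching (m : nat) (M : {set 'I_m * 'I_m}) : bool :=
  [forall a in M, a.1 < a.2] &&
  [forall v : 'I_m, #|[set a in M | (a.1 == v) || (a.2 == v)]| == 1].

(* The family a : 'I_k -> arcs satisfies i_1 < ... < i_k < j_1 < ... < j_k. *)
Definition mutually_crossing (k m : nat) (a : {ffun 'I_k -> 'I_m * 'I_m}) :
    bool :=
  [forall s : 'I_k, forall t : 'I_k,
     ((s < t) ==> ((a s).1 < (a t).1) && ((a s).2 < (a t).2))
     && ((a s).1 < (a t).2)].

Definition noncrossing (k m : nat) (M : {set 'I_m * 'I_m}) : bool :=
  ~~ [exists a : {ffun 'I_k -> 'I_m * 'I_m},
        [forall s, a s \in M] && mutually_crossing a].

Definition num_matchings (k m : nat) : nat :=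
  #|[set M : {set 'I_m * 'I_m} | perfect_matching M && noncrossing k M]|.

Definition num_tangled (k n : nat) : nat :=
  \sum_(0 <= r < n.+1) 'C(n, r) *
    \sum_(0 <= l < (n - r).+1)
      'C(n - r, l) * num_matchings k (2 * (n - r) - l).

(* Main.v *)
(** Put [d = k - 1].  Reading a matching through Fomin's growth diagram gives a
    bijection with closed walks of length [m] in the chamber
    [x_1 >= ... >= x_d >= 0] (oscillating tableaux): the cells of the staircase
    are traversed by rays carrying labels, two rays with the same label [r]
    collide and leave with label [r + 1], and the labels on the boundary are the
    steps of the walk.  The collisions of label [r] form Viennot's [r]-th
    skeleton; passing to the next skeleton shortens the longest crossing chain by
    exactly one, so label [k] occurs iff there are [k] mutually crossing arcs.

    The exponential generating function of the closed walks is the determinant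
    of the generating functions of one-dimensional walks on the half line.  These
    are moments of the semicircle law, so a triangular change of basis turns it
    into a Hankel determinant of [Sum_m beta(m, p) z^m / m!] with explicit [beta];
    each entry is [~ C_p e^(4z) z^(-p-3/2)] because Poisson weights concentrate,
    and the limiting Hankel determinant is positive by its LU decomposition.

    Since [f(2j) / (2d)^(2j)] is nonincreasing (Cauchy-Schwarz for the adjacency
    operator, of norm at most [2d]), the concentration of the Poisson weights can
    be undone, giving [f(2j) ~ C (2d)^(2j) j^(-(d^2 + d/2))].  Finally [t_k(n)] is
    the sum of the coefficients of [(1 + X + X^2)^n] against [f], and these
    coefficients, tilted by [(2d)^m], concentrate as well. *)

(* For [d >= 2] entrywise asymptotics of the walk determinant are useless as they stand: the entry
   [(i, j)] grows like [(i + 1) (j + 1) e^(2z) z^(-3/2)] up to a constant, a matrix of rank one, so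
   the leading terms cancel. In the variable [y = 2 - x] the dominating edge [x = 2] of the spectrum
   sits at [y = 0], and in the basis of powers of [y] the entry [(i, j)] has its own order
   [z^(-(i + j) - 3/2)]. These orders split into row and column factors, the rescaled limit is
   nondegenerate, and the exponents add up to [d^2 + d/2].

   The factor [e^(2z)] replaces [x] by [2 + x = 4 - y], which is nonnegative on the spectrum; hence
   the moments [beta] are positive and do not oscillate with the parity of [m].

   Parity returns with the walk counts, which vanish at odd lengths. The averaging laws are
   therefore restricted to even integers, where their mass tends to one half. *)
Require Import Defs.
From HB Require Import structures.
From mathcomp Require Import all_boot all_order all_fingroup all_algebra.
From mathcomp Require Import zify ring lra.
From mathcomp Require Import all_classical all_reals all_analysis.
Set Implicit Arguments.
Unset Strict Implicit.
Unset Printing Implicit Defensive.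
Import Order.TTheory GRing.Theory Num.Theory.
Import numFieldNormedType.Exports.

(** * Edge labels of growth diagrams *)

(* Outgoing label of a ray entering a cell with label [p] while the other ray
   enters with label [q]; [x] marks an arc in the cell.  These are Fomin's local
   rules for the row in which consecutive partitions differ. *)
Definition cell_out (x : bool) (p q : nat) : nat :=
  if p == q then (if p == 0 then x : nat else p.+1) else p.

(* Rows are the openers [i] and column [b] is the closer [m - 1 - b], so that the
   growth starts at the corner [(0, 0)] and the staircase is [i + b < m - 1]. *)
Fixpoint vlab_row (x : nat -> bool) (h : nat -> nat) (b : nat) : nat :=
  if b is b'.+1 then cell_out (x b') (vlab_row x h b') (h b') else 0.

Fixpoint hlab (X : nat -> nat -> bool) (i : nat) : nat -> nat :=
  if i is i'.+1 then
    fun b => cell_out (X i' b) (hlab X i' b) (vlab_row (X i') (hlab X i') b)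
  else fun _ => 0.

Definition vlab (X : nat -> nat -> bool) (i b : nat) : nat :=
  vlab_row (X i) (hlab X i) b.

(* The cells of the [r]-th skeleton: two rays of label [r] collide there. *)
Definition hit (X : nat -> nat -> bool) (r : nat) (p : nat * nat) : bool :=
  [&& hlab X p.1 p.2 == r, vlab X p.1 p.2 == r & (r == 0) ==> X p.1 p.2].

(** Columns number the closers backwards, so along a crossing chain the first coordinate grows and
    the second one shrinks. The condition that every opener precedes every closer is carried
    separately, by boxes [q.1 <= a], [q.2 <= b] inside the staircase. *)
Definition crosses (p q : nat * nat) : bool := (p.1 < q.1) && (q.2 < p.2).

Arguments hlab : simpl never.
Arguments vlab_row : simpl never.

Section Labels.
Variable X : nat -> nat -> bool.
Local Notation H := (hlab X).
Local Notation V := (vlab X).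

Lemma hlabS i b : H i.+1 b = cell_out (X i b) (H i b) (V i b).
Proof. by []. Qed.

Lemma vlabS i b : V i b.+1 = cell_out (X i b) (V i b) (H i b).
Proof. by []. Qed.

Lemma hlab0 b : H 0 b = 0. Proof. by []. Qed.
Lemma vlab0 i : V i 0 = 0. Proof. by []. Qed.

Lemma cell_out_ge x p q : p <= cell_out x p q.
Proof. rewrite /cell_out; case: eqP => // _; case: eqP => //; lia. Qed.

Lemma cell_out_hit r i b : hit X r (i, b) -> H i.+1 b = r.+1 /\ V i b.+1 = r.+1.
Proof.
case/and3P=> /= /eqP h /eqP v /implyP hx.
rewrite hlabS vlabS h v /cell_out eqxx; case: eqP => // r0.
by rewrite hx ?r0.
Qed.

Lemma hlab_step i b : H i.+1 b = H i b \/ hit X (H i b) (i, b).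
Proof.
rewrite hlabS /cell_out /hit /= eqxx /=.
case: (eqVneq (H i b) (V i b)) => [->|_]; last by left.
rewrite ?eqxx /=; case: (eqVneq (V i b) 0) => [->|_]; last by right.
by case: (X i b); [right|left].
Qed.

Lemma vlab_step i b : V i b.+1 = V i b \/ hit X (V i b) (i, b).
Proof.
rewrite vlabS /cell_out /hit /= eqxx /=.
case: (eqVneq (V i b) (H i b)) => [->|_]; last by left.
rewrite ?eqxx /=; case: (eqVneq (H i b) 0) => [->|_]; last by right.
by case: (X i b); [right|left].
Qed.

Lemma hlab_mono b i i' : i <= i' -> H i b <= H i' b.
Proof.
elim: i' => [|i' IH]; first by case: i.
rewrite leq_eqVlt => /orP[/eqP->//|]; rewrite ltnS => /IH h.
by apply: leq_trans h _; rewrite hlabS cell_out_ge.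
Qed.

Lemma vlab_mono i b b' : b <= b' -> V i b <= V i b'.
Proof.
elim: b' => [|b' IH]; first by case: b.
rewrite leq_eqVlt => /orP[/eqP->//|]; rewrite ltnS => /IH h.
by apply: leq_trans h _; rewrite vlabS cell_out_ge.
Qed.

(** A label changes only at a collision, and then by exactly one, so it cannot skip the value
    [r]. *)
Lemma hlab_jump r b i i' : H i b <= r -> r < H i' b ->
  exists2 c, i <= c < i' & hit X r (c, b).
Proof.
move=> hi; elim: i' => [|i' IH]; first by rewrite hlab0.
move=> hr; case: (ltnP r (H i' b)) => [/IH[c hc ?]|hle].
  by exists c => //; lia.
have ii' : i <= i'.
  rewrite leqNgt; apply/negP => lt.
  by have := hlab_mono b lt; lia.
case: (hlab_step i' b) => [e|]; first lia.
move=> hh; exists i'; first lia.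
have [e _] := cell_out_hit hh.
suff -> : r = H i' b by [].
by move: hr; rewrite e; lia.
Qed.

Lemma vlab_jump r i b b' : V i b <= r -> r < V i b' ->
  exists2 c, b <= c < b' & hit X r (i, c).
Proof.
move=> hi; elim: b' => [|b' IH]; first by rewrite vlab0.
move=> hr; case: (ltnP r (V i b')) => [/IH[c hc ?]|hle].
  by exists c => //; lia.
have ii' : b <= b'.
  rewrite leqNgt; apply/negP => lt.
  by have := vlab_mono i lt; lia.
case: (vlab_step i b') => [e|]; first lia.
move=> hh; exists b'; first lia.
have [_ e] := cell_out_hit hh.
suff -> : r = V i b' by [].
by move: hr; rewrite e; lia.
Qed.

Lemma hit_hlab r p : hit X r p -> H p.1 p.2 = r.
Proof. by case/and3P=> /eqP. Qed.

Lemma hit_vlab r p : hit X r p -> V p.1 p.2 = r.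
Proof. by case/and3P=> _ /eqP. Qed.

Lemma hitS r p : H p.1 p.2 = r.+1 -> V p.1 p.2 = r.+1 -> hit X r.+1 p.
Proof. by rewrite /hit => -> ->; rewrite !eqxx. Qed.

(* Between consecutive points of the upper chain the two incoming label-[r.+1]
   rays cannot cross without colliding, so one of them starts in the box. *)
Lemma chain_hit_up r c cs : path crosses c cs -> all (hit X r.+1) (c :: cs) ->
  exists p ps,
    [/\ path crosses p ps, all (hit X r) (p :: ps), size ps = (size cs).+1,
        p.1 < c.1 /\ p.2 = c.2 &
        all (fun q => (c.1 <= q.1 <= (last c cs).1) && (q.2 < c.2)) ps].
Proof.
elim: cs c => [|c2 cs IH] [a b].
  move=> _ /= /andP[hc _].
  have /= eH := hit_hlab hc; have /= eV := hit_vlab hc.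
  have [|a' /andP[_ ha'] hit1] := @hlab_jump r b 0 a (leq0n r); first by rewrite eH.
  have [|b' /andP[_ hb'] hit2] := @vlab_jump r a 0 b (leq0n r); first by rewrite eV.
  exists (a', b), [:: (a, b')]; split=> //=.
  - by rewrite /crosses /= ha' hb'.
  - by rewrite hit1 hit2.
  - by rewrite leqnn hb'.
move=> /= /andP[cc2 pcs] /and3P[hc hc2 hcs].
have [|p [ps [pps hps sz [p1 p2] bps]]] := IH _ pcs; first by rewrite /= hc2.
have /= eH := hit_hlab hc; have /= eV := hit_vlab hc.
have [|a' /andP[_ ha'] hit1] := @hlab_jump r b 0 a (leq0n r); first by rewrite eH.
have [|b' /andP[_ hb'] hit2] := @vlab_jump r a 0 b (leq0n r); first by rewrite eV.
have [c21 c22] : a < c2.1 /\ c2.2 < b by case/andP: cc2.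
have lastc : c2.1 <= (last c2 cs).1.
  elim: (cs) (c2) pcs => //= c3 cs' IH' c4 /andP[/andP[l _] /IH'].
  by move=> l2; apply: leq_trans l2; apply: ltnW.
(* If [p] lies in row [a] or later it stays in the chain below [(a', b)]; otherwise [(a, b')] takes
   its place. *)
have [lta|gea] := leqP a p.1.
  exists (a', b), (p :: ps); split=> //=.
  - by rewrite /crosses /= p2 c22 pps (leq_trans ha' lta).
  - by rewrite hit1.
  - by rewrite sz.
  - rewrite lta p2 c22 andbT (leq_trans (ltnW p1) lastc) /=.
    apply: sub_all bps => q /andP[/andP[q1 q2] q3].
    by rewrite q2 (leq_trans (ltnW c21) q1) (ltn_trans q3 c22).
(* If [b' < c2.2], both rays entering [(a, c2.2)] carry [r.+1]. They collide there, and the ray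
   arrives at [c2] with a label above [r.+1]. *)
have lec : c2.2 <= b'.
  rewrite leqNgt; apply/negP => lt.
  have eV2 : V a c2.2 = r.+1.
    have := vlab_mono a lt; have [_ ->] := cell_out_hit hit2.
    by have := vlab_mono a (ltnW c22); rewrite eV; clear; lia.
  have hp : hit X r p by case/andP: hps.
  have eH2 : H a c2.2 = r.+1.
    have := hlab_mono p.2 gea.
    have [-> _] : H p.1.+1 p.2 = r.+1 /\ V p.1 p.2.+1 = r.+1.
      by apply: cell_out_hit; case: (p) hp.
    have := hlab_mono c2.2 (ltnW c21); rewrite (hit_hlab hc2) p2; clear; lia.
  have [e _] := @cell_out_hit r.+1 a c2.2 (@hitS r (a, c2.2) eH2 eV2).
  by have := hlab_mono c2.2 c21; rewrite e (hit_hlab hc2) ltnn.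
exists (a', b), ((a, b') :: ps); split=> //=.
- rewrite {1}/crosses /= ha' hb' /=.
  case: (ps) pps bps => //= q qs /andP[pq ->] /andP[/andP[/andP[q1 q2] q3] _].
  rewrite andbT; apply/andP; split=> /=; first exact: leq_trans q1.
  by apply: leq_trans lec.
- by rewrite hit1 hit2 /=; case/andP: hps.
- by rewrite sz.
- rewrite leqnn hb' andbT /= (leq_trans (ltnW c21) lastc) /=.
  apply: sub_all bps => q /andP[/andP[q1 q2] q3].
  by rewrite q2 (leq_trans (ltnW c21) q1) (ltn_trans q3 c22).
Qed.

(* The rays leaving two crossing points either die inside the box they span
   or meet at its far corner. *)
Lemma chain_hit_down r p ps : path crosses p ps -> all (hit X r) (p :: ps) ->
  exists cs,
    [/\ sorted crosses cs, all (hit X r.+1) cs, size cs = size ps &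
        all (fun q => (p.1 < q.1 <= (last p ps).1) && (q.2 <= p.2)) cs].
Proof.
elim: ps p => [|p2 ps IH] p; first by exists [::].
move=> /= /andP[pp2 pps] /and3P[hp hp2 hps].
have [|cs [scs hcs sz bcs]] := IH _ pps; first by rewrite /= hp2.
have [l1 l2] : p.1 < p2.1 /\ p2.2 < p.2 by case/andP: pp2.
have lastp : p2.1 <= (last p2 ps).1.
  elim: (ps) (p2) pps => //= c3 cs' IH' c4 /andP[/andP[l _] /IH'].
  by move=> l3; apply: leq_trans l3; apply: ltnW.
have [c hc bc] : exists2 c, hit X r.+1 c &
    (p.1 < c.1 <= p2.1) && (p2.2 < c.2 <= p.2).
  have eV : V p2.1 p2.2.+1 = r.+1.
    by have [] // := @cell_out_hit r p2.1 p2.2; case: (p2) hp2.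
  have eH : H p.1.+1 p.2 = r.+1.
    by have [] // := @cell_out_hit r p.1 p.2; case: (p) hp.
  have [gtV|leV] := ltnP r.+1 (V p2.1 p.2).
    have [|c hc hit1] := @vlab_jump r.+1 p2.1 p2.2.+1 p.2 _ gtV; first by rewrite eV.
    by exists (p2.1, c) => //=; rewrite l1 leqnn /=; move: hc; clear; lia.
  have [gtH|leH] := ltnP r.+1 (H p2.1 p.2).
    have [|c hc hit1] := @hlab_jump r.+1 p.2 p.1.+1 p2.1 _ gtH; first by rewrite eH.
    by exists (c, p.2) => //=; rewrite l2 leqnn /=; move: hc; clear; lia.
  exists (p2.1, p.2); last by rewrite /= l1 l2 !leqnn.
  apply: hitS => /=.
    by have := hlab_mono p.2 l1; move: leH; rewrite eH; clear; lia.
  by have := vlab_mono p2.1 l2; move: leV; rewrite eV; clear; lia.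
exists (c :: cs); split=> //=.
- case: (cs) scs bcs => //= q qs -> /andP[/andP[/andP[q1 q2] q3] _].
  by rewrite andbT /crosses; lia.
- by rewrite hc.
- by rewrite sz.
- apply/andP; split; first by move: lastp bc; clear; lia.
  apply: sub_all bcs => q /andP[/andP[q1 q2] q3].
  by rewrite q2 (ltn_trans l1 q1) (leq_trans q3 (ltnW l2)).
Qed.

(** Descending one skeleton lengthens the chain by one cell, so chain size plus level is invariant.
    The box is kept because the last cell bounds the rows and the first cell bounds the columns. *)
Lemma hit_chain r a b : hit X r (a, b) ->
  exists ps, [/\ sorted crosses ps, all (hit X 0) ps, size ps = r.+1 &
                 all (fun q => (q.1 <= a) && (q.2 <= b)) ps].
Proof.
suff gen n c cs : path crosses c cs -> all (hit X n) (c :: cs) ->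
    size cs + n = r -> all (fun q => (q.1 <= a) && (q.2 <= b)) (c :: cs) ->
    exists ps, [/\ sorted crosses ps, all (hit X 0) ps, size ps = r.+1 &
                 all (fun q => (q.1 <= a) && (q.2 <= b)) ps].
  by move=> hr; apply: (gen r (a, b) [::]) => //=; rewrite ?hr ?leqnn.
elim: n c cs => [|n IH] c cs pcs hcs sz bcs.
  by exists (c :: cs); split=> //=; lia.
have [p [ps [pps hps szp [p1 p2] bps]]] := chain_hit_up pcs hcs.
apply: (IH p ps) => //; first by lia.
have la : (last c cs).1 <= a.
  by have /andP[] := allP bcs _ (mem_last c cs).
case/andP: bcs => /andP[c1 c2] _ /=.
apply/andP; split; first by lia.
by apply: sub_all bps => q; lia.
Qed.

(** Ascending one skeleton costs one cell, until a single collision is left. *)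
Lemma chain_hit p ps a b : path crosses p ps -> all (hit X 0) (p :: ps) ->
  all (fun q => (q.1 <= a) && (q.2 <= b)) (p :: ps) ->
  exists2 c, hit X (size ps) c & (c.1 <= a) && (c.2 <= b).
Proof.
suff gen n r : forall p ps, size ps = n -> path crosses p ps ->
    all (hit X r) (p :: ps) ->
    all (fun q => (q.1 <= a) && (q.2 <= b)) (p :: ps) ->
    exists2 c, hit X (n + r) c & (c.1 <= a) && (c.2 <= b).
  by move=> h1 h2 h3; rewrite -[size ps]addn0; apply: gen h1 h2 h3.
elim: n r => [|n IH] r q qs sz pqs hqs bqs.
  by exists q; [case/andP: hqs | case/andP: bqs].
have [cs [scs hcs szc bcs]] := chain_hit_down pqs hqs.
case: cs scs hcs szc bcs => [|c cs] scs hcs szc bcs; first by rewrite /= sz in szc.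
rewrite addSnnS; apply: (IH _ c cs) => //; first by move: szc; rewrite sz => -[].
have la : (last q qs).1 <= a.
  by have /andP[] := allP bqs _ (mem_last q qs).
apply: sub_all bcs => x; case/andP: bqs => /andP[c1 c2] _; lia.
Qed.

End Labels.

(** * Oscillating tableaux *)

(* A step [(b, l)] adds ([b = true]) or removes a box in row [l.-1]; the label
   [l = 0] stands for no change. *)
Definition step_allowed (st : bool * nat) (lam : nat -> nat) : bool :=
  if st.2 is r.+1 then
    if st.1 then (r == 0) || (lam r < lam r.-1) else lam r.+1 < lam r
  else true.

Definition apply_step (st : bool * nat) (lam : nat -> nat) : nat -> nat :=
  fun i => if st.2 is r.+1 then
    if i == r then (if st.1 then (lam i).+1 else (lam i).-1) else lam i
  else lam i.

Definition partition_fun (lam : nat -> nat) : Prop := forall i, lam i.+1 <= lam i.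

Fixpoint legal_walk (lam : nat -> nat) (s : seq (bool * nat)) : bool :=
  if s is st :: s' then step_allowed st lam && legal_walk (apply_step st lam) s' else true.

Fixpoint walk_end (lam : nat -> nat) (s : seq (bool * nat)) : nat -> nat :=
  if s is st :: s' then walk_end (apply_step st lam) s' else lam.

Ltac by_cases :=
  repeat (case: eqP => ?); try subst; rewrite /= ?ltnS //; try lia.

Lemma apply_step_part st lam : partition_fun lam -> step_allowed st lam -> partition_fun (apply_step st lam).
Proof.
case: st => b [|r] pl; first by [].
rewrite /step_allowed /apply_step /= => al i; move: (pl i) (pl i.+1) (pl i.-1) al.
by case: b; by_cases.
Qed.

Lemma legal_walk_cat lam s t : legal_walk lam (s ++ t) = legal_walk lam s && legal_walk (walk_end lam s) t.
Proof. by elim: s lam => //= st s IH lam; rewrite IH andbA. Qed.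

Lemma walk_end_cat lam s t : walk_end lam (s ++ t) = walk_end (walk_end lam s) t.
Proof. by elim: s lam => //= st s IH lam; rewrite IH. Qed.

Lemma walk_end_part lam s : partition_fun lam -> legal_walk lam s -> partition_fun (walk_end lam s).
Proof.
by elim: s lam => //= st s IH lam pl /andP[al /IH]; apply; apply: apply_step_part.
Qed.

Lemma apply_step0 b lam : apply_step (b, 0) lam = lam. Proof. by []. Qed.

Definition same_walk lam s t :=
  (legal_walk lam s -> legal_walk lam t /\ walk_end lam t = walk_end lam s).

Lemma same_walk_blocks (A B : nat -> seq (bool * nat)) n lam : partition_fun lam ->
  (forall i mu, i < n -> partition_fun mu -> same_walk mu (A i) (B i)) ->
  same_walk lam (flatten (mkseq A n)) (flatten (mkseq B n)).
Proof.
move=> pl; elim: n => [|n IH] hAB; first by [].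
rewrite /same_walk !mkseqS !flatten_rcons !legal_walk_cat !walk_end_cat => /andP[lA lAn].
have [|lB eB] := IH _ lA; first by move=> i mu ?; apply: hAB; lia.
have [lBn eBn] := hAB n _ (ltnSn n) (walk_end_part pl lA) lAn.
by rewrite eB lB lBn eBn.
Qed.

(** Pushing the boundary path across one cell trades remove-then-add for add-then-remove. If both
    act on the same row, the pair moves one row further, which is legal because the removal showed
    that row to be strictly longer than the next. If neither acts, an arc inserts a box in the first
    row and removes it again. *)
Lemma cell_forward x d u lam : partition_fun lam ->
  same_walk lam [:: (false, d); (true, u)]
    [:: (true, cell_out x u d); (false, cell_out x d u)].
Proof.
move=> pl; rewrite /same_walk /= !andbT /cell_out (eq_sym u d).
case: (eqVneq d u) => [<-|ne].
  case: d => [|r] /=.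
    case: x => //= _; rewrite /step_allowed /apply_step /= ltnS pl; split=> //.
    by apply: funext => i; by_cases.
  rewrite /step_allowed /apply_step /= => /andP[al1 al2]; split.
    by have := pl r.+1; rewrite al1; by_cases.
  by apply: funext => i; by_cases.
case: d u ne => [|r] [|s] //= ne; rewrite /step_allowed /apply_step /=;
  try by rewrite ?andbT.
move=> /andP[al1 al2]; split; last by apply: funext => i; by_cases.
move: al1 al2; case: s ne => [|s] ne /=; by_cases.
Qed.

Definition cell_in (p q : nat) : nat := if p == q then p.-1 else p.

Lemma cell_backward d u lam : partition_fun lam ->
  same_walk lam [:: (true, u); (false, d)]
    [:: (false, cell_in d u); (true, cell_in u d)].
Proof.
move=> pl; rewrite /same_walk /= !andbT /cell_in (eq_sym u d).
case: (eqVneq d u) => [<-|ne].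
  case: d => [|[|r]] //=.
    by rewrite /step_allowed /apply_step /= => _; split=> //; apply: funext => i; by_cases.
  rewrite /step_allowed /apply_step /= => /andP[al1 al2]; split.
    case: r al1 al2 => [|r]; rewrite ?orbT ?orTb ?andbT //=.
    by have := pl r; by_cases.
  by apply: funext => i; by_cases.
case: d u ne => [|r] [|s] //= ne; rewrite /step_allowed /apply_step /=;
  try by rewrite ?andbT.
move=> /andP[al1 al2]; split; last by apply: funext => i; by_cases.
move: al1 al2; case: s ne => [|s] ne /=; by_cases.
Qed.

(** The arc mark can be read off the outgoing labels: both equal 1 exactly at an arc, since a
    collision of nonzero labels leaves with at least 2. *)
Lemma cell_in_out p q :
  cell_out ((p == q) && (p == 1)) (cell_in p q) (cell_in q p) = p.
Proof.
rewrite /cell_in /cell_out (eq_sym q p).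
by case: (eqVneq p q) => [<-|/negbTE->//]; rewrite eqxx; case: p => [|[]].
Qed.

Lemma cell_out_in (x : bool) p q : (x -> p = 0 /\ q = 0) ->
  cell_in (cell_out x p q) (cell_out x q p) = p.
Proof.
rewrite /cell_in /cell_out (eq_sym q p).
case: (eqVneq p q) => [<-|/negbTE->//] _; rewrite eqxx.
by case: p => [|p] //=; case: x.
Qed.

(** The staircase boundary as a walk: each vertex owns a removal slot and an addition slot, and
    label 0 leaves a slot empty. *)
Definition step_blocks (n : nat) (D U : nat -> nat) : seq (bool * nat) :=
  flatten (mkseq (fun i => [:: (false, D i); (true, U i)]) n).

(** Regrouping by half a block pairs [U i] with [D i.+1], the two edges leaving one cell of the last
    antidiagonal. *)
Lemma blocks_shift n D U :
  step_blocks n.+1 D U = (false, D 0) ::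
    flatten (mkseq (fun i => [:: (true, U i); (false, D i.+1)]) n)
      ++ [:: (true, U n)].
Proof.
rewrite /step_blocks; elim: n => [|n IH] //.
by rewrite mkseqS flatten_rcons IH [mkseq _ n.+1]mkseqS flatten_rcons /= -!catA.
Qed.

Definition closed_blocks n D U : Prop :=
  legal_walk (fun=> 0) (step_blocks n D U) /\ walk_end (fun=> 0) (step_blocks n D U) = fun=> 0.

Lemma partition_fun0 : partition_fun (fun=> 0). Proof. by []. Qed.
#[local] Hint Resolve partition_fun0 : core.

Lemma closed_blocksS n (D U D' U' : nat -> nat) (x : nat -> bool) :
  D' 0 = 0 -> U' n = 0 ->
  (forall i, i < n -> U' i = cell_out (x i) (U i) (D i)) ->
  (forall i, i < n -> D' i.+1 = cell_out (x i) (D i) (U i)) ->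
  closed_blocks n D U -> closed_blocks n.+1 D' U'.
Proof.
move=> D0 U0 eU eD [le fi]; rewrite /closed_blocks blocks_shift D0 U0.
have := @same_walk_blocks (fun i => [:: (false, D i); (true, U i)])
   (fun i => [:: (true, U' i); (false, D' i.+1)]) n (fun=> 0) partition_fun0.
case=> // [i mu lt pm|le' fi'].
  by rewrite eU // eD //; apply: cell_forward.
by rewrite /= legal_walk_cat walk_end_cat apply_step0 le' fi' /= apply_step0.
Qed.

(** Nothing can be removed from the empty shape and no addition can end there, which forces the two
    extreme slots to be empty; the rest is pulled back cell by cell. *)
Lemma closed_blocks_pred n (D' U' : nat -> nat) :
  closed_blocks n.+1 D' U' -> [/\ D' 0 = 0, U' n = 0 &
  closed_blocks n (fun i => cell_in (D' i.+1) (U' i))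
                  (fun i => cell_in (U' i) (D' i.+1))].
Proof.
rewrite /closed_blocks blocks_shift /= legal_walk_cat walk_end_cat.
case=> /andP[al1 /andP[le1 /= le2]] fi1.
have D0 : D' 0 = 0 by move: al1; rewrite /step_allowed /=; case: (D' 0).
move: le1 le2 fi1; rewrite D0 apply_step0 => le1 le2 fi1.
have U0 : U' n = 0.
  move: fi1; case: (U' n) => //= r /(congr1 (fun f => f r)).
  by rewrite /apply_step /= eqxx.
split=> //; have := @same_walk_blocks (fun i => [:: (true, U' i); (false, D' i.+1)])
   (fun i => [:: (false, cell_in (D' i.+1) (U' i)); (true, cell_in (U' i) (D' i.+1))])
   n (fun=> 0) partition_fun0.
case=> // [i mu lt pm|le' fi']; first exact: cell_backward.
by split=> //; rewrite /step_blocks fi'; move: fi1; rewrite U0 apply_step0.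
Qed.

(** [cell_out] ignores a mark unless both entering labels are 0. Excluding such invisible marks is
    what makes the labels determine [X]. *)
Definition placed (X : nat -> nat -> bool) : Prop :=
  forall i b, X i b -> hit X 0 (i, b).

Lemma hlab_vlab_local X Y n :
  (forall i b, i + b < n -> X i b = Y i b) ->
  forall i b, i + b <= n -> hlab X i b = hlab Y i b /\ vlab X i b = vlab Y i b.
Proof.
move=> eXY i b; move: {2}(i + b) (leqnn (i + b)) => s.
elim: s i b => [|s IH] i b le1 le2.
  have [-> ->] : i = 0 /\ b = 0 by lia.
  by rewrite !hlab0 !vlab0.
split.
  case: i le1 le2 => [|i] le1 le2; first by rewrite !hlab0.
  rewrite !hlabS eXY; last by lia.
  by have [||-> ->] := IH i b; lia.
case: b le1 le2 => [|b] le1 le2; first by rewrite !vlab0.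
rewrite !vlabS eXY; last by lia.
by have [||-> ->] := IH i b; lia.
Qed.

Lemma labels_closed X n : closed_blocks n (fun i => hlab X i (n.-1 - i))
  (fun i => vlab X i (n.-1 - i)).
Proof.
elim: n => [|n IH]; first by [].
apply: (closed_blocksS (x := fun i => X i (n.-1 - i))) IH => /=.
- by [].
- by rewrite subnn.
- by move=> i lt; rewrite -vlabS; congr vlab; lia.
- by move=> i lt; rewrite -hlabS; congr hlab; lia.
Qed.

Lemma labels_surj n D U : closed_blocks n D U ->
  exists X, [/\ placed X, forall i b, X i b -> i + b < n.-1,
    forall i, i < n -> hlab X i (n.-1 - i) = D i &
    forall i, i < n -> vlab X i (n.-1 - i) = U i].
Proof.
elim: n D U => [|n IH] D U; first by exists (fun _ _ => false).
move=> /closed_blocks_pred[D0 U0 /IH[X [pX sX hX vX]]].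
(* The arcs of the smaller staircase are kept; a cell of the new antidiagonal is marked when both
   labels leaving it are 1. *)
pose Y i b := if i + b < n.-1 then X i b else
  (i + b == n.-1) && (0 < n) && ((U i == D i.+1) && (U i == 1)).
have eXY i b : i + b < n.-1 -> X i b = Y i b by rewrite /Y => ->.
have loc := hlab_vlab_local eXY.
have hY i : i < n -> hlab Y i (n.-1 - i) = cell_in (D i.+1) (U i).
  by move=> lt; have [|<- _] := loc i (n.-1 - i); [lia|rewrite hX].
have vY i : i < n -> vlab Y i (n.-1 - i) = cell_in (U i) (D i.+1).
  by move=> lt; have [|_ <-] := loc i (n.-1 - i); [lia|rewrite vX].
have xY i : i < n -> Y i (n.-1 - i) = (U i == D i.+1) && (U i == 1).
  move=> lt; rewrite /Y ifN; last by lia.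
  by rewrite (_ : i + (n.-1 - i) == n.-1) 1?(leq_ltn_trans _ lt) //; lia.
exists Y; split=> /=.
- move=> i b; have [lt Xib|ge] := ltnP (i + b) n.-1.
    rewrite -eXY // in Xib; have := pX _ _ Xib; rewrite /hit /= eXY //.
    by have [|-> ->] := loc i b; first exact: ltnW.
  move=> Yib; have eb : b = n.-1 - i.
    by move: Yib; rewrite /Y ifN; lia.
  have ni : i < n by move: Yib; rewrite /Y ifN; lia.
  move: Yib; rewrite eb xY // => /andP[/eqP e /eqP e1].
  by rewrite /hit /= xY // hY // vY // -e e1.
- by move=> i b; rewrite /Y; case: ifP; lia.
- case=> [|i] lt; first by rewrite hlab0 D0.
  rewrite (_ : n - i.+1 = n.-1 - i); last by lia.
  rewrite hlabS xY // hY // vY // (_ : _ && _ = (D i.+1 == U i) && (D i.+1 == 1)).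
    exact: cell_in_out.
  by rewrite eq_sym; case: eqP => // ->.
- move=> i; rewrite ltnS leq_eqVlt => /orP[/eqP->|lt].
    by rewrite subnn vlab0 U0.
  rewrite (_ : n - i = (n.-1 - i).+1); last by lia.
  by rewrite vlabS xY // hY // vY // cell_in_out.
Qed.

Lemma labels_inj X Y n : placed X -> placed Y ->
  (forall i, i < n -> hlab X i (n.-1 - i) = hlab Y i (n.-1 - i)) ->
  (forall i, i < n -> vlab X i (n.-1 - i) = vlab Y i (n.-1 - i)) ->
  forall i b, i + b < n.-1 -> X i b = Y i b.
Proof.
move=> pX pY; elim: n => [|n IH] eH eV i b; first by [].
rewrite /= => lt.
have inv Z j : placed Z -> j < n ->
    hlab Z j (n.-1 - j) = cell_in (hlab Z j.+1 (n - j.+1)) (vlab Z j (n - j)) /\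
    vlab Z j (n.-1 - j) = cell_in (vlab Z j (n - j)) (hlab Z j.+1 (n - j.+1)).
  move=> pZ jn; rewrite (_ : n - j.+1 = n.-1 - j); last by lia.
  rewrite (_ : n - j = (n.-1 - j).+1); last by lia.
  have hz : Z j (n.-1 - j) -> hlab Z j (n.-1 - j) = 0 /\ vlab Z j (n.-1 - j) = 0.
    by move=> /pZ hh; have := hit_hlab hh; have := hit_vlab hh.
  by rewrite hlabS vlabS !cell_out_in //; move=> /hz[].
have eH' j : j < n -> hlab X j (n.-1 - j) = hlab Y j (n.-1 - j).
  by move=> jn; have [-> _] := inv X j pX jn; have [-> _] := inv Y j pY jn;
     rewrite eH // eV // ltnW.
have eV' j : j < n -> vlab X j (n.-1 - j) = vlab Y j (n.-1 - j).
  by move=> jn; have [_ ->] := inv X j pX jn; have [_ ->] := inv Y j pY jn;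
     rewrite eH // eV // ltnW.
have [lt'|ge] := ltnP (i + b) n.-1; first exact: IH.
have -> : b = n.-1 - i by lia.
have ni : i < n by lia.
have char Z : placed Z -> Z i (n.-1 - i) =
    [&& hlab Z i (n.-1 - i) == 0, vlab Z i (n.-1 - i) == 0 &
        hlab Z i.+1 (n - i.+1) == 1].
  move=> pZ; apply/idP/idP => [/pZ hh|].
    rewrite (hit_hlab hh) (hit_vlab hh) /=.
    by have [<- _] := cell_out_hit hh; apply/eqP; congr hlab; lia.
  case/and3P=> /eqP h0 /eqP v0; rewrite (_ : n - i.+1 = n.-1 - i); last by lia.
  by rewrite hlabS h0 v0 /cell_out /=; case: (Z _ _).
by rewrite !char // eH' // eV' // eH.
Qed.

(** * Matchings and walks *)

Fixpoint walks (d n : nat) (lam : nat -> nat) : nat :=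
  if n is n'.+1 then
    \sum_(r < d) \sum_(b : bool)
      step_allowed (b, r.+1) lam * walks d n' (apply_step (b, r.+1) lam)
  else all (fun i => lam i == 0) (iota 0 d).

Definition step_of d (c : bool * 'I_d) : bool * nat := (c.1, c.2.+1).

Definition closed_word d (lam : nat -> nat) (w : seq (bool * 'I_d)) : bool :=
  legal_walk lam (map (@step_of d) w) &&
  all (fun i => walk_end lam (map (@step_of d) w) i == 0) (iota 0 d).

Lemma big_tuple_cons (T : finType) n (F : n.+1.-tuple T -> nat) :
  \sum_w F w = \sum_c \sum_(w : n.-tuple T) F [tuple of c :: w].
Proof.
rewrite pair_big /=.
rewrite (reindex (fun p : T * n.-tuple T => [tuple of p.1 :: p.2])) //=.
exists (fun w => (thead w, [tuple of behead w])) => [[c w] _|w _] /=.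
  by rewrite theadE; congr (_, _); apply: val_inj.
by rewrite -tuple_eta.
Qed.

Lemma card_closed_word d n lam :
  #|[set w : n.-tuple (bool * 'I_d) | closed_word lam w]| = walks d n lam.
Proof.
rewrite -sum1_card.
under eq_bigl do rewrite inE.
rewrite big_mkcond /=; elim: n lam => [|n IH] lam.
  rewrite (bigD1 [tuple]) //= big1 ?addn0 => [|w /negP[]]; last first.
    by apply/eqP; apply: tuple0.
  by rewrite /closed_word /=; case: all.
rewrite big_tuple_cons /= [RHS]exchange_big [RHS]pair_big /=.
apply: eq_bigr => -[b r] _; rewrite -IH.
case al : (step_allowed (b, r.+1) lam); last first.
  by rewrite mul0n big1 // => w _; rewrite /closed_word /= al.
by rewrite mul1n; apply: eq_bigr => w _; rewrite /closed_word /= al.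
Qed.

Section Matching.
Variables (m : nat) (M : {set 'I_m * 'I_m}).
Hypothesis pM : perfect_matching M.

Definition arc_cell (i b : nat) : bool :=
  [exists a in M, (nat_of_ord a.1 == i) && ((a.2 + b).+1 == m)].

Lemma arc_cellP i b : reflect
  (exists u w : 'I_m, [/\ (u, w) \in M, u = i :> nat & (w + b).+1 = m])
  (arc_cell i b).
Proof.
apply: (iffP exists_inP) => [[[u w] aM /andP[/eqP ? /eqP ?]]|[u [w [aM eu ew]]]].
  by exists u, w.
by exists (u, w) => //=; rewrite eu ew !eqxx.
Qed.

Lemma arc_lt (u w : 'I_m) : (u, w) \in M -> u < w.
Proof. by case/andP: pM => /forall_inP h _ /h. Qed.

Lemma arc_uniq (v u w u' w' : 'I_m) : (u, w) \in M -> (u', w') \in M ->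
  (u == v) || (w == v) -> (u' == v) || (w' == v) -> u = u' /\ w = w'.
Proof.
case/andP: pM => _ /forallP/(_ v)/cards1P[x ex] aM cM av cv.
have /set1P e : (u, w) \in [set x] by rewrite -ex inE aM.
have /set1P : (u', w') \in [set x] by rewrite -ex inE cM.
by rewrite -e => -[-> ->].
Qed.

Lemma arc_exists (v : 'I_m) :
  exists u w : 'I_m, (u, w) \in M /\ (u == v) || (w == v).
Proof.
case/andP: pM => _ /forallP/(_ v)/cards1P[[u w] ex].
have : (u, w) \in [set (u, w)] by rewrite set11.
by rewrite -ex inE => /andP[]; exists u, w.
Qed.

Lemma arc_cell_lt i b : arc_cell i b -> i + b < m.-1.
Proof. by case/arc_cellP=> u [w [/arc_lt]]; have := ltn_ord w; lia. Qed.

(** A positive label entering the cell of an arc stems from another arc in its row or column, that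
    is, a second arc at one of its endpoints. *)
Lemma arc_cell_placed : placed arc_cell.
Proof.
move=> i b Xib; rewrite /hit /= Xib andbT -!leqn0.
have /arc_cellP[u [w [aM ui wb]]] := Xib.
apply/andP; split; rewrite leqNgt; apply/negP => lt.
  have [c /andP[_ ci] /and3P[_ _ /= /arc_cellP[u' [w' [a'M u'c w'b]]]]] :=
    @hlab_jump _ 0 b 0 i (leq0n 0) lt.
  have e2 : w' = w by apply: ord_inj; lia.
  have [e1 _] : u' = u /\ w' = w.
    by apply: (@arc_uniq w) => //; rewrite ?e2 eqxx orbT.
  by move: ci; rewrite -u'c e1 ui ltnn.
have [c /andP[_ cb] /and3P[_ _ /= /arc_cellP[u' [w' [a'M u'c w'b]]]]] :=
    @vlab_jump _ 0 i 0 b (leq0n 0) lt.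
have e1 : u' = u by apply: ord_inj; lia.
have [_ e2] : u' = u /\ w' = w.
  by apply: (@arc_uniq u) => //; rewrite ?e1 eqxx.
by rewrite e2 in w'b; lia.
Qed.

Lemma hlab_pos (v : 'I_m) :
  0 < hlab arc_cell v (m.-1 - v) <-> exists u, (u, v) \in M.
Proof.
split=> [lt|[u aM]].
  have [c /andP[_ cv] /and3P[_ _ /= /arc_cellP[u [w [aM _ e]]]]] :=
    @hlab_jump _ 0 _ 0 v (leq0n 0) lt.
  have <- : w = v by apply: ord_inj; have := ltn_ord v; lia.
  by exists u.
have uv := arc_lt aM.
have Xa : arc_cell u (m.-1 - v).
  by apply/arc_cellP; exists u, v; split=> //; have := ltn_ord v; lia.
have [h _] := cell_out_hit (arc_cell_placed Xa).
by have := hlab_mono arc_cell (m.-1 - v) uv; rewrite h; lia.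
Qed.

Lemma vlab_pos (v : 'I_m) :
  0 < vlab arc_cell v (m.-1 - v) <-> exists w, (v, w) \in M.
Proof.
split=> [lt|[w aM]].
  have [c /andP[_ cv] /and3P[_ _ /= /arc_cellP[u [w [aM e _]]]]] :=
    @vlab_jump _ 0 v 0 _ (leq0n 0) lt.
  have <- : u = v by apply: ord_inj.
  by exists w.
have vw := arc_lt aM.
have Xa : arc_cell v (m.-1 - w).
  by apply/arc_cellP; exists v, w; split=> //; have := ltn_ord w; lia.
have [_ h] := cell_out_hit (arc_cell_placed Xa).
have le : (m.-1 - w).+1 <= m.-1 - v by have := ltn_ord w; lia.
by have := vlab_mono arc_cell v le; rewrite h; lia.
Qed.

Lemma hlab_vlab_pos (v : 'I_m) :
  (hlab arc_cell v (m.-1 - v) == 0) = (vlab arc_cell v (m.-1 - v) != 0).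
Proof.
rewrite -lt0n -[LHS]negbK -lt0n; apply/idP/idP.
  move/negP => h; have [u [w [aM /orP[/eqP e|/eqP e]]]] := arc_exists v.
    by apply/vlab_pos; exists w; rewrite -e.
  by case: h; apply/hlab_pos; exists u; rewrite -e.
case/vlab_pos=> w aM; apply/negP => /hlab_pos[u cM].
have [e1 e2] : u = v /\ v = w by apply: (@arc_uniq v) => //; rewrite eqxx ?orbT.
by have := arc_lt aM; rewrite -e2 ltnn.
Qed.

Lemma noncrossing_labels k : noncrossing k.+1 M ->
  forall v : 'I_m, hlab arc_cell v (m.-1 - v) <= k /\ vlab arc_cell v (m.-1 - v) <= k.
Proof.
move=> /negP nc v.
suff key i b : i + b < m.-1 -> ~ hit arc_cell k (i, b).
  split; rewrite leqNgt; apply/negP => lt.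
    have [c /andP[_ cv] hc] := @hlab_jump _ k _ 0 v (leq0n k) lt.
    by apply: key hc; have := ltn_ord v; lia.
  have [c /andP[_ cv] hc] := @vlab_jump _ k v 0 _ (leq0n k) lt.
  by apply: key hc; have := ltn_ord v; lia.
move=> lt /hit_chain[ps [sps hps sz bps]]; apply: nc.
have /fin_all_exists[a /fin_all_exists[c ha]] : forall s : 'I_k.+1,
    exists u w : 'I_m, [/\ (u, w) \in M, u = (nth (0, 0) ps s).1 :> nat &
                           (w + (nth (0, 0) ps s).2).+1 = m].
  move=> s; have ls : s < size ps by rewrite sz.
  have := allP hps _ (mem_nth (0, 0) ls).
  by case/and3P=> _ _ /= /arc_cellP.
apply/existsP; exists [ffun s => (a s, c s)]; apply/andP; split.
  by apply/forallP => s; rewrite ffunE; case: (ha s).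
have bnd (s : 'I_k.+1) : (nth (0, 0) ps s).1 <= i /\ (nth (0, 0) ps s).2 <= b.
  have ls : s < size ps by rewrite sz.
  by have /andP[] := allP bps _ (mem_nth (0, 0) ls).
apply/forallP => s; apply/forallP => t; rewrite !ffunE /=.
have [_ s1 s2] := ha s; have [_ t1 t2] := ha t.
have [bs1 bs2] := bnd s; have [bt1 bt2] := bnd t.
(* The box supplies the remaining inequality: the opener of [s] is at most [i], and [i < m - 1 - b],
   which is at most the closer of [t]. *)
apply/andP; split; last by move: s1 t2 bs1 bt2 lt; clear; lia.
apply/implyP => st.
have tr : transitive crosses by move=> p q r; rewrite /crosses; lia.
have : crosses (nth (0, 0) ps s) (nth (0, 0) ps t).
  by apply: (sorted_ltn_nth tr) => //; rewrite inE sz.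
by rewrite /crosses; move: s1 s2 t1 t2; clear; lia.
Qed.

Lemma labels_noncrossing k :
  (forall v : 'I_m, hlab arc_cell v (m.-1 - v) <= k) -> noncrossing k.+1 M.
Proof.
move=> hk; apply/negP => /existsP[a /andP[/forallP aM /forallP cr]].
pose u (s : 'I_k.+1) : 'I_m := (a s).1; pose w (s : 'I_k.+1) : 'I_m := (a s).2.
have uwM s : (u s, w s) \in M by rewrite -surjective_pairing.
have crP (s t : 'I_k.+1) : (s < t -> u s < u t /\ w s < w t) /\ u s < w t.
  have /forallP/(_ t)/andP[/implyP h1 h2] := cr s.
  by split=> // /h1/andP.
pose f (s : 'I_k.+1) : nat * nat := (nat_of_ord (u s), m.-1 - w s).
have crf (s t : 'I_k.+1) : s < t -> crosses (f s) (f t).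
  move=> st; rewrite /crosses /=; have [/(_ st)[-> l] _] := crP s t.
  by have := ltn_ord (w t); have := ltn_ord (w s); lia.
have es : size (map f (enum 'I_k.+1)) = k.+1 by rewrite size_map size_enum_ord.
have srt : sorted crosses (map f (enum 'I_k.+1)).
  apply/(sortedP (0, 0)) => i; rewrite es => lt.
  rewrite !(nth_map ord0) -?enumT ?size_enum_ord //; try exact: ltnW.
  by apply: crf; rewrite !nth_enum_ord // ltnW.
have hf p : p \in map f (enum 'I_k.+1) -> hit arc_cell 0 p /\
    (p.1 <= u ord_max) && (p.2 <= m.-1 - w ord0).
  case/mapP => s _ ->; split.
    apply: arc_cell_placed; apply/arc_cellP; exists (u s), (w s); split=> //=.
    by have := ltn_ord (w s); lia.
  rewrite /=; apply/andP; split.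
    have [->//|ne] := eqVneq s ord_max.
    have lt : s < (ord_max : 'I_k.+1).
      by have := ltn_ord s; have : nat_of_ord s != k; [exact: ne|rewrite /=; lia].
    by have [/(_ lt)[/ltnW]] := crP s ord_max.
  have [->//|ne] := eqVneq s ord0.
  have lt : (ord0 : 'I_k.+1) < s.
    by have : nat_of_ord s != 0; [exact: ne|rewrite /=; lia].
  by have [/(_ lt)[_ l]] := crP ord0 s; lia.
move: es srt hf; case: (map f (enum 'I_k.+1)) => // p ps [sz] srt hf.
have [|||c hc bc] := @chain_hit arc_cell p ps (u ord_max) (m.-1 - w ord0).
- exact: srt.
- by apply/allP => q /hf[].
- by apply/allP => q /hf[].
rewrite sz in hc.
(* The last opener precedes the first closer, so the collision lies inside the staircase, and its
   outgoing label [k.+1] survives to the boundary edge of its column. *)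
have [_ l0] := crP ord_max ord0.
have cm : c.1 + c.2 < m.-1.
  by move: bc l0 (ltn_ord (w ord0)); clear; lia.
have vm : m.-1 - c.2 < m by move: cm; clear; lia.
have := hk (Ordinal vm); rewrite /= (_ : m.-1 - (m.-1 - c.2) = c.2); last first.
  by move: cm; clear; lia.
have lc : c.1.+1 <= m.-1 - c.2 by move: cm; clear; lia.
have := hlab_mono arc_cell c.2 lc.
have [-> _] : hlab arc_cell c.1.+1 c.2 = k.+1 /\ vlab arc_cell c.1 c.2.+1 = k.+1.
  by apply: cell_out_hit; case: (c) hc.
by clear; lia.
Qed.

End Matching.

Lemma flatten_mkseq1 (T : Type) (f : nat -> T) n :
  flatten (mkseq (fun i => [:: f i]) n) = mkseq f n.
Proof. by elim: n => // n IH; rewrite !mkseqS flatten_rcons IH cats1. Qed.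

Definition block_step (D U : nat -> nat) (i : nat) : bool * nat :=
  if U i == 0 then (false, D i) else (true, U i).

Lemma closed_blocks_word n D U :
  (forall i, i < n -> (D i == 0) = (U i != 0)) ->
  closed_blocks n D U <-> legal_walk (fun=> 0) (mkseq (block_step D U) n) /\
    walk_end (fun=> 0) (mkseq (block_step D U) n) = fun=> 0.
Proof.
move=> one; rewrite -flatten_mkseq1 /closed_blocks /step_blocks.
have eqv i mu : i < n ->
    same_walk mu [:: (false, D i); (true, U i)] [:: block_step D U i] /\
    same_walk mu [:: block_step D U i] [:: (false, D i); (true, U i)].
  move=> /one; rewrite /same_walk /block_step.
  by case: (D i) (U i) => [|x] [|y] //= _; rewrite /= ?andbT.
split=> -[le fi].
  have [|->->] := @same_walk_blocks (fun i => [:: (false, D i); (true, U i)])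
    (fun i => [:: block_step D U i]) n (fun=> 0) partition_fun0 _ le => //.
  by move=> i mu /eqv h _; case: (h mu).
have [|->->] := @same_walk_blocks (fun i => [:: block_step D U i])
  (fun i => [:: (false, D i); (true, U i)]) n (fun=> 0) partition_fun0 _ le => //.
by move=> i mu /eqv h _; case: (h mu).
Qed.

Lemma walk_end_ge d lam (w : seq (bool * 'I_d)) i : d <= i ->
  walk_end lam (map (@step_of d) w) i = lam i.
Proof.
move=> di; elim: w lam => //= -[b r] w IH lam; rewrite IH /apply_step /=.
by case: eqP => // e; have := ltn_ord r; lia.
Qed.

Lemma closed_wordE d (w : seq (bool * 'I_d)) :
  closed_word (fun=> 0) w <-> legal_walk (fun=> 0) (map (@step_of d) w) /\
    walk_end (fun=> 0) (map (@step_of d) w) = fun=> 0.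
Proof.
split=> [/andP[le /allP al]|[le fi]].
  split=> //; apply: funext => i; have [lt|ge] := ltnP i d; last exact: walk_end_ge.
  by apply/eqP/al; rewrite mem_iota.
by apply/andP; split=> //; apply/allP => i _; rewrite fi.
Qed.

Section Bijection.
Variables (e m : nat).
Local Notation d := e.+1.

Definition word_of (M : {set 'I_m * 'I_m}) : m.-tuple (bool * 'I_d) :=
  [tuple let l := block_step (fun i => hlab (arc_cell M) i (m.-1 - i))
                             (fun i => vlab (arc_cell M) i (m.-1 - i)) v in
         (l.1, inord l.2.-1) | v < m].

Definition nc_matchings : {set {set 'I_m * 'I_m}} :=
  [set M | perfect_matching M && noncrossing e.+2 M].

Lemma map_word_of M : M \in nc_matchings ->
  map (@step_of d) (word_of M) =
  mkseq (block_step (fun i => hlab (arc_cell M) i (m.-1 - i))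
                    (fun i => vlab (arc_cell M) i (m.-1 - i))) m.
Proof.
rewrite inE => /andP[pM nM].
apply: (@eq_from_nth _ (false, 0)); first by rewrite size_map size_tuple size_mkseq.
move=> i; rewrite size_map size_tuple => im.
rewrite nth_mkseq // (nth_map (false, ord0)) ?size_tuple //.
rewrite -[i]/(nat_of_ord (Ordinal im)) -tnth_nth tnth_mktuple /=.
have [lh lv] := noncrossing_labels pM nM (Ordinal im).
have := hlab_vlab_pos pM (Ordinal im); move: lh lv => /=.
rewrite /block_step /step_of.
by case: (hlab _ _ _) (vlab _ _ _) => [|x] [|y] //= lx ly _; rewrite inordK.
Qed.

Lemma word_of_closed M : M \in nc_matchings -> closed_word (fun=> 0) (word_of M).
Proof.
move=> hM; apply/closed_wordE; rewrite map_word_of //.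
apply/closed_blocks_word; last exact: labels_closed.
move=> i im; move: hM; rewrite inE => /andP[pM _].
exact: (hlab_vlab_pos pM (Ordinal im)).
Qed.

Lemma word_of_inj : {in nc_matchings &, injective word_of}.
Proof.
move=> M N hM hN eMN.
have pM : perfect_matching M by move: hM; rewrite inE => /andP[].
have pN : perfect_matching N by move: hN; rewrite inE => /andP[].
have eb i : i < m ->
    hlab (arc_cell M) i (m.-1 - i) = hlab (arc_cell N) i (m.-1 - i) /\
    vlab (arc_cell M) i (m.-1 - i) = vlab (arc_cell N) i (m.-1 - i).
  move=> im; have := congr1 (fun w => nth (false, 0) (map (@step_of d) w) i)
    (congr1 val eMN).
  rewrite !map_word_of // !nth_mkseq // /block_step.
  have := hlab_vlab_pos pM (Ordinal im); have := hlab_vlab_pos pN (Ordinal im).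
  move=> /=.
  by case: (hlab _ _ _) (vlab _ _ _) (hlab _ _ _) (vlab _ _ _)
     => [|x] [|y] [|z] [|t] //= _ _ [->].
have ex i b : arc_cell M i b = arc_cell N i b.
  apply/idP/idP => h; [have lt := arc_cell_lt pM h|have lt := arc_cell_lt pN h].
    rewrite -(labels_inj (arc_cell_placed pM) (arc_cell_placed pN) _ _ lt) //.
      by move=> j /eb[].
    by move=> j /eb[].
  rewrite (labels_inj (arc_cell_placed pM) (arc_cell_placed pN) _ _ lt) //.
    by move=> j /eb[].
  by move=> j /eb[].
have sub P Q : (forall i b, arc_cell P i b -> arc_cell Q i b) ->
    forall u w : 'I_m, (u, w) \in P -> (u, w) \in Q.
  move=> h u w uw; have : arc_cell Q u (m.-1 - w).
    by apply/h/arc_cellP; exists u, w; split=> //; have := ltn_ord w; lia.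
  case/arc_cellP=> u' [w' [h' eu ew]].
  have <- : u' = u by apply: ord_inj.
  by have <- : w' = w by apply: ord_inj; have := ltn_ord w; lia.
apply/setP => -[u w]; apply/idP/idP; apply: sub => i b; by rewrite ex.
Qed.

Lemma word_of_surj (w : m.-tuple (bool * 'I_d)) : closed_word (fun=> 0) w ->
  exists2 M, M \in nc_matchings & word_of M = w.
Proof.
move=> /closed_wordE cw.
pose s i := nth (false, 0) (map (@step_of d) w) i.
pose D i := if (s i).1 then 0 else (s i).2.
pose U i := if (s i).1 then (s i).2 else 0.
have sb i : i < m -> 0 < (s i).2 <= d.
  by move=> im; rewrite /s (nth_map (false, ord0)) ?size_tuple //=.
have eb i : i < m -> block_step D U i = s i.
  move=> /sb; rewrite /block_step /D /U; case: (s i) => [[] l] //= /andP[l0 _].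
  by case: l l0.
have es : mkseq (block_step D U) m = map (@step_of d) w.
  apply: (@eq_from_nth _ (false, 0)); first by rewrite size_mkseq size_map size_tuple.
  by move=> i; rewrite size_mkseq => im; rewrite nth_mkseq // eb.
have one i : i < m -> (D i == 0) = (U i != 0).
  by move=> /sb; rewrite /D /U; case: (s i) => [[] [|l]].
have /labels_surj[X [pX sX hX vX]] : closed_blocks m D U.
  by apply/closed_blocks_word; rewrite ?es.
pose M := [set a : 'I_m * 'I_m | X a.1 (m.-1 - a.2)].
have cM i b : arc_cell M i b = X i b.
  apply/arc_cellP/idP => [[u [v []]]|Xib].
    rewrite inE /= => h <- eb'; suff -> : b = m.-1 - v by [].
    by have := ltn_ord v; lia.
  have lt := sX _ _ Xib.
  have im : i < m by lia.
  have bm : m.-1 - b < m by lia.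
  exists (Ordinal im), (Ordinal bm); split=> //=; last by lia.
  by rewrite inE /= (_ : m.-1 - (m.-1 - b) = b) //; lia.
have {cM} cM : arc_cell M = X by apply: funext => i; apply: funext => b.
have ltM (u v : 'I_m) : (u, v) \in M -> u < v.
  by rewrite inE /= => /sX; have := ltn_ord v; lia.
(* After the first arc of a row the ray carries a positive label, so a second one would violate
   [placed]. *)
have row (u v v' : 'I_m) : (u, v) \in M -> (u, v') \in M -> v = v'.
  rewrite !inE /= => h1 h2.
  wlog lt : v v' h1 h2 / v < v'.
    move=> H; case: (ltngtP v v') => [l|l|/ord_inj //]; first exact: H.
    by apply/esym; apply: H.
  have [_ e1] := cell_out_hit (pX _ _ h2).
  have l : (m.-1 - v').+1 <= m.-1 - v by have := ltn_ord v'; lia.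
  by have := vlab_mono X u l; rewrite e1 (hit_vlab (pX _ _ h1)).
have col (u u' v : 'I_m) : (u, v) \in M -> (u', v) \in M -> u = u'.
  rewrite !inE /= => h1 h2.
  wlog lt : u u' h1 h2 / u < u'.
    move=> H; case: (ltngtP u u') => [l|l|/ord_inj //]; first exact: H.
    by apply/esym; apply: H.
  have [e1 _] := cell_out_hit (pX _ _ h1).
  by have := hlab_mono X (m.-1 - v) lt; rewrite e1 (hit_hlab (pX _ _ h2)).
have hpos (u v : 'I_m) : (u, v) \in M -> U v = 0.
  move=> uv; apply/eqP; rewrite -[_ == _]negbK -one // -lt0n -hX //.
  have Xuv : X u (m.-1 - v) by move: uv; rewrite inE.
  have [e1 _] := cell_out_hit (pX _ _ Xuv).
  by have := hlab_mono X (m.-1 - v) (ltM _ _ uv); rewrite e1.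
have vpos (u v : 'I_m) : (u, v) \in M -> U u <> 0.
  move=> uv; rewrite -vX //.
  have Xuv : X u (m.-1 - v) by move: uv; rewrite inE.
  have [_ e1] := cell_out_hit (pX _ _ Xuv).
  have l : (m.-1 - v).+1 <= m.-1 - u by have := ltM _ _ uv; have := ltn_ord v; lia.
  by have := vlab_mono X u l; rewrite e1; lia.
have pM : perfect_matching M.
  apply/andP; split; first by apply/forall_inP => -[u v] /ltM.
  apply/forallP => v; apply/cards1P.
  suff [u [u' [uM uv]]] : exists u u' : 'I_m, (u, u') \in M /\ (u == v) || (u' == v).
    exists (u, u'); apply/setP => -[x y]; rewrite !inE /=.
    apply/andP/eqP => [[xM xv]|[-> ->]]; last by move: uM; rewrite inE.
    have {}xM : (x, y) \in M by rewrite inE.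
    case/orP: uv xv => /eqP uv /orP[] /eqP xv.
    - by rewrite -uv in xv; rewrite xv in xM *; rewrite (row _ _ _ xM uM).
    - by case: (vpos _ _ uM); rewrite uv; apply: (hpos x); rewrite -xv.
    - by case: (vpos _ _ xM); rewrite xv; apply: (hpos u); rewrite -uv.
    - by rewrite -uv in xv; rewrite xv in xM *; rewrite (col _ _ _ xM uM).
  have vm := ltn_ord v; case: (eqVneq (U v) 0) => [U0|U1].
    have : 0 < D v by rewrite lt0n one // U0.
    rewrite -hX // => lt.
    have [c /andP[_ cv] /and3P[_ _ /= Xc]] := @hlab_jump _ 0 _ 0 v (leq0n 0) lt.
    exists (Ordinal (ltn_trans cv vm)), v; rewrite eqxx orbT; split=> //.
    by rewrite inE.
  move: U1; rewrite -lt0n -vX // => lt.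
  have [c /andP[_ cv] /and3P[_ _ /= Xc]] := @vlab_jump _ 0 v 0 _ (leq0n 0) lt.
  have cm : m.-1 - c < m by lia.
  exists v, (Ordinal cm); rewrite eqxx; split=> //.
  by rewrite inE /= (_ : m.-1 - (m.-1 - c) = c) //; lia.
have lD (v : 'I_m) : hlab (arc_cell M) v (m.-1 - v) <= d.
  by rewrite cM hX // /D; case: ifP => // _; case/andP: (sb v (ltn_ord v)).
have hM : M \in nc_matchings by rewrite inE pM; apply: labels_noncrossing.
exists M => //; apply: val_inj.
have inj : injective (@step_of d).
  by move=> [b r] [b' r'] [-> e2]; congr (_, _); apply: ord_inj.
apply: (inj_map inj); rewrite map_word_of // -es; apply: (@eq_from_nth _ (false, 0)).
  by rewrite !size_mkseq.
by move=> i; rewrite size_mkseq => im; rewrite !nth_mkseq // /block_step cM hX // vX.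
Qed.

Lemma num_matchings_walks : num_matchings e.+2 m = walks d m (fun=> 0).
Proof.
rewrite -card_closed_word /num_matchings -/nc_matchings.
rewrite -(card_in_imset word_of_inj); congr #|pred_of_set _|; apply/setP => w.
rewrite inE; apply/imsetP/idP => [[M hM ->]|/word_of_surj[M hM <-]].
  exact: word_of_closed.
by exists M.
Qed.

End Bijection.

Lemma walks_odd d n (lam : nat -> nat) : odd (n + \sum_(i < d) lam i) -> walks d n lam = 0.
Proof.
elim: n lam => [|n IH] lam /=.
  case: allP => //= al; rewrite big1 // => i _.
  by apply/eqP/al; rewrite mem_iota /=.
move=> od; rewrite big1 // => r _; rewrite big1 // => b _.
case: (boolP (step_allowed _ _)) => al; last by rewrite mul0n.
rewrite IH ?muln0 //; move: od; rewrite (bigD1 r) //= [in X in _ -> X](bigD1 r) //=.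
have -> : \sum_(i < d | i != r) apply_step (b, r.+1) lam i = \sum_(i < d | i != r) lam i.
  apply: eq_bigr => i ir; rewrite /apply_step /= ifN //.
move: al; rewrite /apply_step /step_allowed /= eqxx.
by case: b; move: (\sum_(_ < d | _) _) => s; lia.
Qed.

Lemma walks_far d n (lam : nat -> nat) (i : 'I_d) : n < lam i -> walks d n lam = 0.
Proof.
elim: n lam => [|n IH] lam /= li.
  case: allP => //= al; have := al i; rewrite mem_iota ltn_ord => /(_ isT).
  by lia.
rewrite big1 // => r _; rewrite big1 // => b _; rewrite IH ?muln0 //.
rewrite /apply_step /=; case: eqP => _; last by lia.
by case: b; lia.
Qed.

(** * Norm of the adjacency operator on shapes *)

Lemma up_down lam mu r : partition_fun lam -> partition_fun mu ->
  (step_allowed (true, r.+1) lam /\ apply_step (true, r.+1) lam = mu) <->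
  (step_allowed (false, r.+1) mu /\ apply_step (false, r.+1) mu = lam).
Proof.
move=> pl pm; rewrite /step_allowed /apply_step /=; split=> -[al <-].
  by have := pl r; split; [by_cases|apply: funext => i; by_cases].
split; last by apply: funext => i; by_cases.
by have := pm r.-1; case: r al => [|r] //=; by_cases.
Qed.

(* Shapes confined to a finite box, large enough to contain every walk considered. *)
Section Box.
Variables (d N : nat).

Definition box_shape := {ffun 'I_d -> 'I_N.+1}.

Definition shape_rows (x : box_shape) (i : nat) : nat :=
  if insub i is Some j then x j : nat else 0.

Lemma shape_rows_ord x (i : 'I_d) : shape_rows x i = x i.
Proof. by rewrite /shape_rows valK. Qed.

Lemma shape_rows_ge x i : d <= i -> shape_rows x i = 0.
Proof. by move=> di; rewrite /shape_rows insubF //; lia. Qed.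

Definition part_shape (x : box_shape) : bool := [forall i : 'I_d, shape_rows x i.+1 <= shape_rows x i].

Lemma part_shapeP x : reflect (partition_fun (shape_rows x)) (part_shape x).
Proof.
apply: (iffP forallP) => [h i|h i]; last exact: h.
have [lt|ge] := ltnP i d; first exact: (h (Ordinal lt)).
by rewrite !shape_rows_ge // ltnW.
Qed.

Definition neighbor (st : bool * nat) (x y : box_shape) : bool :=
  step_allowed st (shape_rows x) && [forall i : 'I_d, apply_step st (shape_rows x) i == shape_rows y i].

Lemma neighborP b (r : 'I_d) x y : reflect
  (step_allowed (b, r.+1) (shape_rows x) /\ apply_step (b, r.+1) (shape_rows x) = shape_rows y)
  (neighbor (b, r.+1) x y).
Proof.
apply: (iffP andP) => -[al e]; split=> //; last by apply/forallP => i; rewrite e.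
apply: funext => i; have [lt|ge] := ltnP i d.
  by apply/eqP; exact: (forallP e (Ordinal lt)).
rewrite [RHS]shape_rows_ge // /apply_step /= ifN ?shape_rows_ge //.
by have := ltn_ord r; lia.
Qed.

Definition step_count (x y : box_shape) : nat :=
  \sum_(r < d) \sum_(b : bool) neighbor (b, r.+1) x y.

Lemma step_count_sym x y : part_shape x -> part_shape y -> step_count x y = step_count y x.
Proof.
move=> /part_shapeP px /part_shapeP py; apply: eq_bigr => r _; rewrite !big_bool /= addnC.
congr (_ + _); congr nat_of_bool; apply/neighborP/neighborP.
- by move/(up_down r py px).
- by move/(up_down r py px).
- by move/(up_down r px py).
- by move/(up_down r px py).
Qed.

Lemma shape_rows_inj : injective shape_rows.
Proof. by move=> x y e; apply/ffunP => i; apply: ord_inj; rewrite -!shape_rows_ord e. Qed.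

Lemma sum_neighbor_le (P : pred box_shape) b (r : 'I_d) x :
  \sum_(y | P y) neighbor (b, r.+1) x y <= 1.
Proof.
case: (pickP (neighbor (b, r.+1) x)) => [y0 n0|no]; last first.
  by rewrite big1 // => y _; rewrite no.
apply: (@leq_trans (\sum_y (y == y0))); last first.
  by rewrite (bigD1 y0) //= eqxx big1 // => y /negbTE->.
rewrite big_mkcond /=; apply: leq_sum => y _; case: (P y) => //.
case: (boolP (neighbor _ _ _)) => // n1; rewrite lt0b; apply/eqP/shape_rows_inj.
by have /neighborP[_ <-] := n1; have /neighborP[_ <-] := n0.
Qed.

Lemma sum_step_count_le (P : pred box_shape) x : \sum_(y | P y) step_count x y <= 2 * d.
Proof.
rewrite exchange_big /=; apply: (@leq_trans (\sum_(r < d) 2)); last first.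
  by rewrite sum_nat_const card_ord mulnC.
apply: leq_sum => r _; rewrite exchange_big big_bool /=.
by rewrite -[2]/(1 + 1) leq_add // sum_neighbor_le.
Qed.

Definition shape_walks n (x : box_shape) : nat := walks d n (shape_rows x).

Lemma shape_walksS n x : n <= N -> part_shape x ->
  shape_walks n.+1 x = \sum_(y | part_shape y) step_count x y * shape_walks n y.
Proof.
move=> nN px; have px' := part_shapeP _ px; rewrite /shape_walks /=.
under [RHS]eq_bigr do rewrite /step_count big_distrl /=.
rewrite [RHS]exchange_big /=; apply: eq_bigr => r _.
under [RHS]eq_bigr do rewrite big_distrl /=.
rewrite [RHS]exchange_big /=; apply: eq_bigr => b _.
case: (boolP (step_allowed _ _)) => al; last first.
  by rewrite mul0n big1 // => y _; rewrite /neighbor (negbTE al).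
rewrite mul1n.
have [le|gt] := leqP (apply_step (b, r.+1) (shape_rows x) r) N; last first.
  rewrite (@walks_far _ _ _ r) ?(leq_ltn_trans nN) // big1 // => y _.
  case: (boolP (neighbor _ _ _)) => // /neighborP[_ e].
  by move: gt; rewrite e shape_rows_ord => gt; have := ltn_ord (y r); lia.
pose y0 : box_shape := [ffun i : 'I_d => inord (apply_step (b, r.+1) (shape_rows x) i)].
have ey : apply_step (b, r.+1) (shape_rows x) = shape_rows y0.
  apply: funext => i; have [lt|ge] := ltnP i d.
    rewrite -[i]/(nat_of_ord (Ordinal lt)) shape_rows_ord ffunE inordK //= ltnS.
    have [->//|ne] := eqVneq i r.
    rewrite /apply_step /= (negbTE ne).
    by rewrite -[i]/(nat_of_ord (Ordinal lt)) shape_rows_ord -ltnS.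
  rewrite [RHS]shape_rows_ge // /apply_step /= ifN ?shape_rows_ge //.
  by have := ltn_ord r; lia.
have n0 : neighbor (b, r.+1) x y0 by apply/neighborP.
have p0 : part_shape y0 by apply/part_shapeP; rewrite -ey; apply: apply_step_part.
rewrite (bigD1 y0) //= n0 mul1n -ey big1 ?addn0 // => y /andP[_ ne].
case: (boolP (neighbor _ _ _)) => // /neighborP[_ e].
by case/eqP: ne; apply: shape_rows_inj; rewrite -e.
Qed.

(** The inner product of [A^a e_0] and [A^b e_0], where [A] is the adjacency operator and [e_0] the
    empty shape. Self-adjointness moves factors [A] across, so only [a + b] matters. *)
Definition overlap a b : nat := \sum_(x | part_shape x) shape_walks a x * shape_walks b x.

Lemma overlap_shift a b : a <= N -> b <= N -> overlap a.+1 b = overlap a b.+1.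
Proof.
move=> aN bN; rewrite /overlap.
transitivity (\sum_(x | part_shape x) \sum_(y | part_shape y) step_count x y * shape_walks a y * shape_walks b x).
  by apply: eq_bigr => x px; rewrite shape_walksS // big_distrl.
rewrite exchange_big /=; apply: eq_bigr => y py; rewrite shape_walksS // big_distrr /=.
by apply: eq_bigr => x px; rewrite step_count_sym // mulnAC mulnC.
Qed.

Lemma overlap0 n : overlap 0 n = walks d n (fun=> 0).
Proof.
pose x0 : box_shape := [ffun=> ord0].
have r0 : shape_rows x0 = fun=> 0.
  by apply: funext => i; rewrite /shape_rows; case: insub => // j; rewrite ffunE.
have p0 : part_shape x0 by apply/part_shapeP; rewrite r0.
rewrite /overlap (bigD1 x0) //= /shape_walks r0 big1 => [|x /andP[_ ne]].
  rewrite addn0 /= (_ : all _ _) ?mul1n //.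
  by apply/allP.
rewrite /= ; case: allP => // al; case/eqP: ne.
apply: shape_rows_inj; rewrite r0; apply: funext => i; have [lt|ge] := ltnP i d.
  by apply/eqP/al; rewrite mem_iota.
exact: shape_rows_ge.
Qed.

Lemma overlapE a b : a + b <= N -> overlap a b = walks d (a + b) (fun=> 0).
Proof.
elim: a b => [|a IH] b ab; first exact: overlap0.
by rewrite overlap_shift ?IH -?addSnnS //; lia.
Qed.

(** This is [|A v|^2 <= (2d)^2 |v|^2] for [v = A^j e_0], by Schur's test: Cauchy-Schwarz with
    weights [step_count x y] bounds each [(A v)(x)^2] by [2d] times a weighted sum of squares, and
    symmetry bounds the column sums by [2d] too. *)
Lemma overlapS_le j : j <= N -> overlap j.+1 j.+1 <= (2 * d) ^ 2 * overlap j j.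
Proof.
move=> jN; rewrite -(@leq_pmul2l 2) // /overlap.
pose W := \sum_(x | part_shape x) \sum_(y | part_shape y) step_count x y * shape_walks j y ^ 2.
apply: (@leq_trans (2 * (2 * d * W))); last first.
  rewrite leq_mul2l /= expnS expn1 -[2 * d * (2 * d) * _]mulnA leq_mul2l /W; apply/orP; right.
  rewrite exchange_big big_distrr /=; apply: leq_sum => y py.
  rewrite -big_distrl /= -mulnn leq_mul2r; apply/orP; right.
  apply: leq_trans (sum_step_count_le part_shape y).
  by apply: eq_leq; apply: eq_bigr => x px; rewrite step_count_sym.
rewrite /W !big_distrr /=; apply: leq_sum => x px; rewrite shape_walksS //.
set S := \sum_(y | _) _; set Q := \sum_(y | _) _ * _ ^ 2.
have e : S * S = \sum_(y | part_shape y) \sum_(y' | part_shape y')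
    step_count x y * step_count x y' * (shape_walks j y * shape_walks j y').
  rewrite /S big_distrl /=; apply: eq_bigr => y _; rewrite big_distrr /=.
  by apply: eq_bigr => y' _; rewrite mulnACA.
have e1 : (\sum_(y | part_shape y) step_count x y) * Q = \sum_(y | part_shape y) \sum_(y' | part_shape y')
    step_count x y * step_count x y' * shape_walks j y' ^ 2.
  rewrite big_distrl /=; apply: eq_bigr => y _; rewrite /Q big_distrr /=.
  by apply: eq_bigr => y' _; rewrite mulnA.
have e2 : (\sum_(y | part_shape y) step_count x y) * Q = \sum_(y | part_shape y) \sum_(y' | part_shape y')
    step_count x y * step_count x y' * shape_walks j y ^ 2.
  rewrite e1 exchange_big /=; apply: eq_bigr => y _; apply: eq_bigr => y' _.
  by rewrite [step_count x y' * _]mulnC.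
have le : 2 * (S * S) <= (\sum_(y | part_shape y) step_count x y) * Q + (\sum_(y | part_shape y) step_count x y) * Q.
  rewrite {1}e1 e2 e -big_split big_distrr /=; apply: leq_sum => y _.
  rewrite -big_split big_distrr /=; apply: leq_sum => y' _.
  rewrite -mulnDr mulnCA leq_mul2l; apply/orP; right.
  by rewrite addnC; apply: (nat_Cauchy (shape_walks j y) (shape_walks j y')).
apply: (leq_trans le); rewrite addnn -mul2n leq_mul2l /= leq_mul2r sum_step_count_le orbT //.
Qed.

End Box.

Lemma walks_double_le d j :
  walks d (j.+1).*2 (fun=> 0) <= (2 * d) ^ 2 * walks d j.*2 (fun=> 0).
Proof.
have := @overlapS_le d (j.+1).*2 j.
by rewrite !overlapE -?addnn; [apply|..]; lia.
Qed.

Local Open Scope classical_set_scope.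
Local Open Scope ring_scope.

(** * The determinantal generating function *)

Section RowReplacement.
Variables (R : comNzRingType) (n : nat).

Definition set_row (i : 'I_n) (v : 'I_n -> R) (A : 'M[R]_n) : 'M[R]_n :=
  \matrix_(k, l) if k == i then v l else A k l.

Lemma det_set_row i v A :
  \det (set_row i v A) = \sum_j v j * cofactor A i j.
Proof.
rewrite (expand_det_row _ i); apply: eq_bigr => j _.
rewrite mxE eqxx; congr (_ * (_ * \det _)).
by apply/matrixP => k l; rewrite !mxE eq_sym (negbTE (neq_lift i k)).
Qed.

Lemma det_zero_row (A : 'M[R]_n) i : (forall j, A i j = 0) -> \det A = 0.
Proof.
by move=> A0; rewrite (expand_det_row _ i) big1 // => j _; rewrite A0 mul0r.
Qed.

End RowReplacement.

Section DerivDet.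
Variables (R : comNzRingType) (n : nat).

Lemma deriv_prod_seq (I : eqType) (r : seq I) (F : I -> {poly R}) : uniq r ->
  (\prod_(i <- r) F i)^`() =
  \sum_(i <- r) (F i)^`() * \prod_(k <- r | k != i) F k.
Proof.
elim: r => [|i r IH] /=; first by rewrite !big_nil derivC.
case/andP=> ir ur; rewrite !big_cons derivM IH // eqxx /=; congr (_ * _ + _).
  rewrite big_seq [RHS]big_mkcond [RHS]big_seq; apply: eq_big => // k kr.
  by case: eqP => // e; rewrite -e kr in ir.
rewrite big_distrr /= !big_seq; apply: eq_bigr => k kr; rewrite big_cons.
by rewrite ifT 1?mulrCA //; apply: contraNneq ir => ->.
Qed.

Lemma deriv_det (A : 'M[{poly R}]_n) :
  (\det A)^`() = \sum_i \det (set_row i (fun l => (A i l)^`()) A).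
Proof.
rewrite /determinant raddf_sum exchange_big /=; apply: eq_bigr => s _.
rewrite -big_distrr /= !mulr_sign.
have -> : \sum_i \prod_j set_row i (fun l => (A i l)^`()) A j (s j) =
    (\prod_i A i (s i))^`().
  rewrite deriv_prod_seq ?index_enum_uniq //; apply: eq_bigr => i _.
  rewrite (bigD1 i) //= mxE eqxx; congr (_ * _).
  by apply: eq_bigr => k ki; rewrite mxE (negbTE ki).
by case: (odd_perm s); rewrite ?derivN.
Qed.

End DerivDet.

Fixpoint line_walks (n i j : nat) : nat :=
  if n is n'.+1 then
    (line_walks n' i.+1 j + if i is i'.+1 then line_walks n' i' j else 0)%N
  else i == j.

Section WalkDet.
Variable R : numFieldType.
Variable d : nat.

(** Truncation keeps determinants and derivatives inside polynomial algebra; the coefficients of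
    degree at most [N] are unaffected. *)
Definition line_egf (N i j : nat) : {poly R} :=
  \poly_(n < N.+1) ((line_walks n i j)%:R / n`!%:R).

(* Rows are indexed by [y i = lam i + (d - 1 - i)], which turns the chamber into
   strictly decreasing sequences of natural numbers. *)
Definition walk_mx (N : nat) (y : 'I_d -> nat) : 'M[{poly R}]_d :=
  \matrix_(i, j) line_egf N (y i) (d.-1 - j).

(** The term in ['X^N] is the truncation defect: the derivative has lost the coefficient of degree
    [N] that the neighbours still have. *)
Lemma deriv_line_egf N i j :
  (line_egf N i j)^`() = line_egf N i.+1 j +
    (if i is i'.+1 then line_egf N i' j else 0) -
    'X^N * ((line_walks N.+1 i j)%:R / N`!%:R)%:P.
Proof.
apply/polyP => n; rewrite coef_deriv coefB coefD coefXnM !coef_poly ltnS.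
have -> : ((if i is i'.+1 then line_egf N i' j else 0) : {poly R})`_n =
    if (n < N.+1)%N then (if i is i'.+1 then line_walks n i' j else 0)%:R / n`!%:R else 0.
  by case: i => [|i]; rewrite ?coef_poly ?coef0 ?mul0r //; case: ifP.
have nf : n`!%:R != 0 :> R by rewrite pnatr_eq0 -lt0n fact_gt0.
have n1 : n.+1%:R != 0 :> R by rewrite pnatr_eq0.
have key : (line_walks n.+1 i j)%:R / (n.+1)`!%:R *+ n.+1 =
    (line_walks n i.+1 j)%:R / n`!%:R +
    (if i is i'.+1 then line_walks n i' j else 0)%:R / n`!%:R :> R.
  rewrite -mulrDl -natrD -[X in X%:R / n`!%:R]/(line_walks n.+1 i j).
  by rewrite factS natrM -mulr_natr invfM [_^-1 * _]mulrC -!mulrA mulVf // mulr1.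
case: (ltngtP n N) => h.
- by rewrite ltnS ltnW // subr0 key.
- rewrite ltnS leqNgt h /= addr0 mul0rn coefC subn_eq0 leqNgt h /=.
  by rewrite subrr.
- by rewrite ltnS h leqnn subnn coefC eqxx -h -key factS natrM -mulr_natr
    invfM [_^-1 * _]mulrC -!mulrA mulVf // mulr1 subrr mul0rn.
Qed.

Lemma walk_mx_det_deriv N y n : (n < N)%N ->
  ((\det (walk_mx N y))^`())`_n =
  \sum_(r < d) ((\det (walk_mx N (fun i => if i == r then (y i).+1 else y i)))`_n +
    (if y r is _.+1 then
       (\det (walk_mx N (fun i => if i == r then (y i).-1 else y i)))`_n else 0)).
Proof.
move=> nN; rewrite deriv_det coef_sum; apply: eq_bigr => r _.
rewrite det_set_row.
have setE (z : nat) : \det (walk_mx N (fun i => if i == r then z else y i)) =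
    \sum_(j < d) line_egf N z (d.-1 - j) * cofactor (walk_mx N y) r j.
  rewrite -det_set_row; congr (\det _); apply/matrixP => k l; rewrite !mxE.
  by case: eqP.
have eU : (fun i => if i == r then (y i).+1 else y i) =
    (fun i => if i == r then (y r).+1 else y i).
  by apply: funext => i; case: eqP => // ->.
have eD : (fun i => if i == r then (y i).-1 else y i) =
    (fun i => if i == r then (y r).-1 else y i).
  by apply: funext => i; case: eqP => // ->.
rewrite eU eD !setE.
have drop_XN (c : 'I_d -> R) : (\sum_(j < d) ('X^N * (c j)%:P) * cofactor (walk_mx N y) r j)`_n = 0.
  under eq_bigr do rewrite -mulrA.
  by rewrite -big_distrr /= coefXnM nN.
under eq_bigr do rewrite mxE deriv_line_egf mulrBl mulrDl.
rewrite sumrB big_split /= coefB coefD drop_XN subr0; congr (_ + _).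
case: (y r) => [|z] //=.
by rewrite big1 ?coef0 // => j _; rewrite mul0r.
Qed.

Definition shifted (lam : nat -> nat) (i : 'I_d) : nat := lam i + (d.-1 - i).

(** Both sides obey the same recursion in [n]. Differentiating the determinant moves each row index
    up and down freely, but a move out of the chamber makes two adjacent rows equal and contributes
    0. For [n = 0] a nonempty shape has first row index at least [d], which gives a zero row. *)
Lemma walk_mx_coef n N lam : (n <= N)%N -> partition_fun lam -> lam d = 0%N ->
  (\det (walk_mx N (shifted lam)))`_n = (walks d n lam)%:R / n`!%:R.
Proof.
move=> nN pl ld; elim: n nN lam pl ld => [|n IH] nN lam pl ld.
  rewrite fact0 divr1 -horner_coef0 -[LHS]/(horner_eval 0 _) -det_map_mx /=.
  have ent i j : (map_mx (horner_eval 0) (walk_mx N (shifted lam))) i j =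
      (shifted lam i == d.-1 - j)%N%:R.
    by rewrite !mxE /horner_eval horner_coef0 coef_poly /= fact0 divr1.
  have [/allP al|/allPn[i]] := boolP (all _ _).
    have l0 i : (i < d)%N -> lam i = 0%N.
      by move=> id; apply/eqP/al; rewrite mem_iota.
    rewrite (_ : map_mx _ _ = 1%:M) ?det1 //; apply/matrixP => i j.
    rewrite ent mxE /shifted l0 // add0n; congr (_%:R); congr nat_of_bool.
    by rewrite -val_eqE /=; have := ltn_ord i; have := ltn_ord j; lia.
  rewrite mem_iota /= add0n => id li.
  have d0 : (0 < d)%N by lia.
  apply: (@det_zero_row _ _ _ (Ordinal d0)) => j; rewrite ent /shifted /=.
  have : (lam i <= lam 0)%N.
    elim: (i) => // k IHk; exact: leq_trans (pl k) IHk.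
  by move=> h; rewrite (_ : (_ == _) = false) //; move: li h d0; clear; lia.
have n1 : n.+1%:R != 0 :> R by rewrite pnatr_eq0.
apply: (mulIf n1); rewrite mulr_natr -coef_deriv walk_mx_det_deriv //.
rewrite factS natrM invfM [_^-1 * _]mulrC -!mulrA mulVf // mulr1.
rewrite /= natr_sum big_distrl /=; apply: eq_bigr => r _.
rewrite big_bool /= natrD mulrDl !natrM; congr (_ + _).
  case: (boolP (step_allowed _ _)) => al; rewrite ?mul1r ?mul0r.
    rewrite -IH; [|exact: ltnW|exact: apply_step_part|].
      congr ((\det (walk_mx N _) : {poly R})`_n); apply: funext => i.
      by rewrite /shifted /apply_step /= -val_eqE /=; case: eqP.
    by rewrite /apply_step /=; case: eqP => // e; have := ltn_ord r; lia.
  move: al; rewrite /step_allowed /= negb_or -leqNgt => /andP[r0 le].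
  have r1 : (r.-1 < d)%N by have := ltn_ord r; lia.
  rewrite (@determinant_alternate _ _ _ r (Ordinal r1)) ?coef0 //.
    by rewrite -val_eqE /=; lia.
  move=> j; rewrite !mxE eqxx ifN; last by rewrite -val_eqE /=; lia.
  congr (line_egf _ _ _); rewrite /shifted /=.
  have := pl r.-1; rewrite prednK ?lt0n // => le2.
  by have := ltn_ord r; lia.
have ld' : (lam r.+1 <= lam r)%N := pl r.
case: (boolP (step_allowed _ _)) => al; rewrite ?mul1r ?mul0r.
  rewrite -IH; [|exact: ltnW|exact: apply_step_part|].
    move: al; rewrite /step_allowed /= => al.
    case e : (shifted lam r) => [|z]; first by move: e; rewrite /shifted; lia.
    congr ((\det (walk_mx N _) : {poly R})`_n); apply: funext => i.
    rewrite /shifted /apply_step /= -val_eqE /=; case: eqP => // e2.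
    by rewrite e2; lia.
  by rewrite /apply_step /=; case: eqP => // e; have := ltn_ord r; lia.
move: al; rewrite /step_allowed /= -leqNgt => al.
case e : (shifted lam r) => [|z] //.
have r1 : (r.+1 < d)%N.
  have := ltn_ord r; rewrite leq_eqVlt => /orP[/eqP e1|//].
  by move: e; rewrite /shifted; rewrite e1 ld in ld' al; lia.
rewrite (@determinant_alternate _ _ _ r (Ordinal r1)) ?coef0 //.
  by rewrite -val_eqE /=; lia.
move=> j; rewrite !mxE eqxx ifN; last by rewrite -val_eqE /=; lia.
by congr (line_egf _ _ _); move: e; rewrite /shifted /=; lia.
Qed.

End WalkDet.

(** * Semicircle moments *)

Section Moments.
Variable R : realFieldType.

(* [moment] is integration against the semicircle law on [[-2, 2]] in the variable
   [y = 2 - x]; its [n]-th moment is read off the operator [2 - x], which acts on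
   the orthonormal basis [cheb] as a signed lazy walk. *)
Fixpoint lap_walks (n i : nat) : R :=
  if n is n'.+1 then
    2 * lap_walks n' i - lap_walks n' i.+1 -
      (if i is i'.+1 then lap_walks n' i' else 0)
  else (i == 0)%:R.

Definition moment (q : {poly R}) : R := \sum_(n < size q) q`_n * lap_walks n 0.

Lemma moment_widen N (q : {poly R}) : (size q <= N)%N ->
  moment q = \sum_(n < N) q`_n * lap_walks n 0.
Proof.
move=> le; rewrite /moment (big_ord_widen _ (fun n => q`_n * lap_walks n 0) le).
rewrite big_mkcond /=; apply: eq_bigr => n _; case: ltnP => // ge.
by rewrite nth_default ?mul0r.
Qed.

Lemma momentD p q : moment (p + q) = moment p + moment q.
Proof.
pose N := maxn (size p) (size q).
rewrite !(@moment_widen N) ?leq_maxl ?leq_maxr ?size_polyD //.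
by rewrite -big_split /=; apply: eq_bigr => n _; rewrite coefD mulrDl.
Qed.

Lemma momentZ c p : moment (c *: p) = c * moment p.
Proof.
rewrite !(@moment_widen (size p)) ?size_scale_leq // big_distrr /=.
by apply: eq_bigr => n _; rewrite coefZ mulrA.
Qed.

Lemma moment0 : moment 0 = 0.
Proof. by rewrite -(scale0r 0) momentZ mul0r. Qed.

Lemma momentB p q : moment (p - q) = moment p - moment q.
Proof. by rewrite -scaleN1r momentD momentZ mulN1r. Qed.

Lemma moment_sum (I : Type) (r : seq I) (P : pred I) (F : I -> {poly R}) :
  moment (\sum_(i <- r | P i) F i) = \sum_(i <- r | P i) moment (F i).
Proof. exact: (big_morph moment momentD moment0). Qed.

Lemma momentXn n : moment 'X^n = lap_walks n 0.
Proof.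
rewrite (@moment_widen (n.+1)) ?size_polyXn // (bigD1 ord_max) //=.
rewrite coefXn eqxx mul1r big1 ?addr0 // => i ni.
by rewrite coefXn (_ : (_ == _) = false) ?mul0r //; apply/negbTE.
Qed.

Local Notation x := (2%:R - 'X : {poly R}).

(** The Chebyshev polynomials of the second kind [U_i(x / 2)], with [x = 2 - 'X]. *)
Fixpoint cheb (i : nat) : {poly R} :=
  if i is i1.+1 then
    if i1 is i2.+1 then x * cheb i1 - cheb i2 else x
  else 1.

Lemma chebSS i : cheb i.+2 = x * cheb i.+1 - cheb i.
Proof. by []. Qed.

Definition cheb_pred (i : nat) : {poly R} := if i is i'.+1 then cheb i' else 0.

Lemma mul_cheb i : x * cheb i = cheb i.+1 + cheb_pred i.
Proof. by case: i => [|i]; [rewrite addr0 mulr1|rewrite chebSS /= subrK]. Qed.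

Lemma nat_pair_ind (P : nat -> Prop) :
  P 0%N -> P 1%N -> (forall n, P n -> P n.+1 -> P n.+2) -> forall n, P n.
Proof.
move=> P0 P1 PS n; suff: P n /\ P n.+1 by case.
by elim: n => // n [? ?]; split=> //; apply: PS.
Qed.

Lemma moment_Xn_cheb i n : moment ('X^n * cheb i) = lap_walks n i.
Proof.
elim/nat_pair_ind: i n => [n|n|i IH0 IH1 n].
- by rewrite mulr1 momentXn.
- have -> : 'X^n * cheb 1 = (2 : R) *: 'X^n - 'X^(n.+1).
    by rewrite /= mulrBr mulr_natr scaler_nat exprSr.
  by rewrite momentB momentZ !momentXn /= subr0; lra.
- have -> : 'X^n * cheb i.+2 =
      (2 : R) *: ('X^n * cheb i.+1) - 'X^(n.+1) * cheb i.+1 - 'X^n * cheb i.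
    rewrite chebSS mulrBr mulrBl mulrBr mulrCA mulr_natl -scaler_nat mulrA.
    by rewrite -exprSr.
  by rewrite !momentB momentZ !IH1 IH0 /=; lra.
Qed.

Lemma moment_cheb i : moment (cheb i) = (i == 0%N)%:R.
Proof. by have := moment_Xn_cheb i 0; rewrite expr0 mul1r. Qed.

Lemma moment_cheb2 i j : moment (cheb i * cheb j) = (i == j)%:R.
Proof.
elim/nat_pair_ind: j i => [i|i|j IH0 IH1 i].
- by rewrite mulr1 moment_cheb.
- rewrite mulrC [cheb 1]/= mul_cheb momentD moment_cheb add0r.
  by case: i => [|i] /=; rewrite ?moment0 ?moment_cheb.
- rewrite chebSS mulrBr momentB IH0 mulrA (mulrC (cheb i)) mul_cheb mulrDl momentD IH1.
  case: i => [|i] /=; first by rewrite mul0r moment0 addr0 eqSS subrr.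
  by rewrite IH1 -[i.+2 == j.+1]/(i.+1 == j) addrAC subrr add0r.
Qed.

(** By [mul_cheb], multiplication by [x] in this orthonormal basis is the adjacency operator of the
    half line. *)
Lemma moment_line_walks n i j :
  moment (x ^+ n * (cheb i * cheb j)) = (line_walks n i j)%:R.
Proof.
elim: n i => [|n IH] i; first by rewrite expr0 mul1r moment_cheb2.
rewrite exprSr -mulrA (mulrA x) mul_cheb mulrDl mulrDr momentD IH /= natrD.
by case: i => [|i] /=; rewrite ?IH // mul0r mulr0 moment0.
Qed.

Lemma deriv_cheb i :
  ('X ^+ 2 - 4 * 'X) * (cheb i)^`() =
  (i%:R + 2) * (x * cheb i) - 2 * (i%:R + 1) * cheb i.+1.
Proof.
have dx : x^`() = -1 by rewrite derivB derivX -[2%:R]polyC_natr derivC sub0r.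
elim/nat_pair_ind: i => [||i IH0 IH1].
- by rewrite /= derivC; ring.
- by rewrite [cheb 1]/= [cheb 2]/= dx; ring.
- move: IH0 IH1; rewrite !chebSS derivB derivM dx.
  move: (cheb i) (cheb i.+1) => p q.
  move: p^`() q^`() => p' q' IH0 IH1.
  have -> : ('X ^+ 2 - 4 * 'X) * (-1 * q + x * q' - p') =
      - ('X ^+ 2 - 4 * 'X) * q + x * (('X ^+ 2 - 4 * 'X) * q') -
      ('X ^+ 2 - 4 * 'X) * p' by ring.
  rewrite IH0 IH1; ring.
Qed.

(* The Pearson equation of the semicircle law (integration by parts). *)
Definition pearson (q : {poly R}) : {poly R} :=
  ('X ^+ 2 - 4 * 'X) * q^`() - 3 * (x * q).

Lemma pearsonD p q : pearson (p + q) = pearson p + pearson q.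
Proof. by rewrite /pearson derivD; ring. Qed.

Lemma pearsonZ c p : pearson (c *: p) = c *: pearson p.
Proof. by rewrite /pearson derivZ -!mul_polyC; ring. Qed.

(** Multiplication by ['X] stays in the span of the [cheb i], which reduces [q] to a constant. There
    [deriv_cheb] leaves a multiple [i - 1] of [cheb_pred i] besides terms of moment 0, and
    [cheb_pred i] has nonzero moment only at [i = 1]. *)
Lemma moment_pearson_cheb q i : moment (pearson (q * cheb i)) = 0.
Proof.
elim/poly_ind: q i => [|q c IH] i.
  by rewrite mul0r -(scale0r 0) pearsonZ momentZ mul0r.
have -> : (q * 'X + c%:P) * cheb i =
    2 *: (q * cheb i) + (-1) *: (q * cheb i.+1) + (-1) *: (q * cheb_pred i)
    + c *: cheb i.
  have e : 'X * cheb i = 2 * cheb i - cheb i.+1 - cheb_pred i.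
    rewrite -[X in _ = X]addrA -opprD -mul_cheb; ring.
  by rewrite mulrDl -mulrA e -!mul_polyC polyC_natr polyCN; ring.
rewrite !pearsonD !pearsonZ !momentD !momentZ !IH.
have -> : moment (pearson (q * cheb_pred i)) = 0.
  by case: i => [|i] //=; rewrite mulr0 -(scale0r 0) pearsonZ momentZ mul0r.
rewrite !mulr0 !add0r /pearson deriv_cheb.
have -> : (i%:R + 2) * (x * cheb i) - 2 * (i%:R + 1) * cheb i.+1 - 3 * (x * cheb i)
    = (i%:R - 1) *: (x * cheb i) - (2 * (i%:R + 1)) *: cheb i.+1.
  by rewrite -!mul_polyC polyCB polyCM polyCD !polyC_natr; ring.
rewrite momentB !momentZ moment_cheb mulr0 subr0 mul_cheb momentD moment_cheb add0r.
case: i => [|[|i]]; rewrite /cheb_pred ?moment0 ?mulr0 // moment_cheb.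
  by rewrite subrr mul0r mulr0.
by rewrite !mulr0.
Qed.

(** A normalised Beta integral, of [y^(p + 1/2) (4 - y)^(m + 1/2)] over [[0, 4]]. *)
Definition beta_moment (m p : nat) : R := moment ((4 - 'X) ^+ m * 'X ^+ p).

Lemma beta_moment_sum m p : beta_moment m.+1 p + beta_moment m p.+1 = 4 * beta_moment m p.
Proof.
rewrite /beta_moment -momentD -momentZ; congr moment.
rewrite -mul_polyC polyC_natr !exprS.
by move: ((4 - 'X) ^+ m) ('X ^+ p) => F G; ring.
Qed.

Lemma beta_moment_pearson m p :
  (2 * p%:R + 3) * beta_moment m.+1 p = (2 * m%:R + 3) * beta_moment m p.+1.
Proof.
have := moment_pearson_cheb ((4 - 'X) ^+ m * 'X ^+ p) 0.
rewrite mulr1 /pearson.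
have d4 : (4 - 'X : {poly R})^`() = -1.
  by rewrite derivB derivX -[4%:R]polyC_natr derivC sub0r.
have -> : ('X ^+ 2 - 4 * 'X) * ((4 - 'X) ^+ m * 'X ^+ p)^`() =
    m%:R * ((4 - 'X) ^+ m * 'X ^+ p.+1) - p%:R * ((4 - 'X) ^+ m.+1 * 'X ^+ p) :> {poly R}.
  have dF : (4 - 'X) * ((4 - 'X : {poly R}) ^+ m)^`() = - (m%:R * (4 - 'X) ^+ m).
    rewrite deriv_exp d4 mulN1r mulNrn mulrN; congr (- _).
    by case: m => [|m]; rewrite ?mulr0n ?mulr0 ?mul0r // mulrnAr -exprS mulr_natl.
  have dG : 'X * ('X ^+ p : {poly R})^`() = p%:R * 'X ^+ p.
    rewrite deriv_exp derivX mul1r.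
    by case: p => [|p]; rewrite ?mulr0n ?mulr0 ?mul0r // mulrnAr -exprS mulr_natl.
  rewrite derivM [_ ^+ m.+1]exprS [_ ^+ p.+1]exprS; move: dF dG.
  move: ((4 - 'X) ^+ m) ('X ^+ p) => F G; move: F^`() G^`() => F' G' dF dG.
  have -> : ('X^2 - 4 * 'X) * (F' * G + F * G') =
    - ((4 - 'X) * F') * ('X * G) - ('X * G') * ((4 - 'X) * F) by ring.
  by rewrite dF dG; ring.
have -> : m%:R * ((4 - 'X) ^+ m * 'X ^+ p.+1) - p%:R * ((4 - 'X) ^+ m.+1 * 'X ^+ p)
    - 3 * (x * ((4 - 'X) ^+ m * 'X ^+ p)) =
    (m%:R + 3 / 2) *: ((4 - 'X) ^+ m * 'X ^+ p.+1) -
    (p%:R + 3 / 2) *: ((4 - 'X) ^+ m.+1 * 'X ^+ p) :> {poly R}.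
  rewrite -!mul_polyC !polyCD ![(_ *+ _)%:P]polyC_natr !exprS.
  move: ((4 - 'X) ^+ m) ('X ^+ p) => F G.
  have h : (3 / 2 : R)%:P + (3 / 2 : R)%:P = 3 :> {poly R}.
    have <- : (3%:R : R)%:P = 3%:R by exact: polyC_natr.
    by rewrite -polyCD; congr (_%:P); lra.
  by move: h; move: (3 / 2)%:P => c <-; ring.
rewrite momentB !momentZ -!/(beta_moment _ _) => h.
by lra.
Qed.

(** The two preceding relations form a linear system for the moments at [(m.+1, p)] and
    [(m, p.+1)]. *)
Lemma beta_momentS m p : (m%:R + p%:R + 3) * beta_moment m.+1 p = (4 * m%:R + 6) * beta_moment m p.
Proof. by have := beta_moment_sum m p; have := beta_moment_pearson m p; nra. Qed.

Lemma beta_moment_pS m p : (m%:R + p%:R + 3) * beta_moment m p.+1 = (4 * p%:R + 6) * beta_moment m p.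
Proof. by have := beta_moment_sum m p; have := beta_moment_pearson m p; nra. Qed.

Lemma beta_moment00 : beta_moment 0 0 = 1.
Proof. by rewrite /beta_moment !expr0 mulr1; apply: moment_cheb 0%N. Qed.

(** Since [4 - 'X = 2 + x], these are walks that may also rest in two ways; on generating functions
    this is the factor [e^(2z)]. *)
Lemma moment_lazy_walks n i j :
  moment ((4 - 'X) ^+ n * (cheb i * cheb j)) =
  \sum_(l < n.+1) 'C(n, l)%:R * 2 ^+ (n - l) * (line_walks l i j)%:R.
Proof.
have -> : 4 - 'X = 2%:R + x :> {poly R} by ring.
rewrite exprDn mulr_suml moment_sum; apply: eq_bigr => l _.
rewrite -moment_line_walks -momentZ; congr moment.
rewrite -mul_polyC polyCM polyC_natr rmorphXn /= polyC_natr -mulr_natl.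
by rewrite -!mulrA.
Qed.

Lemma coef_cheb i p : (i < p)%N -> (cheb i)`_p = 0.
Proof.
elim/nat_pair_ind: i p => [||i IH0 IH1] [|p] //.
- by rewrite coef1.
- by rewrite /= -[2%:R]polyC_natr coefB coefC coefX; case: p => //=; rewrite subr0.
- move=> ip; rewrite chebSS mulrBl mulr_natl !coefB coefMn coefXM /=.
  by rewrite !IH1 ?IH0 ?mul0rn ?subr0 //; lia.
Qed.

Lemma lead_cheb i : (cheb i)`_i = (-1) ^+ i.
Proof.
elim/nat_pair_ind: i => [||i IH0 IH1].
- by rewrite coef1.
- by rewrite /= -[2%:R]polyC_natr coefB coefC coefX /= sub0r expr1.
- rewrite chebSS mulrBl mulr_natl !coefB coefMn coefXM IH1 !coef_cheb //.
  by rewrite mul0rn sub0r subr0 [RHS]exprS mulN1r.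
Qed.

End Moments.

(** * Concentrated weights *)

Section Limits.
Variable R : realType.
Implicit Types (b c : R).

(** The bounds may depend on [e]: the limit along [F] is taken for fixed [e], and only then does [e]
    tend to 0. *)
Lemma eps_sandwich {T : Type} {F : set_system T} {FF : ProperFilter F}
    (f : T -> R) (L U : R -> R) (l : R) :
  L e @[e --> 0^'+] --> l -> U e @[e --> 0^'+] --> l ->
  (\forall e \near 0^'+, exists lo up : T -> R,
     [/\ lo @ F --> L e, up @ F --> U e &
         \forall t \near F, lo t <= f t <= up t]) ->
  f @ F --> l.
Proof.
move=> cL cU H; apply/cvgrPdist_le => eta eta0.
have eta2 : 0 < eta / 2 by lra.
have /cvgrPdist_le/(_ _ eta2) nL := cL; have /cvgrPdist_le/(_ _ eta2) nU := cU.
have [e [[he1 he2] [lo [up [clo cup lu]]]]] :=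
  @filter_ex _ _ (at_right_proper_filter (0 : R)) _ (filterI (filterI nL nU) H).
move/cvgrPdist_le/(_ _ eta2): clo => clo.
move/cvgrPdist_le/(_ _ eta2): cup => cup.
near=> t.
have h1 : `|L e - lo t| <= eta / 2 by near: t.
have h2 : `|U e - up t| <= eta / 2 by near: t.
have /andP[h3 h4] : lo t <= f t <= up t by near: t.
move: h1 h2 h3 h4 he1 he2; rewrite !ler_norml => /andP[? ?] /andP[? ?] ? ? /andP[? ?] /andP[? ?].
by apply/andP; split; lra.
Unshelve. all: by end_near. Qed.

Lemma cvg_near_eq {T : Type} {F : set_system T} {FF : Filter F} (f g : T -> R) (l : R) :
  f @ F --> l -> (\forall t \near F, f t = g t) -> g @ F --> l.
Proof. by move=> cf fg; apply: cvg_trans cf; apply: near_eq_cvg. Qed.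

Lemma powR_cvg1 b (h : R -> R) : h e @[e --> 0^'+] --> (1 : R) ->
  h e `^ b @[e --> 0^'+] --> (1 : R).
Proof.
move=> ch; have c1 : {for 1, continuous (fun x : R => x `^ b)}.
  apply: differentiable_continuous; apply/derivable1_diffP.
  by apply: derivable_powR; rewrite in_itv /= ltr01.
have := continuous_cvg _ c1 ch; rewrite /= powR1; exact.
Qed.

Lemma expR_decay (delta b : R) : 0 < delta ->
  expR (- (delta * x)) * x `^ b @[x --> +oo] --> (0 : R).
Proof.
move=> d0; have [n hn] : exists n : nat, b <= n%:R.
  by exists (Num.truncn `|b|).+1; rewrite (le_trans (ler_norm b)) // ltW // truncnS_gt.
(* The Taylor term of degree [n.+1] beats [x ^+ n] by one power, leaving [K / x]. *)
pose K := (n.+1)`!%:R / delta ^+ n.+1.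
have K0 : 0 <= K by rewrite divr_ge0 // ?exprn_ge0 // ltW.
apply: (@squeeze_cvgr _ _ _ _ (fun=> 0) (fun x => K * x^-1)).
- near=> x.
  have x1 : 1 <= x by near: x; apply: nbhs_pinfty_ge; rewrite num_real.
  have x0 : 0 < x by lra.
  rewrite mulr_ge0 ?expR_ge0 ?powR_ge0 //=.
  have h1 : x `^ b <= x ^+ n by have := ler_powR x1 hn; rewrite powR_mulrn // ltW.
  have h2 := expR_ge1Dxn n (ltW (mulr_gt0 d0 x0)).
  have h3 : (delta * x) ^+ n.+1 / (n.+1)`!%:R <= expR (delta * x) by lra.
  rewrite expRN ler_pdivrMl ?expR_gt0 //.
  apply: le_trans h1 _; apply: le_trans (_ : (delta * x) ^+ n.+1 / (n.+1)`!%:R * (K / x) <= _).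
    rewrite exprMn [x ^+ n.+1]exprSr /K.
    have D0 : delta ^+ n.+1 != 0 by rewrite gt_eqF // exprn_gt0.
    have N0 : (n.+1)`!%:R != 0 :> R by rewrite pnatr_eq0 -lt0n fact_gt0.
    move: D0 N0; move: (delta ^+ n.+1) (_`!%:R) (x ^+ n) => D N X D0 N0.
    rewrite le_eqVlt; apply/orP; left; apply/eqP; field.
    by rewrite N0 D0 gt_eqF.
  by rewrite ler_wpM2r // divr_ge0 // ltW.
- exact: cvg_cst.
- rewrite -[X in _ --> X](mulr0 K); apply: cvgM; first exact: cvg_cst.
  apply/gtr0_cvgV0; last exact: cvg_id.
  exact: nbhs_pinfty_gt.
Unshelve. all: by end_near. Qed.

Lemma expR_le_quad (u : R) : u <= 2^-1 -> expR u <= 1 + u + 2 * u ^+ 2.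
Proof.
move=> hu; have h := expR_ge1Dx (- u); rewrite expRN in h.
have e0 := expR_gt0 u.
have h1 : (1 - u) * expR u <= 1.
  by rewrite -[X in _ <= X](mulVf (lt0r_neq0 e0)) ler_pM2r //; lra.
have u1 : 0 < 1 - u by lra.
rewrite -(ler_pM2l u1); apply: le_trans h1 _.
have -> : (1 - u) * (1 + u + 2 * u ^+ 2) = 1 + u ^+ 2 * (1 - 2 * u) by ring.
by rewrite lerDl mulr_ge0 ?sqr_ge0 //; lra.
Qed.

End Limits.

Section Concentration.
Variable R : realType.
Implicit Types (w g : nat -> R) (lam C eps K A M b c : R).

Definition wsum w g : R := limn (series (fun m => g m * w m)).

(** A Bernstein condition for weights centred at [lam]. Both signs of [s] are covered, hence both
    tails; [s] stays small because exponentials are only locally quadratic. *)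
Definition mgf_bound w lam C : Prop := forall s N, `|s| <= 2^-1 ->
  \sum_(0 <= m < N) expR (s * m%:R) * w m <= expR (lam * (s + C * s ^+ 2)).

Lemma is_cvg_wsum w g M K : (forall m, 0 <= w m) -> series w @ \oo --> M ->
  (forall m, `|g m| <= K) -> cvgn (series (fun m => g m * w m)).
Proof.
move=> w0 cw gK; apply: normed_cvg.
have K0 : 0 <= K by apply: le_trans (gK 0%N).
apply: (@series_le_cvg _ _ (fun m => K * w m)).
- by move=> m; exact: normr_ge0.
- by move=> m; rewrite mulr_ge0.
- by move=> m /=; rewrite normrM (ger0_norm (w0 m)) ler_wpM2r.
- have -> : series (fun m => K * w m) = (fun n => K * series w n).
    by apply/funext => n; rewrite /series /= big_distrr.
  by apply: is_cvgM; [exact: is_cvg_cst|apply/cvg_ex; exists M].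
Qed.

Lemma wsum_window_le w g M lam C eps K A :
  (forall m, 0 <= w m) -> series w @ \oo --> M -> mgf_bound w lam C ->
  0 < C -> 0 < eps <= C -> (forall m, `|g m| <= K) ->
  (forall m, (1 - eps) * lam <= m%:R <= (1 + eps) * lam -> g m <= A) ->
  wsum w g <= A * M + 2 * (K + `|A|) * expR (- (eps ^+ 2 / (4 * C) * lam)).
Proof.
move=> w0 cw mgf C0 /andP[e0 eC] gK gA.
have K0 : 0 <= K by apply: le_trans (gK 0%N).
(* The Chernoff choice: this [s] maximises [s * eps - C * s ^+ 2], with maximum
   [eps ^+ 2 / (4 * C)], and [eps <= C] keeps it below one half. *)
pose s := eps / (2 * C).
have s0 : 0 < s by rewrite /s divr_gt0 // mulr_gt0.
have s1 : `|s| <= 2^-1.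
  rewrite (ger0_norm (ltW s0)) /s ler_pdivrMr ?mulr_gt0 //.
  by rewrite mulKf // pnatr_eq0.
have s2 : `|- s| <= 2^-1 by rewrite normrN.
set delta := eps ^+ 2 / (4 * C).
have eD : delta = s * eps - C * s ^+ 2.
  by rewrite /delta /s; field; rewrite gt_eqF.
set KA := K + `|A|.
have KA0 : 0 <= KA by rewrite addr_ge0.
pose hi m := expR (s * m%:R) * expR (- (s * ((1 + eps) * lam))).
pose lo m := expR (- s * m%:R) * expR (s * ((1 - eps) * lam)).
(* To the right of the window [hi m >= 1] and to the left [lo m >= 1], so exponentials replace the
   indicator of its complement. *)
have maj m : g m <= A + KA * (hi m + lo m).
  have hi0 : 0 <= hi m by rewrite mulr_ge0 ?expR_ge0.
  have lo0 : 0 <= lo m by rewrite mulr_ge0 ?expR_ge0.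
  have big : 1 <= hi m + lo m -> g m <= A + KA * (hi m + lo m).
    move=> h1; have h2 : g m <= K by rewrite (le_trans (ler_norm _)).
    have h3 : - A <= `|A| by rewrite -normrN ler_norm.
    have h4 : KA <= KA * (hi m + lo m) by rewrite ler_peMr.
    by rewrite /KA in h4 *; lra.
  have [h1|h1] := lerP ((1 - eps) * lam) m%:R; last first.
    apply: big; rewrite -[leLHS]add0r lerD // /lo -expRD -[leLHS]expR0 ler_expR.
    by rewrite mulNr addrC -mulrBr mulr_ge0 ?subr_ge0 // ltW.
  have [h2|h2] := lerP m%:R ((1 + eps) * lam); last first.
    apply: big; rewrite -[leLHS]addr0 lerD // /hi -expRD -[leLHS]expR0 ler_expR.
    by rewrite -mulrBr mulr_ge0 ?subr_ge0 // ltW.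
  by rewrite (le_trans (gA _ _)) ?h1 ?h2 // lerDl mulr_ge0 // addr_ge0.
have partial n : series (fun m => g m * w m) n <=
    A * series w n + 2 * KA * expR (- (delta * lam)).
  apply: (@le_trans _ _ (\sum_(0 <= m < n) (A + KA * (hi m + lo m)) * w m)).
    by rewrite /series /=; apply: ler_sum => m _; rewrite ler_wpM2r.
  have -> : \sum_(0 <= m < n) (A + KA * (hi m + lo m)) * w m = A * series w n +
     KA * (expR (- (s * ((1 + eps) * lam))) * (\sum_(0 <= m < n) expR (s * m%:R) * w m)
       + expR (s * ((1 - eps) * lam)) * (\sum_(0 <= m < n) expR (- s * m%:R) * w m)).
    rewrite /series /= !big_distrr -big_split big_distrr -big_split /=.
    by apply: eq_bigr => m _; rewrite /hi /lo; ring.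
  rewrite lerD2l [2 * KA]mulrC -[KA * 2 * _]mulrA ler_wpM2l //.
  have h1 := mgf s n s1; have h2 := mgf (- s) n s2.
  rewrite mulr_natl mulr2n; apply: lerD.
    apply: le_trans (ler_wpM2l (expR_ge0 _) h1) _.
    by rewrite -expRD ler_expR eD le_eqVlt; apply/orP; left; apply/eqP; ring.
  apply: le_trans (ler_wpM2l (expR_ge0 _) h2) _.
  by rewrite -expRD ler_expR eD le_eqVlt; apply/orP; left; apply/eqP; ring.
have cg := is_cvg_wsum w0 cw gK.
apply: (ler_cvg_to cg (g := fun n => A * series w n + 2 * KA * expR (- (delta * lam)))).
  apply: cvgD; last exact: cvg_cst.
  by apply: cvgM => //; exact: cvg_cst.
by near=> n; exact: partial.
Unshelve. all: by end_near. Qed.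

Lemma wsumN w g M K : (forall m, 0 <= w m) -> series w @ \oo --> M ->
  (forall m, `|g m| <= K) -> wsum w (fun m => - g m) = - wsum w g.
Proof.
move=> w0 cw gK; have cg := is_cvg_wsum w0 cw gK.
have e : series (fun m => - g m * w m) = - series (fun m => g m * w m).
  apply/funext => n; rewrite /series /= /GRing.opp /= -sumrN.
  by apply: eq_bigr => m _; rewrite mulNr.
by rewrite /wsum e limN.
Qed.

Lemma wsum_window_ge w g M lam C eps K A :
  (forall m, 0 <= w m) -> series w @ \oo --> M -> mgf_bound w lam C ->
  0 < C -> 0 < eps <= C -> (forall m, `|g m| <= K) ->
  (forall m, (1 - eps) * lam <= m%:R <= (1 + eps) * lam -> A <= g m) ->
  A * M - 2 * (K + `|A|) * expR (- (eps ^+ 2 / (4 * C) * lam)) <= wsum w g.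
Proof.
move=> w0 cw mgf C0 eC gK gA; rewrite -lerN2 -(wsumN w0 cw gK) opprB addrC -mulNr.
rewrite -(normrN A); apply: wsum_window_le => // m; rewrite ?normrN // lerN2.
exact: gA.
Qed.

Definition concentrated {T : Type} (F : set_system T) (lam : T -> R)
    (w : T -> nat -> R) (mu C : R) : Prop :=
  lam @ F --> +oo /\ exists M : T -> R, M @ F --> mu /\
    \forall t \near F, [/\ (forall m, 0 <= w t m), series (w t) @ \oo --> M t &
                           mgf_bound (w t) (lam t) C].

Lemma cvg_tail {T : Type} {F : set_system T} {FF : Filter F} (lam : T -> R)
    (delta b K : R) : 0 < delta -> lam @ F --> +oo ->
  K * (expR (- (delta * lam t)) * lam t `^ b) @[t --> F] --> (0 : R).
Proof.
move=> d0 lF.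
rewrite -[X in _ --> X](mulr0 K); apply: cvgM; first exact: cvg_cst.
exact: (cvg_comp _ _ lF (@expR_decay R delta b d0)).
Qed.

Lemma wsum_abelian {T : Type} {F : set_system T} {FF : ProperFilter F}
    (lam : T -> R) (w : T -> nat -> R) (mu C b c K : R) g :
  0 < C -> 0 <= b -> 0 < c -> concentrated F lam w mu C ->
  (forall m, `|g m| <= K) -> g m * m%:R `^ b @[m --> \oo] --> c ->
  wsum (w t) g * lam t `^ b @[t --> F] --> c * mu.
Proof.
move=> C0 b0 c0 [lF [M [cM wF]]] gK cg.
have lpos : \forall t \near F, 0 < lam t.
  by move/cvgryPgt: lF; apply.
apply: (@eps_sandwich _ _ _ _ _ (fun e => (c - e) * ((1 + e) `^ (- b)) * mu)
   (fun e => (c + e) * ((1 - e) `^ (- b)) * mu)).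
- rewrite -[X in _ --> X * mu]mulr1; apply: cvgM; last exact: cvg_cst.
  apply: cvgM.
    rewrite -[X in _ --> X]subr0; apply: cvgB; first exact: cvg_cst.
    exact: cvg_at_right_filter.
  apply: powR_cvg1; rewrite -[X in _ --> X]addr0.
  by apply: cvgD; [exact: cvg_cst|exact: cvg_at_right_filter].
- rewrite -[X in _ --> X * mu]mulr1; apply: cvgM; last exact: cvg_cst.
  apply: cvgM.
    rewrite -[X in _ --> X]addr0; apply: cvgD; first exact: cvg_cst.
    exact: cvg_at_right_filter.
  apply: powR_cvg1; rewrite -[X in _ --> X]subr0.
  by apply: cvgB; [exact: cvg_cst|exact: cvg_at_right_filter].
near=> e.
have e0 : 0 < e by near: e; exact: nbhs_right_gt.
have ec : e < c by near: e; exact: nbhs_right_lt.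
have eC : e < C by near: e; exact: nbhs_right_lt.
have e1 : e < 1 by near: e; exact: nbhs_right_lt.
pose delta := e ^+ 2 / (4 * C).
have d0 : 0 < delta by rewrite divr_gt0 ?exprn_gt0 // mulr_gt0.
pose Al t := (c - e) * ((1 + e) * lam t) `^ (- b).
pose Au t := (c + e) * ((1 - e) * lam t) `^ (- b).
exists (fun t => (c - e) * ((1 + e) `^ (- b)) * M t
   - 2 * (K + (c - e) * (1 + e) `^ (- b)) * (expR (- (delta * lam t)) * lam t `^ b)).
exists (fun t => (c + e) * ((1 - e) `^ (- b)) * M t
   + 2 * (K + (c + e) * (1 - e) `^ (- b)) * (expR (- (delta * lam t)) * lam t `^ b)).
split.
- rewrite -[X in _ --> X]subr0; apply: cvgB; last exact: cvg_tail.
  by apply: cvgM => //; exact: cvg_cst.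
- rewrite -[X in _ --> X]addr0; apply: cvgD; last exact: cvg_tail.
  by apply: cvgM => //; exact: cvg_cst.
have [N0 _ hN0] : \forall m \near \oo, c - e <= g m * m%:R `^ b <= c + e.
  move/cvgrPdist_le: cg => /(_ _ e0); apply: filterS => m.
  by rewrite ler_norml => /andP[? ?]; apply/andP; split; lra.
near=> t.
have lt0 : 0 < lam t by near: t.
have l1 : 1 <= lam t by near: t; move/cvgryPge: lF; apply.
have [w0 cw mgf] : [/\ (forall m, 0 <= w t m), series (w t) @ \oo --> M t &
                           mgf_bound (w t) (lam t) C] by near: t.
have lN : N0.+1%:R <= (1 - e) * lam t.
  rewrite -ler_pdivrMl ?subr_gt0 //; near: t.
  by move/cvgryPge: lF; apply.
have win m : (1 - e) * lam t <= m%:R <= (1 + e) * lam t ->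
    Al t <= g m <= Au t.
  case/andP=> h1 h2.
  have hm : (N0.+1 <= m)%N by rewrite -(ler_nat R) (le_trans lN).
  have m0 : 0 < m%:R :> R by rewrite ltr0n (leq_trans _ hm).
  have /andP[hl hu] := hN0 m (ltnW hm).
  have pm := powR_gt0 b m0.
  have gE : g m = (g m * m%:R `^ b) * m%:R `^ (- b).
    by rewrite powRN mulfK // gt_eqF.
  have powRNle x y : 0 < x -> x <= y -> y `^ (- b) <= x `^ (- b).
    move=> x0 xy; rewrite !powRN lef_pV2 ?posrE ?powR_gt0 //; last exact: lt_le_trans xy.
    by apply: ge0_ler_powR => //; rewrite nnegrE ltW //; exact: lt_le_trans xy.
  rewrite gE; apply/andP; split.
    by apply: ler_pM => //; rewrite ?powR_ge0 ?subr_ge0 ?(ltW ec) // powRNle.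
  apply: ler_pM => //; rewrite ?powR_ge0 //.
    by apply: le_trans hl; rewrite subr_ge0 ltW.
  by apply: powRNle => //; rewrite mulr_gt0 ?subr_gt0.
have lb : lam t `^ (- b) * lam t `^ b = 1 by rewrite powRN mulVf // gt_eqF // powR_gt0.
have pb := powR_gt0 b lt0.
have AlE : Al t * lam t `^ b = (c - e) * (1 + e) `^ (- b).
  by rewrite /Al powRM ?(ltW lt0) ?addr_ge0 ?(ltW e0) // -!mulrA lb mulr1.
have AuE : Au t * lam t `^ b = (c + e) * (1 - e) `^ (- b).
  by rewrite /Au powRM ?(ltW lt0) ?subr_ge0 ?(ltW e1) // -!mulrA lb mulr1.
have lb1 : lam t `^ (- b) <= 1.
  rewrite -(powRr0 (lam t)).
  by have := @ler_powR _ _ l1 (- b) 0; apply; rewrite oppr_le0.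
have Al0 : 0 <= Al t by rewrite mulr_ge0 ?powR_ge0 // subr_ge0 ltW.
have Au0 : 0 <= Au t by rewrite mulr_ge0 ?powR_ge0 // addr_ge0 // ltW.
have Ale : Al t <= (c - e) * (1 + e) `^ (- b).
  rewrite /Al powRM ?(ltW lt0) ?addr_ge0 ?(ltW e0) // mulrA ler_piMr //.
  by rewrite mulr_ge0 ?powR_ge0 // subr_ge0 ltW.
have Aue : Au t <= (c + e) * (1 - e) `^ (- b).
  rewrite /Au powRM ?(ltW lt0) ?subr_ge0 ?(ltW e1) // mulrA ler_piMr //.
  by rewrite mulr_ge0 ?powR_ge0 // addr_ge0 // ltW.
have eC' : 0 < e <= C by rewrite e0 ltW.
have ex0 := expR_ge0 (- (delta * lam t)).
apply/andP; split.
  have h := wsum_window_ge w0 cw mgf C0 eC' gK (fun m hm => proj1 (andP (win m hm))).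
  rewrite (ger0_norm Al0) -/delta in h.
  have h2 := ler_wpM2r (ltW pb) h; apply: le_trans h2.
  rewrite [leRHS]mulrBl -AlE [X in _ - X]mulrA [Al t * _ * _]mulrAC lerB // ler_wpM2r ?(ltW pb) //.
  by rewrite ler_wpM2r // ler_wpM2l // lerD2l AlE.
have h := wsum_window_le w0 cw mgf C0 eC' gK (fun m hm => proj2 (andP (win m hm))).
rewrite (ger0_norm Au0) -/delta in h.
have h2 := ler_wpM2r (ltW pb) h; apply: le_trans h2 _.
rewrite [leLHS]mulrDl -AuE [X in _ <= _ + X]mulrA [Au t * _ * _]mulrAC lerD // ler_wpM2r ?(ltW pb) //.
by rewrite ler_wpM2r // ler_wpM2l // lerD2l AuE.
Unshelve. all: by end_near. Qed.

(** Monotonicity turns averages back into values. With [t = m / (1 - e)] the window lies to the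
    right of [m], so the average bounds [g m] from below; with [t = m / (1 + e)] it lies to the left
    and bounds [g m] from above. *)
Lemma wsum_tauberian (w : R -> nat -> R) (mu C b c : R) g :
  0 < C -> 0 <= b -> 0 < mu -> concentrated +oo%R id w mu C ->
  (forall m, 0 <= g m) -> (forall m n, (m <= n)%N -> g n <= g m) ->
  wsum (w t) g * t `^ b @[t --> +oo] --> c ->
  g m * m%:R `^ b @[m --> \oo] --> c / mu.
Proof.
move=> C0 b0 mu0 [_ [M [cM wF]]] g0 gdec cI.
pose K := g 0%N.
have gK m : `|g m| <= K by rewrite ger0_norm // gdec.
have K0 : 0 <= K := g0 _.
have cN (a : R) : 0 < a -> a * (m%:R : R) @[m --> \oo] --> +oo.
  move=> a0; apply/cvgryPge => A; have /cvgryPge/(_ (a^-1 * A)) := @cvgr_idn R.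
  by apply: filterS => m; rewrite ler_pdivrMl.
apply: (@eps_sandwich _ _ _ _ _ (fun e => (1 - e) `^ b * (c / mu))
   (fun e => (1 + e) `^ b * (c / mu))).
- rewrite -[X in _ --> X]mul1r; apply: cvgM; last exact: cvg_cst.
  apply: powR_cvg1; rewrite -[X in _ --> X]subr0.
  by apply: cvgB; [exact: cvg_cst|exact: cvg_at_right_filter].
- rewrite -[X in _ --> X]mul1r; apply: cvgM; last exact: cvg_cst.
  apply: powR_cvg1; rewrite -[X in _ --> X]addr0.
  by apply: cvgD; [exact: cvg_cst|exact: cvg_at_right_filter].
near=> e.
have e0 : 0 < e by near: e; exact: nbhs_right_gt.
have eC : e < C by near: e; exact: nbhs_right_lt.
have e1 : e < 1 by near: e; exact: nbhs_right_lt.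
have eC' : 0 < e <= C by rewrite e0 ltW.
pose delta := e ^+ 2 / (4 * C).
have d0 : 0 < delta by rewrite divr_gt0 ?exprn_gt0 // mulr_gt0.
pose I t := wsum (w t) g * t `^ b.
(* The tail constant [2 * (K + |A|)] with [A = g m], which is at most [K]. *)
pose tl t := 4 * K * (expR (- (delta * t)) * t `^ b).
have ctl : tl t @[t --> +oo] --> (0 : R) by exact: cvg_tail cvg_id.
have cV : (M t)^-1 @[t --> +oo] --> mu^-1.
  by apply: cvgV => //; rewrite gt_eqF.
pose lo t := (1 - e) `^ b * ((I t - tl t) / M t).
pose up t := (1 + e) `^ b * ((I t + tl t) / M t).
have clo : lo t @[t --> +oo] --> (1 - e) `^ b * (c / mu).
  apply: cvgM; first exact: cvg_cst; apply: cvgM => //.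
  by rewrite -[X in _ --> X]subr0; apply: cvgB.
have cup : up t @[t --> +oo] --> (1 + e) `^ b * (c / mu).
  apply: cvgM; first exact: cvg_cst; apply: cvgM => //.
  by rewrite -[X in _ --> X]addr0; apply: cvgD.
have p1 : 0 < 1 - e by rewrite subr_gt0.
have p2 : 0 < 1 + e by rewrite addr_gt0.
have q1 : 0 < (1 - e)^-1 by rewrite invr_gt0.
have q2 : 0 < (1 + e)^-1 by rewrite invr_gt0.
exists (fun m => lo ((1 - e)^-1 * m%:R)), (fun m => up ((1 + e)^-1 * m%:R)); split.
- exact: (cvg_comp _ _ (cN _ q1) clo).
- exact: (cvg_comp _ _ (cN _ q2) cup).
pose P t := [/\ 0 < t, 0 < M t & [/\ (forall m, 0 <= w t m),
    series (w t) @ \oo --> M t & mgf_bound (w t) t C]].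
have good : \forall t \near +oo, P t.
  near=> t; split; [|by near: t; apply: (cvgr_gt mu)|by near: t].
  by near: t; exact: nbhs_pinfty_gt.
have core t m (a : R) : 0 < a -> a * t = m%:R -> 0 < t -> g m * m%:R `^ b = a `^ b * (g m * t `^ b).
  by move=> a0 <- t0; rewrite powRM ?(ltW a0) ?(ltW t0) // mulrCA.
near=> m; apply/andP; split.
  have : P ((1 - e)^-1 * m%:R) by near: m; exact: (cN _ q1 _ good).
  set t := (1 - e)^-1 * m%:R => -[t0 M0 [w0 cw mgf]].
  have tm : (1 - e) * t = m%:R by rewrite /t mulVKf // gt_eqF.
  rewrite (core t m _ p1 tm t0) -/t /lo ler_wpM2l ?powR_ge0 // ler_pdivrMr //.
  have win j : (1 - e) * t <= j%:R <= (1 + e) * t -> g j <= g m.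
    by case/andP=> h _; apply: gdec; rewrite -(ler_nat R) -tm.
  have h := wsum_window_le w0 cw mgf C0 eC' gK win.
  have gm := gK m; have ex0 := expR_ge0 (- (delta * t)).
  have pt := powR_ge0 t b.
  have h1 : wsum (w t) g <= g m * M t + 4 * K * expR (- (delta * t)).
    apply: (le_trans h); rewrite lerD2l -/delta ler_wpM2r //.
    by lra.
  have h2 := ler_wpM2r pt h1.
  by rewrite /I /tl mulrA; lra.
have : P ((1 + e)^-1 * m%:R) by near: m; exact: (cN _ q2 _ good).
set t := (1 + e)^-1 * m%:R => -[t0 M0 [w0 cw mgf]].
have tm : (1 + e) * t = m%:R by rewrite /t mulVKf // gt_eqF.
rewrite (core t m _ p2 tm t0) -/t /up ler_wpM2l ?powR_ge0 // ler_pdivlMr //.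
have win j : (1 - e) * t <= j%:R <= (1 + e) * t -> g m <= g j.
  by case/andP=> _ h; apply: gdec; rewrite -(ler_nat R) -tm.
have h := wsum_window_ge w0 cw mgf C0 eC' gK win.
have gm := gK m; have ex0 := expR_ge0 (- (delta * t)).
have pt := powR_ge0 t b.
have h1 : g m * M t - 4 * K * expR (- (delta * t)) <= wsum (w t) g.
  apply: le_trans h; rewrite lerD2l lerN2 -/delta ler_wpM2r //.
  by lra.
have h2 := ler_wpM2r pt h1.
by rewrite /I /tl mulrA; lra.
Unshelve. all: by end_near. Qed.

End Concentration.

(** * Exponential generating functions as convergent series *)

Section Series.
Variable R : realType.

Lemma cvg_det {T : Type} {F : set_system T} {FF : Filter F} n
    (A : T -> 'M[R]_n) (B : 'M[R]_n) :
  (forall i j, A t i j @[t --> F] --> B i j) -> \det (A t) @[t --> F] --> \det B.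
Proof.
move=> cA; apply: cvg_big => [|s _]; first exact: add_continuous.
apply: cvgM; first exact: cvg_cst.
by apply: cvg_big => [|i _]; first exact: mul_continuous.
Qed.

Definition egf_term (u : nat -> R) (z : R) (n : nat) : R := u n * z ^+ n / n`!%:R.

Lemma cvg_exp_series (x : R) : series (fun n => x ^+ n / n`!%:R) @ \oo --> expR x.
Proof. exact: is_cvg_series_exp_coeff. Qed.

Lemma exp_series_le (x : R) N : 0 <= x -> \sum_(0 <= n < N) x ^+ n / n`!%:R <= expR x.
Proof.
move=> x0; have c := @cvg_exp_series x.
have : nondecreasing_seq (series (fun n => x ^+ n / n`!%:R)).
  by apply/nondecreasing_series => n _ _; rewrite divr_ge0 ?exprn_ge0.
by move=> nd; have := nondecreasing_cvgn_le nd (cvgP _ c) N; rewrite (cvg_lim _ c).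
Qed.

Lemma is_cvg_egf (u : nat -> R) (C K z : R) : 0 <= z -> 0 <= C ->
  (forall n, `|u n| <= K * C ^+ n) -> cvgn (series (egf_term u z)).
Proof.
move=> z0 C0 uK; apply: normed_cvg.
have K0 : 0 <= K by have := uK 0%N; rewrite expr0 mulr1; apply: le_trans.
apply: (@series_le_cvg _ _ (fun n => K * ((C * z) ^+ n / n`!%:R))).
- by move=> n; exact: normr_ge0.
- by move=> n; rewrite mulr_ge0 // divr_ge0 // exprn_ge0 // mulr_ge0.
- move=> n /=; rewrite /egf_term !normrM normrV ?unitfE ?pnatr_eq0 -?lt0n ?fact_gt0 //.
  rewrite (ger0_norm (exprn_ge0 n z0)) (ger0_norm (ler0n _ _)) exprMn !mulrA.
  by rewrite ler_wpM2r ?invr_ge0 // ler_wpM2r // exprn_ge0.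
- have -> : series (fun n => K * ((C * z) ^+ n / n`!%:R)) =
     (fun n => K * series (fun n => (C * z) ^+ n / n`!%:R) n).
    by apply/funext => n; rewrite /series /= big_distrr.
  apply: is_cvgM; first exact: is_cvg_cst.
  by apply/cvg_ex; exists (expR (C * z)); exact: cvg_exp_series.
Qed.

(** The Cauchy product of two nonnegative series: its partial sum at [n] lies between the product of
    the partial sums at [n./2] and the partial sum at [n] of one factor times the limit of the
    other. *)
Lemma egf_convol (u : nat -> R) (a c z : R) : 0 <= z -> 0 <= c ->
  (forall n, 0 <= u n) -> series (egf_term u z) @ \oo --> a ->
  series (egf_term (fun n => \sum_(l < n.+1) 'C(n, l)%:R * c ^+ (n - l) * u l) z)
    @ \oo --> expR (c * z) * a.
Proof.
move=> z0 c0 u0 cu.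
pose A := series (egf_term u z).
pose v n := (c * z) ^+ n / n`!%:R.
pose B := series v.
have v0 n : 0 <= v n by rewrite divr_ge0 ?exprn_ge0 ?mulr_ge0.
have t0 n : 0 <= egf_term u z n.
  by rewrite /egf_term divr_ge0 ?mulr_ge0 ?exprn_ge0.
have cB : B @ \oo --> expR (c * z) by exact: cvg_exp_series.
pose W := series (egf_term (fun n => \sum_(l < n.+1) 'C(n, l)%:R * c ^+ (n - l) * u l) z).
have term n : egf_term (fun n => \sum_(l < n.+1) 'C(n, l)%:R * c ^+ (n - l) * u l) z n
    = \sum_(l < n.+1) egf_term u z l * v (n - l)%N.
  rewrite /egf_term !mulr_suml; apply: eq_bigr => l _; rewrite /v exprMn.
  have ln : (l <= n)%N by rewrite -ltnS.
  have f0 k : k`!%:R != 0 :> R by rewrite pnatr_eq0 -lt0n fact_gt0.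
  have -> : n`!%:R = 'C(n, l)%:R * (l`!%:R * (n - l)`!%:R) :> R.
    by rewrite -!natrM bin_fact.
  have C0 : 'C(n, l)%:R != 0 :> R by rewrite pnatr_eq0 -lt0n bin_gt0.
  have -> : z ^+ n = z ^+ (n - l) * z ^+ l by rewrite -exprD subnK.
  have := f0 l; have := f0 (n - l)%N; move: C0.
  move: ('C(n, l)%:R) (l`!%:R) ((n - l)`!%:R) (c ^+ (n - l)) (u l) (z ^+ (n - l)) (z ^+ l).
  by move=> x1 x2 x3 x4 x5 x6 x7 h1 h2 h3; field; rewrite h1 h2 h3.
have WE n : W n = \sum_(0 <= l < n) egf_term u z l * B (n - l)%N.
  elim: n => [|n IH]; first by rewrite /W /series /= !big_nil.
  rewrite /W seriesSr -/W IH term big_nat_recr //= subSnn.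
  rewrite (big_ord_recr n) /= subnn addrA; congr (_ + _); last first.
    by rewrite /B /series /= big_nat1.
  rewrite -(big_mkord xpredT (fun l => egf_term u z l * v (n - l)%N)) -big_split /=.
  apply: eq_big_nat => l /andP[_ ln]; rewrite -mulrDr; congr (_ * _).
  by rewrite subSn ?(ltnW ln) // /B seriesSr.
have Bnd : nondecreasing_seq B by apply/nondecreasing_series => n _ _.
have And : nondecreasing_seq A by apply/nondecreasing_series => n _ _.
have Ble n : B n <= expR (c * z) by apply: exp_series_le; rewrite mulr_ge0.
apply: (@squeeze_cvgr _ _ _ _ (fun n => B n./2 * A n./2) (fun n => expR (c * z) * A n)).
- near=> n; rewrite -/W WE; apply/andP; split; last first.
    rewrite mulrC /A /series /= big_distrl /=.
    by apply: ler_sum => l _; rewrite ler_wpM2l.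
  rewrite mulrC /A /series /= big_distrl /=.
  have hn : (n./2 <= n)%N by rewrite -{2}(odd_double_half n) -addnn; lia.
  rewrite (big_cat_nat _ hn) //= -[leLHS]addr0; apply: lerD.
    rewrite !big_nat; apply: ler_sum => l /andP[_ lh]; rewrite ler_wpM2l // Bnd //.
    by have := odd_double_half n; rewrite -addnn; lia.
  apply: sumr_ge0 => l _; rewrite mulr_ge0 // /B /series /= sumr_ge0 //.
- have ch : (fun n => n./2) @ \oo --> \oo.
    apply/cvgnyPge => K; near=> n.
    have : (K.*2 <= n)%N by near: n; exact: nbhs_infty_ge.
    by move=> h; rewrite -(doubleK K) half_leq.
  by apply: cvgM; apply: (cvg_comp _ _ ch).
- by apply: cvgM => //; exact: cvg_cst.
Unshelve. all: by end_near. Qed.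

End Series.

Lemma line_walks_le n i j : (line_walks n i j <= 2 ^ n)%N.
Proof.
elim: n i => [|n IH] i /=; first by rewrite leq_b1.
rewrite expnS mul2n -addnn leq_add //.
by case: i => [|i]; rewrite ?IH ?leq0n.
Qed.

Section NonnegPoly.
Variable R : realType.

Lemma coef_prod_ge0 (I : Type) (r : seq I) (p : I -> {poly R}) :
  (forall i n, 0 <= (p i)`_n) -> forall n, 0 <= (\prod_(i <- r) p i)`_n.
Proof.
move=> p0; elim: r => [|i r IH] n; first by rewrite big_nil coef1.
by rewrite big_cons coefM sumr_ge0 // => k _; rewrite mulr_ge0.
Qed.

Lemma coef_le_horner (p : {poly R}) (x : R) n : 0 <= x -> (forall n, 0 <= p`_n) ->
  p`_n * x ^+ n <= p.[x].
Proof.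
move=> x0 p0; rewrite horner_coef; have [lt|ge] := ltnP n (size p); last first.
  by rewrite nth_default // mul0r sumr_ge0 // => i _; rewrite mulr_ge0 ?exprn_ge0.
rewrite (bigD1 (Ordinal lt)) //= lerDl sumr_ge0 // => i _.
by rewrite mulr_ge0 ?exprn_ge0.
Qed.

End NonnegPoly.

Section WalkEgf.
Variable R : realType.
Variable d : nat.

Definition line_sum (z : R) (i j : nat) : R :=
  limn (series (egf_term (fun n => (line_walks n i j)%:R) z)).

Lemma cvg_line_sum z i j : 0 <= z ->
  series (egf_term (fun n => (line_walks n i j)%:R) z) @ \oo --> line_sum z i j.
Proof.
move=> z0; apply: (@is_cvg_egf _ _ 2 1) => // n.
by rewrite mul1r ger0_norm // -natrX ler_nat line_walks_le.
Qed.

Lemma horner_line_egf N i j (z : R) :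
  (line_egf R N i j).[z] = series (egf_term (fun n => (line_walks n i j)%:R) z) N.+1.
Proof.
rewrite horner_poly /series /= big_mkord; apply: eq_bigr => n _.
by rewrite /egf_term mulrAC.
Qed.

Lemma coef_line_egf_ge0 N i j n : 0 <= (line_egf R N i j)`_n.
Proof. by rewrite coef_poly; case: ifP => // _; rewrite divr_ge0. Qed.

Lemma horner_line_egf_le N i j (x : R) : 0 <= x ->
  (line_egf R N i j).[x] <= expR (2 * x).
Proof.
move=> x0; rewrite horner_line_egf.
apply: le_trans (@exp_series_le _ (2 * x) N.+1 _); last by rewrite mulr_ge0.
rewrite /series /=; apply: ler_sum => n _; rewrite /egf_term ler_wpM2r ?invr_ge0 //.
by rewrite exprMn ler_wpM2r ?exprn_ge0 // -natrX ler_nat line_walks_le.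
Qed.

(** Cauchy's estimate, uniform in [N]: each Leibniz term is up to sign a product of polynomials with
    nonnegative coefficients, each at most [e^(2x)] at [x]. *)
Lemma coef_walk_det_le N (y : 'I_d -> nat) (x : R) n : 0 <= x ->
  `|(\det (walk_mx R N y))`_n| * x ^+ n <= (d`!)%:R * expR (2 * x) ^+ d.
Proof.
move=> x0; rewrite /determinant coef_sum.
apply: (@le_trans _ _ (\sum_(s : 'S_d) (\prod_i line_egf R N (y i) (d.-1 - s i))`_n * x ^+ n)).
  rewrite -mulr_suml ler_wpM2r ?exprn_ge0 //.
  apply: le_trans (ler_norm_sum _ _ _) _; apply: ler_sum => s _.
  rewrite mulr_sign; under eq_bigr do rewrite mxE.
  by case: (odd_perm s); rewrite ?coefN ?normrN ger0_norm // coef_prod_ge0 // => *;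
     apply: coef_line_egf_ge0.
apply: (@le_trans _ _ (\sum_(s : 'S_d) expR (2 * x) ^+ d)); last first.
  by rewrite sumr_const card_Sn [leRHS]mulr_natl.
apply: ler_sum => s _; apply: (le_trans (coef_le_horner _ x0 _)).
  by apply: coef_prod_ge0 => *; apply: coef_line_egf_ge0.
rewrite horner_prod -[X in _ ^+ X]card_ord -prodr_const.
apply: ler_prod => i _; rewrite horner_line_egf_le // andbT.
rewrite horner_coef sumr_ge0 // => k _.
by rewrite mulr_ge0 ?exprn_ge0 // coef_line_egf_ge0.
Qed.

(** Up to degree [N] the truncated determinant [P N] has the right coefficients. Its higher ones are
    truncation artefacts; estimating them at radius [2 * z] makes their contribution at [z] of order
    [2^-N]. *)
Lemma cvg_walks_egf (z : R) : 0 < z ->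
  series (egf_term (fun n => (walks d n (fun=> 0%N))%:R) z) @ \oo -->
  \det (\matrix_(i < d, j < d) line_sum z (d.-1 - i) (d.-1 - j)).
Proof.
move=> z0; pose P N := \det (walk_mx R N (@shifted d (fun=> 0%N))).
pose E := series (egf_term (fun n => (walks d n (fun=> 0%N))%:R) z).
pose K := (d`!)%:R * expR (2 * (2 * z)) ^+ d.
have z2 : 0 <= 2 * z by rewrite mulr_ge0 // ltW.
have tail N : `|(P N).[z] - E N.+1| <= K * 2^-1 ^+ N.
  rewrite (@horner_coef_wide _ (N.+1 + size (P N))) ?leq_addl //.
  rewrite -(big_mkord xpredT (fun i => (P N)`_i * z ^+ i)).
  rewrite (@big_cat_nat _ _ _ N.+1) ?leq_addr //=.
  have -> : \sum_(0 <= i < N.+1) (P N)`_i * z ^+ i = E N.+1.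
    rewrite /E /series /= !big_nat; apply: eq_bigr => i /andP[_ iN].
    by rewrite /P walk_mx_coef // /egf_term mulrAC.
  rewrite addrC addrK; apply: le_trans (ler_norm_sum _ _ _) _.
  have half_ge0 k : 0 <= 2^-1 ^+ k :> R by rewrite exprn_ge0 // invr_ge0.
  apply: (@le_trans _ _ (\sum_(N.+1 <= i < N.+1 + size (P N)) K * 2^-1 ^+ i)).
    apply: ler_sum => i _; have := coef_walk_det_le N (@shifted d (fun=> 0%N)) i z2.
    rewrite -/K -/(P N) exprMn mulrCA -ler_pdivlMl ?exprn_gt0 // => h.
    by rewrite normrM (ger0_norm (exprn_ge0 i (ltW z0))) (le_trans h) // mulrC exprVn.
  rewrite -mulr_sumr ler_wpM2l //.
    by rewrite mulr_ge0 ?exprn_ge0 ?expR_ge0.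
  elim: (size _) => [|s IH]; first by rewrite addn0 big_geq.
  suff -> : \sum_(N.+1 <= i < N.+1 + s.+1) 2^-1 ^+ i = 2^-1 ^+ N - 2^-1 ^+ (N + s.+1) :> R.
    by rewrite lerBlDr lerDl.
  elim: s {IH} => [|s IH].
    by rewrite addn1 big_nat1 addn1 !exprS; move: (2^-1 ^+ N) => a; lra.
  rewrite addnS big_nat_recr /=; last by rewrite leq_addr.
  rewrite IH addSn [(N + s.+2)%N]addnS !(exprS _ (N + s.+1)).
  by move: (2^-1 ^+ (N + s.+1)) (2^-1 ^+ N) => a b; lra.
have cP : (P N).[z] @[N --> \oo] -->
    \det (\matrix_(i < d, j < d) line_sum z (d.-1 - i) (d.-1 - j)).
  have -> : (fun N => (P N).[z]) = (fun N => \det (map_mx (horner_eval z)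
      (walk_mx R N (@shifted d (fun=> 0%N))))).
    by apply/funext => N; rewrite det_map_mx.
  apply: cvg_det => i j; rewrite mxE.
  have -> : (fun N => map_mx (horner_eval z) (walk_mx R N (@shifted d (fun=> 0%N))) i j)
     = (fun N => series (egf_term (fun n => (line_walks n (d.-1 - i) (d.-1 - j))%:R) z) N.+1).
    by apply/funext => N; rewrite !mxE -horner_line_egf.
  have := @cvg_line_sum z (d.-1 - i) (d.-1 - j) (ltW z0).
  by rewrite -cvg_shiftS.
rewrite -cvg_shiftS -/E.
have c0 : K * 2^-1 ^+ N @[N --> \oo] --> (0 : R).
  rewrite -[X in _ --> X](mulr0 K); apply: cvgM; first exact: cvg_cst.
  by apply: cvg_expr; rewrite ger0_norm ?invr_ge0 // invf_lt1 // ltr1n.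
have cd : (P N).[z] - E N.+1 @[N --> \oo] --> (0 : R).
  apply/cvgr0Pnorm_le => e e0; move/cvgr0Pnorm_le: c0 => /(_ _ e0).
  apply: filterS => N h; apply: le_trans (tail N) _.
  by rewrite (le_trans (ler_norm _)).
have h := cvgB cP cd; rewrite subr0 in h.
suff <- : (fun N => (P N).[z]) - (fun N => (P N).[z] - E N.+1) = [sequence E n.+1]_n by exact: h.
by apply/funext => N; rewrite fctE opprB addrC subrK.
Qed.

End WalkEgf.

(** * The limiting Hankel determinant *)

Section Hankel.
Variable R : realFieldType.

(** The moments of the Gamma density proportional to [y^(1/2) e^(-y/4)], the local shape of the
    semicircle at its edge under exponential tilting. *)
Definition hankel_coef (p : nat) : R := \prod_(l < p) (4 * l%:R + 6).

(* The recursion comes from [4 (i + j) + 6 = (4 l + 4 i + 6) + 4 (j - l)], which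
   expands the quotient [hankel_coef (i + j) / hankel_coef j] in the polynomials
   [falling4 j l]. *)
Fixpoint hankel_low (i l : nat) : R :=
  if i is i'.+1 then
    (4 * l%:R + 4 * i'%:R + 6) * hankel_low i' l +
      (if l is l'.+1 then hankel_low i' l' else 0)
  else (l == 0%N)%:R.

Definition falling4 (j l : nat) : R := \prod_(t < l) (4 * (j%:R - t%:R)).

Lemma hankel_low_gt i l : (i < l)%N -> hankel_low i l = 0.
Proof.
elim: i l => [|i IH] [|l] //= il.
by rewrite !IH ?mulr0 ?addr0 // ltnW.
Qed.

Lemma hankel_low_diag i : hankel_low i i = 1.
Proof. by elim: i => [|i IH] //=; rewrite hankel_low_gt // mulr0 add0r. Qed.

Lemma falling4_gt j l : (j < l)%N -> falling4 j l = 0.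
Proof.
by move=> jl; rewrite /falling4 (bigD1 (Ordinal jl)) //= subrr mulr0 mul0r.
Qed.

Lemma falling4_diag j : 0 < falling4 j j.
Proof.
by apply: prodr_gt0 => t _; rewrite mulr_gt0 // subr_gt0 ltr_nat.
Qed.

Lemma hankel_coef_gt0 p : 0 < hankel_coef p.
Proof.
by apply: prodr_gt0 => l _; rewrite ltr_wpDl ?mulr_ge0.
Qed.

Lemma hankel_coefD i j :
  hankel_coef (i + j) = hankel_coef j * \sum_(l < i.+1) hankel_low i l * falling4 j l.
Proof.
suff gen N : (i < N)%N -> hankel_coef (i + j) =
    hankel_coef j * \sum_(l < N) hankel_low i l * falling4 j l by exact: gen.
elim: i N => [|i IH] [|N] // iN.
  rewrite big_ord_recl big1 => [|l _]; last by rewrite /= mul0r.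
  by rewrite /= /falling4 big_ord0 mul1r addr0 mulr1.
rewrite addSn /hankel_coef big_ord_recr /= -/(hankel_coef (i + j)) -/(hankel_coef j).
rewrite (IH N.+1) ?ltnS 1?ltnW // -mulrA; congr (_ * _).
rewrite mulr_suml.
have step l : hankel_low i l * falling4 j l * (4 * (i + j)%:R + 6) =
    (4 * l%:R + 4 * i%:R + 6) * hankel_low i l * falling4 j l +
    hankel_low i l * falling4 j l.+1.
  by rewrite [falling4 j l.+1]big_ord_recr /= -/(falling4 j l) natrD; ring.
rewrite (eq_bigr _ (fun (l : 'I_N.+1) _ => step l)) big_split /=; under [RHS]eq_bigr do rewrite mulrDl.
rewrite [RHS]big_split /=; congr (_ + _).
rewrite [RHS]big_ord_recl /= mul0r add0r big_ord_recr /=.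
by rewrite hankel_low_gt // mul0r addr0.
Qed.

Lemma hankel_det_gt0 d : 0 < \det (\matrix_(i < d, j < d) hankel_coef (i + j)).
Proof.
pose L : 'M[R]_d := \matrix_(i, l) hankel_low i l.
pose U : 'M[R]_d := \matrix_(j, l) (hankel_coef j * falling4 j l).
have -> : \matrix_(i < d, j < d) hankel_coef (i + j) = L *m U^T.
  apply/matrixP => i j; rewrite !mxE hankel_coefD.
  rewrite (big_ord_widen d (fun l => hankel_low i l * falling4 j l)) // big_mkcond /=.
  rewrite big_distrr /=; apply: eq_bigr => l _; rewrite !mxE.
  case: ltnP => [_|il]; first by rewrite mulrCA.
  by rewrite hankel_low_gt // mulr0 mul0r.
rewrite det_mulmx det_tr !det_trig.
- rewrite big1 => [|i _]; last by rewrite mxE hankel_low_diag.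
  by rewrite mul1r prodr_gt0 // => i _; rewrite mxE mulr_gt0 ?hankel_coef_gt0 ?falling4_diag.
- by apply/is_trig_mxP => i j ij; rewrite mxE falling4_gt ?mulr0.
- by apply/is_trig_mxP => i j ij; rewrite mxE hankel_low_gt.
Qed.

End Hankel.

(** * Growth of the normalised Beta moments *)

Section BetaBounds.
Variable R : realFieldType.

Lemma beta_momentSE m p : beta_moment R m.+1 p = (4 * m%:R + 6) / (m%:R + p%:R + 3) * beta_moment R m p.
Proof.
have h : 0 < m%:R + p%:R + 3 :> R by rewrite ltr_wpDl ?addr_ge0.
by apply: (mulfI (lt0r_neq0 h)); rewrite beta_momentS [RHS]mulrA [_ * (_ / _)]mulrC divfK ?gt_eqF.
Qed.

Lemma beta_moment_pSE m p : beta_moment R m p.+1 = (4 * p%:R + 6) / (m%:R + p%:R + 3) * beta_moment R m p.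
Proof.
have h : 0 < m%:R + p%:R + 3 :> R by rewrite ltr_wpDl ?addr_ge0.
by apply: (mulfI (lt0r_neq0 h)); rewrite beta_moment_pS [RHS]mulrA [_ * (_ / _)]mulrC divfK ?gt_eqF.
Qed.

Lemma beta_moment_gt0 m p : 0 < beta_moment R m p.
Proof.
elim: m => [|m IH]; first (elim: p => [|p IH]; first by rewrite beta_moment00).
  by rewrite beta_moment_pSE mulr_gt0 // divr_gt0 // ltr_wpDl ?addr_ge0 ?mulr_ge0.
by rewrite beta_momentSE mulr_gt0 // divr_gt0 // ltr_wpDl ?addr_ge0 ?mulr_ge0.
Qed.

Definition beta_norm p m : R := beta_moment R m p / 4 ^+ m.

Lemma beta_norm_gt0 p m : 0 < beta_norm p m.
Proof. by rewrite divr_gt0 ?beta_moment_gt0 ?exprn_gt0. Qed.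

Lemma beta_normS p m :
  beta_norm p m.+1 = (m%:R + 3 / 2) / (m%:R + p%:R + 3) * beta_norm p m.
Proof.
have h : 0 < m%:R + p%:R + 3 :> R by rewrite ltr_wpDl ?addr_ge0.
have f : 4 ^+ m != 0 :> R by rewrite expf_eq0 pnatr_eq0 andbF.
rewrite /beta_norm beta_momentSE exprS; move: (4 ^+ m) f (beta_moment R m p) => a f b; field.
by rewrite f gt_eqF.
Qed.

Lemma beta_norm_pS p m :
  beta_norm p.+1 m = (4 * p%:R + 6) / (m%:R + p%:R + 3) * beta_norm p m.
Proof. by rewrite /beta_norm beta_moment_pSE mulrA. Qed.

Lemma beta_norm_le p m : beta_norm p m <= beta_moment R 0 p.
Proof.
elim: m => [|m IH]; first by rewrite /beta_norm expr0 divr1.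
apply: le_trans IH; rewrite beta_normS ler_piMl ?(ltW (beta_norm_gt0 _ _)) //.
have h : 0 < m%:R + p%:R + 3 :> R by rewrite ltr_wpDl ?addr_ge0.
rewrite ler_pdivrMr // mul1r; have : 0 <= p%:R :> R by []; lra.
Qed.

End BetaBounds.

Section BetaAsymptotics.
Variable R : realType.

Lemma cvg_nat_ratio (a : R) : 0 <= a -> m%:R / (m%:R + a) @[m --> \oo] --> (1 : R).
Proof.
move=> a0; apply: (@squeeze_cvgr _ _ _ _ (fun m => 1 - a * (m%:R)^-1) (fun=> 1)).
- near=> m; have m0 : 0 < m%:R :> R by rewrite ltr0n; near: m; exact: nbhs_infty_gt.
  have ma : 0 < m%:R + a by rewrite ltr_pwDl.
  apply/andP; split; last by rewrite ler_pdivrMr // mul1r lerDl.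
  rewrite ler_pdivlMr //.
  have -> : (1 - a * m%:R^-1) * (m%:R + a) = m%:R - a ^+ 2 * m%:R^-1.
    by field; rewrite gt_eqF.
  by rewrite gerBl mulr_ge0 ?sqr_ge0 ?invr_ge0.
- rewrite -[X in _ --> X]subr0; apply: cvgB; first exact: cvg_cst.
  rewrite -[X in _ --> X](mulr0 a); apply: cvgM; first exact: cvg_cst.
  apply/gtr0_cvgV0; last exact: cvgr_idn.
  by near=> m; rewrite ltr0n; near: m; exact: nbhs_infty_gt.
- exact: cvg_cst.
Unshelve. all: by end_near. Qed.

(** No Stirling formula is needed: for [p = 0], [q] is nonincreasing and bounded below by [r 0 = 4],
    since [r m <= q m] and [r] does not decrease. So [q] has a positive limit and [kappa] is its
    square root; squaring avoids half-integer powers in the ratio test. Larger [p] follow by the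
    recursion in [p]. *)
Lemma beta_norm_cvg : exists2 kappa : R, 0 < kappa &
  forall p, beta_norm R p m * m%:R `^ (p%:R + 3 / 2) @[m --> \oo] -->
    kappa * hankel_coef R p.
Proof.
pose q m : R := beta_norm R 0 m ^+ 2 * (m%:R + 2) ^+ 3.
pose r m : R := beta_norm R 0 m ^+ 2 * ((m%:R + 1) * (m%:R + 2) ^+ 2).
have qdec : nonincreasing_seq q.
  apply/nonincreasing_seqP => m; rewrite /q beta_normS addr0 -[m.+1%:R]natr1.
  have m0 : 0 <= m%:R :> R by [].
  move: (m%:R : R) m0 (beta_norm R 0 m) => x x0 y.
  have -> : (x + 1 + 2) ^+ 3 = (x + 3) ^+ 3 by ring.
  have -> : ((x + 3 / 2) / (x + 3) * y) ^+ 2 * (x + 3) ^+ 3 =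
      y ^+ 2 * ((x + 3 / 2) ^+ 2 * (x + 3)) by field; lra.
  by rewrite ler_wpM2l ?sqr_ge0 //; nra.
have rinc m : r 0%N <= r m.
  elim: m => // m /le_trans; apply; rewrite /r beta_normS addr0 -[m.+1%:R]natr1.
  have m0 : 0 <= m%:R :> R by [].
  move: (m%:R : R) m0 (beta_norm R 0 m) => x x0 y.
  have -> : ((x + 3 / 2) / (x + 3) * y) ^+ 2 * ((x + 1 + 1) * (x + 1 + 2) ^+ 2) =
      y ^+ 2 * ((x + 3 / 2) ^+ 2 * (x + 2)) by field; lra.
  by rewrite ler_wpM2l ?sqr_ge0 //; nra.
have r0 : r 0%N = 4.
  by rewrite /r /beta_norm beta_moment00 expr0 divr1; ring.
have rq m : r m <= q m.
  rewrite /r /q ler_wpM2l ?sqr_ge0 // [leRHS]exprS ler_wpM2r ?sqr_ge0 //.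
  by rewrite lerD2l ler1n.
have q4 m : 4 <= q m by rewrite -r0 (le_trans (rinc m)).
have cq : cvgn q.
  apply: nonincreasing_is_cvgn => //; exists 4 => _ [m _ <-]; exact: q4.
have L4 : 4 <= limn q by apply: limr_ge => //; near=> m; exact: q4.
have base : beta_norm R 0 m * m%:R `^ (3 / 2) @[m --> \oo] --> Num.sqrt (limn q).
  have c1 : q m * (m%:R / (m%:R + 2)) ^+ 3 @[m --> \oo] --> limn q.
    have c2 := cvg_nat_ratio (ler0n R 2).
    have := cvgM cq (cvgM c2 (cvgM c2 c2)); rewrite !mulr1 => h; apply: (cvg_near_eq (h _ _ _)).
    by near=> m; rewrite /= !exprS expr0 mulr1.
  have c3 := continuous_cvg _ (@sqrt_continuous R (limn q)) c1.
  apply: (cvg_near_eq (c3 _)); near=> m => /=.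
  have b0 := ltW (beta_norm_gt0 R 0 m).
  have m2 : m%:R + 2 != 0 :> R by rewrite gt_eqF // ltr_wpDl.
  have -> : q m * (m%:R / (m%:R + 2)) ^+ 3 = beta_norm R 0 m ^+ 2 * m%:R ^+ 3.
    by rewrite /q; move: (m%:R : R) (beta_norm R 0 m) m2 => x y m2; field.
  rewrite sqrtrM ?sqr_ge0 // sqrtr_sqr ger0_norm //; congr (_ * _).
  by rewrite powRrM -powR12_sqrt ?powR_ge0 // powR_mulrn.
exists (Num.sqrt (limn q)); first by rewrite sqrtr_gt0; lra.
elim=> [|p IH].
  rewrite /hankel_coef big_ord0 mulr1; apply: (cvg_near_eq base).
  by near=> m; rewrite add0r.
rewrite /hankel_coef big_ord_recr /= -/(hankel_coef R p) mulrA.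
have p3 : 0 <= p%:R + 3 :> R by rewrite addr_ge0.
have c := cvgM (cvgM IH (cvg_cst (4 * p%:R + 6 : R))) (cvg_nat_ratio p3).
rewrite mulr1 in c; apply: (cvg_near_eq (c _ _ _)); near=> m => /=.
have m0 : 0 < m%:R :> R by rewrite ltr0n; near: m; exact: nbhs_infty_gt.
rewrite beta_norm_pS.
have -> : p.+1%:R + 3 / 2 = (p%:R + 3 / 2) + 1 :> R by rewrite -[p.+1%:R]natr1; ring.
rewrite (@powRD _ m%:R (p%:R + 3 / 2) 1) ?(gt_eqF m0) ?implybT // powRr1 ?(ltW m0) // !addrA.
by ring.
Unshelve. all: by end_near. Qed.

End BetaAsymptotics.

(** * Asymptotics of the walk counts *)

Section Poisson.
Variable R : realType.

Definition poisson_weight (lam : R) (m : nat) : R := expR (- lam) * (lam ^+ m / m`!%:R).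

Definition even_poisson_weight (lam : R) (m : nat) : R :=
  if odd m then 0 else poisson_weight lam m.

Lemma poisson_weight_ge0 lam m : 0 <= lam -> 0 <= poisson_weight lam m.
Proof. by move=> l0; rewrite mulr_ge0 ?expR_ge0 // divr_ge0 ?exprn_ge0. Qed.

Lemma poisson_mgf lam : 0 <= lam -> mgf_bound (poisson_weight lam) lam 2.
Proof.
move=> l0 s N s2.
have -> : \sum_(0 <= m < N) expR (s * m%:R) * poisson_weight lam m =
    expR (- lam) * \sum_(0 <= m < N) (lam * expR s) ^+ m / m`!%:R.
  rewrite big_distrr /=; apply: eq_bigr => m _.
  rewrite /poisson_weight expRM_natr exprMn mulrCA; congr (_ * _).
  by rewrite mulrA [expR s ^+ m * _]mulrC.
have le0 : 0 <= lam * expR s by rewrite mulr_ge0 ?expR_ge0.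
apply: le_trans (ler_wpM2l (expR_ge0 _) (exp_series_le N le0)) _.
rewrite -expRD ler_expR addrC -[X in _ - X]mulr1 -mulrBr ler_wpM2l //.
have : s <= 2^-1 by apply: le_trans (ler_norm _) s2.
by move/expR_le_quad; lra.
Qed.

Lemma cvg_poisson_mass lam : series (poisson_weight lam) @ \oo --> (1 : R).
Proof.
have -> : series (poisson_weight lam) =
    (fun n => expR (- lam) * series (fun m => lam ^+ m / m`!%:R) n).
  by apply/funext => n; rewrite /series /= big_distrr.
rewrite -[X in _ --> X](expR0 R) -[X in _ --> expR X](addNr lam) expRD.
by apply: cvgM; [exact: cvg_cst|exact: cvg_exp_series].
Qed.

Lemma poisson_concentrated {T : Type} {F : set_system T} {FF : Filter F} (lam : T -> R) :
  lam @ F --> +oo -> concentrated F lam (fun t => poisson_weight (lam t)) 1 2.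
Proof.
move=> lF; split=> //; exists (fun=> 1); split; first exact: cvg_cst.
have : \forall t \near F, 0 <= lam t by move/cvgryPge: lF; apply.
apply: filterS => t l0; split; [|exact: cvg_poisson_mass|exact: poisson_mgf].
by move=> m; exact: poisson_weight_ge0.
Qed.

Lemma even_poisson_concentrated : concentrated +oo%R id even_poisson_weight (2^-1) 2.
Proof.
split; first exact: cvg_id.
(* The even part of the Poisson law has mass [e^(-lam) cosh lam]. *)
exists (fun lam => 2^-1 * (1 + expR (- lam) * expR (- lam))); split.
  rewrite -[X in _ --> X]mulr1; apply: cvgM; first exact: cvg_cst.
  rewrite -[X in _ --> X]addr0; apply: cvgD; first exact: cvg_cst.
  by rewrite -[X in _ --> X](mulr0 0); apply: cvgM; exact: cvgr_expR.
near=> lam.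
have l0 : 0 <= lam by near: lam; apply: nbhs_pinfty_ge; rewrite num_real.
split.
- by move=> m; rewrite /even_poisson_weight; case: ifP => // _; exact: poisson_weight_ge0.
- have -> : series (even_poisson_weight lam) = (fun n => 2^-1 * (series (poisson_weight lam) n
     + expR (- lam) * series (fun m => (- lam) ^+ m / m`!%:R) n)).
    apply/funext => n; rewrite /series /= big_distrr -big_split big_distrr /=.
    apply: eq_bigr => m _; rewrite /even_poisson_weight /poisson_weight exprNn.
    by case: ifP => om; rewrite -signr_odd om /=; lra.
  apply: cvgM; first exact: cvg_cst; apply: cvgD; first exact: cvg_poisson_mass.
  by apply: cvgM; [exact: cvg_cst|exact: cvg_exp_series].
- move=> s N s2; apply: le_trans (poisson_mgf l0 N s2).
  apply: ler_sum => m _; rewrite ler_wpM2l ?expR_ge0 // /even_poisson_weight.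
  by case: ifP => // _; exact: poisson_weight_ge0.
Unshelve. all: by end_near. Qed.

End Poisson.

(** * From the Hankel determinant to the walk generating function *)

Section WalkAsymptotics.
Variable R : realType.

Definition beta_egf (z : R) (p : nat) : R :=
  limn (series (egf_term (fun n => beta_moment R n p) z)).

Lemma cvg_beta_egf z p : 0 <= z ->
  series (egf_term (fun n => beta_moment R n p) z) @ \oo --> beta_egf z p.
Proof.
move=> z0; apply: (@is_cvg_egf _ _ 4 (beta_moment R 0 p)) => // n.
rewrite ger0_norm ?(ltW (beta_moment_gt0 _ _ _)) // -ler_pdivrMr ?exprn_gt0 //.
exact: beta_norm_le.
Qed.

Lemma beta_egf_wsum z p : 0 <= z ->
  expR (- (4 * z)) * beta_egf z p = wsum (poisson_weight (4 * z)) (beta_norm R p).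
Proof.
move=> z0; apply/esym/cvg_lim => //.
have -> : series (fun m => beta_norm R p m * poisson_weight (4 * z) m) =
    (fun n => expR (- (4 * z)) * series (egf_term (fun n => beta_moment R n p) z) n).
  apply/funext => n; rewrite /series /= big_distrr /=; apply: eq_bigr => m _.
  rewrite /beta_norm /poisson_weight /egf_term exprMn.
  have f : 4 ^+ m != 0 :> R by rewrite expf_eq0 pnatr_eq0 andbF.
  have f2 : m`!%:R != 0 :> R by rewrite pnatr_eq0 -lt0n fact_gt0.
  move: (4 ^+ m) (m`!%:R) (expR _) (beta_moment R m p) (z ^+ m) f f2 => a b c x y f f2.
  by field; rewrite f f2.
by apply: cvgM; [exact: cvg_cst|exact: cvg_beta_egf].
Qed.

(** The factor [e^(2z)] passes to lazy walks, whose counts are moments of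
    [(4 - 'X) ^+ n * (cheb i * cheb j)]; expanding both [cheb] factors in powers of ['X] leaves a
    Hankel kernel. *)
Lemma line_sum_beta d z (i j : 'I_d) : 0 <= z ->
  expR (2 * z) * line_sum z i j =
  \sum_(p < d) \sum_(q < d) (cheb R i)`_p * (cheb R j)`_q * beta_egf z (p + q).
Proof.
move=> z0.
have c1 := egf_convol z0 (ler0n R 2) (fun n => ler0n R (line_walks n i j))
  (@cvg_line_sum R z i j z0).
have chebE (k : 'I_d) : cheb R k = \sum_(p < d) (cheb R k)`_p *: 'X^p.
  rewrite -poly_def; apply/polyP => p; rewrite coef_poly; case: ltnP => // dp.
  by rewrite coef_cheb // (leq_trans _ dp).
have momE n : \sum_(l < n.+1) 'C(n, l)%:R * 2 ^+ (n - l) * (line_walks l i j)%:R =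
    \sum_(p < d) \sum_(q < d) (cheb R i)`_p * (cheb R j)`_q * beta_moment R n (p + q).
  rewrite -moment_lazy_walks {1}(chebE i) {1}(chebE j) big_distrl big_distrr /=.
  rewrite moment_sum; apply: eq_bigr => p _.
  rewrite big_distrr big_distrr /= moment_sum; apply: eq_bigr => q _.
  rewrite /beta_moment -momentZ; congr moment.
  by rewrite -scalerAl -!scalerAr scalerA exprD.
have c2 : series (egf_term (fun n => \sum_(l < n.+1) 'C(n, l)%:R * 2 ^+ (n - l) *
      (line_walks l i j)%:R) z) @ \oo -->
    \sum_(p < d) \sum_(q < d) (cheb R i)`_p * (cheb R j)`_q * beta_egf z (p + q).
  have -> : series (egf_term (fun n => \sum_(l < n.+1) 'C(n, l)%:R * 2 ^+ (n - l) *
      (line_walks l i j)%:R) z) = (fun N => \sum_(p < d) \sum_(q < d)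
      (cheb R i)`_p * (cheb R j)`_q * series (egf_term (fun n => beta_moment R n (p + q)) z) N).
    apply/funext => N; rewrite /series /=.
    under [RHS]eq_bigr do under eq_bigr do rewrite big_distrr /=.
    under [RHS]eq_bigr do rewrite exchange_big /=.
    rewrite [RHS]exchange_big /=; apply: eq_bigr => n _.
    rewrite /egf_term momE !mulr_suml; apply: eq_bigr => p _.
    by rewrite !mulr_suml; apply: eq_bigr => q _; rewrite !mulrA.
  apply: cvg_big => [|p _]; first exact: add_continuous.
  apply: cvg_big => [|q _]; first exact: add_continuous.
  by apply: cvgM; [exact: cvg_cst|exact: cvg_beta_egf].
exact: (cvg_unique _ c1 c2).
Qed.

Lemma det_line_sum d z : 0 <= z ->
  expR (2 * z) ^+ d * \det (\matrix_(i < d, j < d) line_sum z (d.-1 - i) (d.-1 - j)) =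
  \det (\matrix_(i < d, j < d) beta_egf z (i + j)).
Proof.
move=> z0.
pose A : 'M[R]_d := \matrix_(i, j) line_sum z i j.
(* Rows and columns are both in reverse order, so the two signs cancel. *)
pose s := perm (can_inj (@rev_ordK d)).
have -> : \matrix_(i < d, j < d) line_sum z (d.-1 - i) (d.-1 - j) =
    row_perm s (col_perm s A).
  apply/matrixP => i j; rewrite !mxE !permE /=; congr line_sum; lia.
rewrite row_permE col_permE !det_mulmx !det_perm odd_permV.
rewrite [\det A * _]mulrC [(-1) ^+ s * _]mulrA -signr_addb addbb mul1r -detZ.
pose V : 'M[R]_d := \matrix_(i, p) (cheb R i)`_p.
pose B : 'M[R]_d := \matrix_(p, q) beta_egf z (p + q).
have -> : expR (2 * z) *: A = V *m B *m V^T.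
  apply/matrixP => i j; rewrite !mxE line_sum_beta //.
  rewrite exchange_big /=; apply: eq_bigr => q _; rewrite !mxE mulr_suml.
  by apply: eq_bigr => p _; rewrite !mxE mulrAC.
rewrite !det_mulmx det_tr mulrAC -expr2.
have -> : \det V = \prod_(i < d) (-1) ^+ i.
  rewrite det_trig; last by apply/is_trig_mxP => i j ij; rewrite mxE coef_cheb.
  by apply: eq_bigr => i _; rewrite mxE lead_cheb.
rewrite -prodrXl big1 ?mul1r // => i _.
by rewrite -exprM mulnC exprM sqrrN expr1n expr1n.
Qed.

Lemma prod_powR (I : Type) (r : seq I) (a : I -> R) (x : R) : 0 < x ->
  \prod_(i <- r) x `^ a i = x `^ (\sum_(i <- r) a i).
Proof.
move=> x0; elim: r => [|i r IH]; first by rewrite !big_nil powRr0.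
by rewrite !big_cons IH powRD ?(gt_eqF x0) ?implybT.
Qed.

(** The origin of the polynomial exponent: row [i] is scaled by the power [i + 3/2] and column [i]
    by the power [i]. *)
Lemma sum_hankel_exponents d :
  \sum_(i < d) (i%:R + (i%:R + 3 / 2)) = d%:R ^+ 2 + d%:R / 2 :> R.
Proof.
elim: d => [|d IH]; first by rewrite big_ord0; lra.
by rewrite big_ord_recr /= IH -[d.+1%:R]natr1; lra.
Qed.

Lemma walk_det_asymptotics d : exists2 c : R, 0 < c &
  expR (- (2 * d%:R * z)) *
    \det (\matrix_(i < d, j < d) line_sum z (d.-1 - i) (d.-1 - j)) *
    (4 * z) `^ (d%:R ^+ 2 + d%:R / 2) @[z --> +oo] --> c.
Proof.
have [kappa k0 ck] := beta_norm_cvg R.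
pose H : 'M[R]_d := \matrix_(i, j) (kappa * hankel_coef R (i + j)).
exists (\det H).
  have -> : H = kappa *: \matrix_(i, j) hankel_coef R (i + j).
    by apply/matrixP => i j; rewrite !mxE.
  by rewrite detZ mulr_gt0 ?exprn_gt0 ?hankel_det_gt0.
pose A (z : R) : 'M[R]_d := \matrix_(i, j)
  (expR (- (4 * z)) * beta_egf z (i + j) * (4 * z) `^ ((i + j)%:R + 3 / 2)).
have l4 : (4 * z : R) @[z --> +oo] --> +oo.
  apply/cvgryPge => a; near=> z.
  rewrite -ler_pdivrMl //; near: z; apply: nbhs_pinfty_ge; rewrite num_real //.
have cA : \det (A z) @[z --> +oo] --> \det H.
  apply: cvg_det => i j; rewrite mxE.
  have b0 : 0 <= (i + j)%:R + 3 / 2 :> R by rewrite addr_ge0 ?divr_ge0.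
  have c0 : 0 < kappa * hankel_coef R (i + j) by rewrite mulr_gt0 ?hankel_coef_gt0.
  have gK m : `|beta_norm R (i + j) m| <= beta_moment R 0 (i + j).
    by rewrite ger0_norm ?beta_norm_le // ltW // beta_norm_gt0.
  have := wsum_abelian (ltr0n R 2) b0 c0 (poisson_concentrated l4) gK (ck (i + j)%N).
  rewrite mulr1 => h; apply: (cvg_near_eq (h _ _)); near=> z.
  have z0 : 0 <= z by near: z; apply: nbhs_pinfty_ge; rewrite num_real.
  by rewrite mxE beta_egf_wsum.
apply: (cvg_near_eq cA); near=> z.
have z0 : 0 < z by near: z; exact: nbhs_pinfty_gt.
have z4 : 0 < 4 * z by rewrite mulr_gt0.
(* The exponent [i + j + 3/2] splits additively, so the scaling that makes every entry converge is a
   product with diagonal matrices. *)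
pose D1 : 'rV[R]_d := \row_i (expR (- (4 * z)) * (4 * z) `^ (i%:R + 3 / 2)).
pose D2 : 'rV[R]_d := \row_i ((4 * z) `^ i%:R).
have -> : A z = diag_mx D1 *m (\matrix_(i, j) beta_egf z (i + j)) *m diag_mx D2.
  apply/matrixP => i j; rewrite mul_mx_diag mul_diag_mx !mxE.
  have -> : (i + j)%:R + 3 / 2 = (i%:R + 3 / 2) + j%:R :> R by rewrite natrD; ring.
  rewrite powRD ?(gt_eqF z4) ?implybT //; ring.
rewrite !det_mulmx !det_diag -det_line_sum ?(ltW z0) //.
under eq_bigr do rewrite mxE.
under [X in _ * X]eq_bigr do rewrite mxE.
rewrite big_split /= prodr_const card_ord !prod_powR // -sum_hankel_exponents.
rewrite [\sum_(i < d) (_ + (_ + _))]big_split /= powRD ?(gt_eqF z4) ?implybT //.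
have -> : expR (- (2 * d%:R * z)) = expR (- (4 * z)) ^+ d * expR (2 * z) ^+ d.
  by rewrite -exprMn -expRD -expRM_natl; congr expR; ring.
move: (_ `^ _) (_ `^ _) (\det _) (expR _ ^+ d) (expR _ ^+ d) => a b c e f; ring.
Unshelve. all: by end_near. Qed.

End WalkAsymptotics.

Section WalkCounts.
Variables (R : realType) (e : nat).
Local Notation d := e.+1.
Local Notation f n := (walks d n (fun=> 0%N)).
Local Notation b := (d%:R ^+ 2 + d%:R / 2 : R).

(* Odd closed walks do not exist; rounding [m] up makes the density monotone. *)
Definition walk_density (m : nat) : R :=
  (f (uphalf m).*2)%:R / (2 * d%:R) ^+ (uphalf m).*2.

Lemma two_d_gt0 : 0 < 2 * d%:R :> R.
Proof. by rewrite mulr_gt0. Qed.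

Lemma walk_density_even m : ~~ odd m -> walk_density m = (f m)%:R / (2 * d%:R) ^+ m.
Proof.
move=> om; rewrite /walk_density; suff -> : (uphalf m).*2 = m by [].
by rewrite uphalf_half (negbTE om) add0n; have := odd_double_half m; rewrite (negbTE om).
Qed.

Lemma walk_density_ge0 m : 0 <= walk_density m.
Proof. by rewrite divr_ge0 // exprn_ge0 // ltW // two_d_gt0. Qed.

Lemma walk_density_dec m n : (m <= n)%N -> walk_density n <= walk_density m.
Proof.
move=> mn; have : (uphalf m <= uphalf n)%N by exact: (@half_leq m.+1 n.+1).
rewrite /walk_density; elim: (uphalf n) => [|j IH]; first by rewrite leqn0 => /eqP->.
rewrite leq_eqVlt => /orP[/eqP->//|]; rewrite ltnS => /IH; apply: le_trans.
have t0 := two_d_gt0.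
rewrite doubleS !exprS mulrA ler_pdivrMr ?mulr_gt0 ?exprn_gt0 //.
have : (f j.+1.*2)%:R <= (2 * d%:R) ^+ 2 * (f j.*2)%:R :> R.
  by rewrite -!natrM -natrX -natrM ler_nat walks_double_le.
rewrite doubleS => /le_trans; apply.
have h : (2 * d%:R) ^+ j.*2 != 0 :> R by rewrite gt_eqF // exprn_gt0.
rewrite le_eqVlt; apply/orP; left; apply/eqP.
by move: h; move: (2 * d%:R : R) (f j.*2) => y z h; field.
Qed.

(** At [z = lam / (2d)] the powers of [2d] in the density cancel, and the missing odd terms are
    exactly the odd walk counts, which vanish. *)
Lemma walk_density_wsum lam : 0 < lam ->
  wsum (even_poisson_weight lam) walk_density =
  expR (- lam) * \det (\matrix_(i < d, j < d) line_sum (lam / (2 * d%:R)) (d.-1 - i) (d.-1 - j)).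
Proof.
move=> l0; apply: cvg_lim => //.
have t0 := two_d_gt0.
have -> : series (fun m => walk_density m * even_poisson_weight lam m) =
    (fun n => expR (- lam) *
       series (egf_term (fun n => (f n)%:R) (lam / (2 * d%:R))) n).
  apply/funext => n; rewrite /series /= big_distrr /=; apply: eq_bigr => m _.
  rewrite /even_poisson_weight /egf_term; case: (boolP (odd m)) => om.
    by rewrite walks_odd ?mul0r ?mulr0 // big1 // addn0.
  rewrite walk_density_even // /poisson_weight expr_div_n.
  have h : (2 * d%:R) ^+ m != 0 :> R by rewrite gt_eqF // exprn_gt0.
  have h2 : m`!%:R != 0 :> R by rewrite pnatr_eq0 -lt0n fact_gt0.
  by move: (m`!%:R : R) h2 h; move: (2 * d%:R : R) (f m) => y z x h2 h; field; rewrite h h2.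
by apply: cvgM; [exact: cvg_cst|apply: cvg_walks_egf; rewrite divr_gt0].
Qed.

Lemma walk_density_cvg : exists2 c : R, 0 < c &
  walk_density m * m%:R `^ b @[m --> \oo] --> c.
Proof.
have [c c0 cc] := walk_det_asymptotics R d.
have t0 := two_d_gt0.
have q0 : 0 < 4 / (2 * d%:R) :> R by rewrite divr_gt0.
pose Q : R := (4 / (2 * d%:R)) `^ b.
have Q0 : 0 < Q by rewrite powR_gt0.
have b0 : 0 <= b by rewrite addr_ge0 ?sqr_ge0 ?divr_ge0.
have lF : (lam / (2 * d%:R) : R) @[lam --> +oo] --> +oo.
  apply/cvgryPge => a; near=> lam.
  by rewrite ler_pdivlMr //; near: lam; apply: nbhs_pinfty_ge; rewrite num_real.
(* [Q] converts [(4 * z)]^ b[to]lam [^ b] at [z = lam / (2d)]; [2^-1] is the limiting mass of the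
   even Poisson weights. *)
exists (c / Q / 2^-1); first by rewrite !divr_gt0 ?invr_gt0.
apply: (wsum_tauberian (ltr0n R 2) b0 _ (even_poisson_concentrated R)).
- by rewrite invr_gt0.
- exact: walk_density_ge0.
- exact: walk_density_dec.
have h := cvgM (cvg_comp _ _ lF cc) (cvg_cst Q^-1).
apply: (cvg_near_eq (h _ _)); near=> lam => /=.
have l0 : 0 < lam by near: lam; exact: nbhs_pinfty_gt.
rewrite walk_density_wsum // [2 * d%:R * _]mulrC divfK ?gt_eqF // -!mulrA; congr (_ * (_ * _)).
have -> : 4 * (lam / (2 * d%:R)) = 4 / (2 * d%:R) * lam by rewrite mulrA mulrAC.
by rewrite powRM ?(ltW q0) ?(ltW l0) // -/Q mulrAC mulfV ?mul1r // gt_eqF.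
Unshelve. all: by end_near. Qed.

End WalkCounts.

(** * Tangled diagrams *)

Section Tangled.
Variables (R : realType) (e : nat).
Local Notation d := e.+1.
Local Notation f n := (walks d n (fun=> 0%N)).

Definition trinomial (n : nat) : {poly R} := (1 + 'X + 'X^2) ^+ n.

Lemma coef_trinomial_ge0 n m : 0 <= (trinomial n)`_m.
Proof.
rewrite /trinomial -[n]card_ord -prodr_const; apply: coef_prod_ge0 => _ i.
by rewrite !coefD coef1 coefX coefXn !addr_ge0.
Qed.

Lemma horner_trinomial n (x : R) : (trinomial n).[x] = (1 + x + x ^+ 2) ^+ n.
Proof. by rewrite horner_exp !hornerE. Qed.

Lemma num_tangled_trinomial n L : (size (trinomial n) <= L)%N ->
  (num_tangled e.+2 n)%:R = \sum_(0 <= m < L) (trinomial n)`_m * (f m)%:R.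
Proof.
(* The linear functional sending ['X^m] to [f m]. Applied to the twice expanded power, it reproduces
   the double sum once [L] exceeds all exponents. *)
pose phi L (p : {poly R}) := \sum_(0 <= m < L) p`_m * (f m)%:R.
have phiD K (p q : {poly R}) : phi K (p + q) = phi K p + phi K q.
  by rewrite -big_split /=; apply: eq_bigr => m _; rewrite coefD mulrDl.
have phi0 K : phi K 0 = 0 by apply: big1 => m _; rewrite coef0 mul0r.
have phiMn K (p : {poly R}) c : phi K (p *+ c) = c%:R * phi K p.
  by rewrite /phi big_distrr /=; apply: eq_bigr => m _; rewrite coefMn mulrA mulr_natl.
have phi_sum K c (F : 'I_c -> {poly R}) :
    phi K (\sum_(i < c) F i) = \sum_(i < c) phi K (F i).
  exact: (big_morph (phi K) (phiD K) (phi0 K)).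
have phiX K a : (a < K)%N -> phi K ('X^a) = (f a)%:R.
  move=> aK; rewrite /phi (bigD1_seq a) ?mem_index_iota ?iota_uniq //=.
  by rewrite coefXn eqxx mul1r big1 ?addr0 // => i /negbTE ia; rewrite coefXn ia mul0r.
move=> sL; rewrite -/(phi L _).
have widen K : (L <= K)%N -> phi L (trinomial n) = phi K (trinomial n).
  move=> LK; rewrite /phi [RHS](big_cat_nat _ LK) //= -[LHS]addr0; congr (_ + _).
  rewrite big_nat big1 // => m /andP[Lm _].
  by rewrite nth_default ?mul0r // (leq_trans sL).
rewrite (widen (L + (2 * n).+1)%N) ?leq_addr //; move: (L + (2 * n).+1)%N (leq_addl L (2 * n).+1).
move=> K nK.
rewrite /trinomial -addrA addrC exprDn phi_sum /num_tangled big_mkord natr_sum.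
apply: eq_bigr => r _; rewrite expr1n mulr1 phiMn natrM; congr (_ * _).
rewrite addrC exprDn phi_sum big_mkord natr_sum; apply: eq_bigr => l _.
rewrite phiMn natrM -exprM -exprD; congr (_ * _).
have lr : (l <= n - r)%N by rewrite -ltnS.
rewrite (_ : 2 * (n - r - l) + l = 2 * (n - r) - l)%N; last by lia.
by rewrite phiX ?num_matchings_walks //; lia.
Qed.

Local Notation x := (2 * d%:R : R).
Local Notation M := (1 + x + x ^+ 2).

Definition trinomial_weight (n m : nat) : R :=
  if odd m then 0 else (trinomial n)`_m * x ^+ m / M ^+ n.

Local Notation mu := ((x + 2 * x ^+ 2) / M).

Lemma base_gt0 : 0 < M.
Proof. by have := two_d_gt0 R e; nra. Qed.

Lemma mu_gt0 : 0 < mu.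
Proof. by rewrite divr_gt0 ?base_gt0 //; have := two_d_gt0 R e; nra. Qed.

(** The square of a trinomial step brings in [e^(2s)] with [|s| <= 1/2], so the quadratic bound is
    needed up to 1; it comes from squaring the bound at [u / 2]. *)
Lemma expR_le_quad1 (u : R) : `|u| <= 1 -> expR u <= 1 + u + 2 * u ^+ 2.
Proof.
rewrite ler_norml => /andP[u1 u2].
have h : expR (u / 2) <= 1 + u / 2 + 2 * (u / 2) ^+ 2 by apply: expR_le_quad; lra.
have e0 := expR_gt0 (u / 2).
have -> : expR u = expR (u / 2) ^+ 2 by rewrite -expRM_natl; congr expR; lra.
apply: (@le_trans _ _ ((1 + u / 2 + 2 * (u / 2) ^+ 2) ^+ 2)).
  by rewrite ler_pXn2r // nnegrE ?ltW // (lt_le_trans e0).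
have -> : (1 + u / 2 + 2 * (u / 2) ^+ 2) ^+ 2 =
  1 + u + 2 * u ^+ 2 - u ^+ 2 * ((1 - u) * (3 + u)) / 4 by field.
have : 0 <= u ^+ 2 * ((1 - u) * (3 + u)) by rewrite mulr_ge0 ?sqr_ge0 // mulr_ge0; lra.
by lra.
Qed.

Lemma trinomial_weight_ge0 n m : 0 <= trinomial_weight n m.
Proof.
rewrite /trinomial_weight; case: ifP => // _; rewrite divr_ge0 ?exprn_ge0 ?(ltW base_gt0) //.
by rewrite mulr_ge0 ?coef_trinomial_ge0 // exprn_ge0 // (ltW (two_d_gt0 R e)).
Qed.

(** The sum is at most [(P(x e^s) / P(x))^n] for [P = 1 + X + X^2], and [mu = x P'(x) / P(x)] is the
    mean exponent of one factor. The constant 4 is dictated by the term in [X^2], where [e^(2s)]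
    contributes [8 s^2] against a mean of 2. *)
Lemma trinomial_mgf n : mgf_bound (trinomial_weight n) (mu * n%:R) 4.
Proof.
move=> s N s2; have M0 := base_gt0; have x0 := two_d_gt0 R e.
have e0 := expR_gt0 s.
apply: (@le_trans _ _ ((trinomial n).[x * expR s] / M ^+ n)).
  rewrite ler_pdivlMr ?exprn_gt0 // mulr_suml (@horner_coef_wide _ (N + size (trinomial n))).
    rewrite -(big_mkord xpredT (fun i => (trinomial n)`_i * (x * expR s) ^+ i)).
    rewrite [leRHS](@big_cat_nat _ _ _ N) ?leq_addr //= -[leLHS]addr0; apply: lerD.
      apply: ler_sum => m _; rewrite /trinomial_weight; case: ifP => _.
        by rewrite mulr0 mul0r mulr_ge0 ?coef_trinomial_ge0 ?exprn_ge0 ?mulr_ge0 ?ltW.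
      rewrite [expR _ * _]mulrA divfK ?gt_eqF ?exprn_gt0 // expRM_natr [(_ * expR s) ^+ m]exprMn mulrC.
      by rewrite [X in _ <= X]mulrA.
    by rewrite sumr_ge0 // => m _;
      rewrite mulr_ge0 ?coef_trinomial_ge0 ?exprn_ge0 ?mulr_ge0 ?ltW.
  by rewrite leq_addl.
rewrite horner_trinomial -expr_div_n.
have -> : mu * n%:R * (s + 4 * s ^+ 2) = n%:R * (mu * (s + 4 * s ^+ 2)) by ring.
have xe0 : 0 <= x * expR s by rewrite mulr_ge0 ?ltW.
rewrite expRM_natl; apply: lerXn2r; rewrite ?nnegrE ?expR_ge0 //.
apply: le_trans (expR_ge1Dx _); rewrite ler_pdivrMr //.
have -> : (1 + mu * (s + 4 * s ^+ 2)) * M = M + (x + 2 * x ^+ 2) * (s + 4 * s ^+ 2).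
  by rewrite mulrDl mul1r mulrAC divfK // gt_eqF.
have h1 : expR s <= 1 + s + 2 * s ^+ 2 by apply: expR_le_quad1; lra.
have h2 : expR s ^+ 2 <= 1 + 2 * s + 8 * s ^+ 2.
  have := @expR_le_quad1 (2 * s); rewrite expRM_natl normrM ger0_norm // => h.
  by apply: le_trans (h _) _; lra.
rewrite exprMn.
have k1 := ler_wpM2l (ltW x0) h1; have k2 := ler_wpM2l (sqr_ge0 x) h2.
have k3 : 0 <= x * s ^+ 2 by rewrite mulr_ge0 ?sqr_ge0 // ltW.
by lra.
Qed.

Lemma trinomial_concentrated :
  concentrated \oo (fun n => mu * n%:R) trinomial_weight (2^-1) 4.
Proof.
have M0 := base_gt0; have x0 := two_d_gt0 R e.
split.
  apply/cvgryPge => A; have /cvgryPge/(_ (mu^-1 * A)) := @cvgr_idn R.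
  by apply: filterS => m; rewrite ler_pdivrMl // mu_gt0.
(* The even part is the half sum of the values at [x] and [- x]; the latter is exponentially
   smaller. *)
exists (fun n => 2^-1 * (1 + ((1 - x + x ^+ 2) / M) ^+ n)); split.
  rewrite -[X in _ --> X]mulr1; apply: cvgM; first exact: cvg_cst.
  rewrite -[X in _ --> X]addr0; apply: cvgD; first exact: cvg_cst.
  apply: cvg_expr; rewrite ger0_norm ?ltr_pdivrMr ?mul1r //; first by nra.
  by rewrite divr_ge0 ?(ltW M0) //; nra.
near=> n; split; [exact: trinomial_weight_ge0| |exact: trinomial_mgf].
apply: (cvg_near_eq (cvg_cst _)); near=> N.
have sN : (size (trinomial n) <= N)%N by near: N; exact: nbhs_infty_ge.
have hE y : (trinomial n).[y] = \sum_(0 <= m < N) (trinomial n)`_m * y ^+ m.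
  by rewrite (horner_coef_wide _ sN) big_mkord.
have -> : 2^-1 * (1 + ((1 - x + x ^+ 2) / M) ^+ n) =
    2^-1 * ((trinomial n).[x] + (trinomial n).[- x]) / M ^+ n.
  rewrite !horner_trinomial sqrrN expr_div_n.
  have := exprn_gt0 n M0; move: (M ^+ n) => a a0; field.
  by rewrite gt_eqF.
rewrite !hE /series /= -big_split big_distrr mulr_suml /=; apply: eq_bigr => m _.
rewrite /trinomial_weight exprNn -signr_odd; case: (odd m) => /=.
  by rewrite expr1 mulN1r mulrN subrr mulr0 mul0r.
by rewrite expr0 mul1r; congr (_ / _); lra.
Unshelve. all: by end_near. Qed.

Lemma num_tangled_wsum n :
  (num_tangled e.+2 n)%:R / M ^+ n = wsum (trinomial_weight n) (walk_density R e).
Proof.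
have x0 := two_d_gt0 R e.
apply/esym/cvg_lim => //; apply: (cvg_near_eq (cvg_cst _)); near=> N.
have sN : (size (trinomial n) <= N)%N by near: N; exact: nbhs_infty_ge.
rewrite (num_tangled_trinomial sN) /series /= mulr_suml; apply: eq_bigr => m _.
rewrite /trinomial_weight; case: (boolP (odd m)) => om.
  by rewrite walks_odd ?mulr0 ?mul0r // big1 // addn0.
rewrite walk_density_even //.
have h : x ^+ m != 0 by rewrite gt_eqF // exprn_gt0.
rewrite [RHS]mulrA; congr (_ / _); rewrite mulrC -!mulrA; congr (_ * _).
by rewrite [x ^+ m]lock mulrCA -lock mulVf // mulr1.
Unshelve. all: by end_near. Qed.

End Tangled.

Theorem theorem1 (R : realType) (k : nat) (hk : (2 <= k)%N) :
  exists c : R, 0 < c /\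
    (num_tangled k n)%:R /
      (c * n%:R `^ (- ((k%:R - 1) ^+ 2 + (k%:R - 1) / 2))
         * (4 * (k%:R - 1) ^+ 2 + 2 * (k%:R - 1) + 1) ^+ n)
    @[n --> \oo] --> (1 : R).
Proof.
case: k hk => [|[|e]] // _.
have -> : e.+2%:R - 1 = e.+1%:R :> R by rewrite -natr1 addrK.
have [c1 c10 cc] := walk_density_cvg R e.
pose x : R := 2 * e.+1%:R; pose b : R := e.+1%:R ^+ 2 + e.+1%:R / 2.
pose M : R := 1 + x + x ^+ 2; pose mu : R := (x + 2 * x ^+ 2) / M.
have mu0 : 0 < mu := mu_gt0 R e.
have M0 : 0 < M := base_gt0 R e.
have b0 : 0 <= b by rewrite addr_ge0 ?sqr_ge0 ?divr_ge0.
have gK m : `|walk_density R e m| <= walk_density R e 0.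
  by rewrite ger0_norm ?walk_density_ge0 // walk_density_dec.
have h := wsum_abelian (ltr0n R 4) b0 c10 (trinomial_concentrated R e) gK cc.
pose c := c1 * 2^-1 / mu `^ b.
have c0 : 0 < c by rewrite divr_gt0 ?powR_gt0 // mulr_gt0 // invr_gt0.
exists c; split=> //.
have -> : 4 * e.+1%:R ^+ 2 + 2 * e.+1%:R + 1 = M by rewrite /M /x; ring.
have h2 := cvgM (h _) (cvg_cst (c1 * 2^-1)^-1).
rewrite mulfV in h2; last by rewrite gt_eqF // mulr_gt0 // invr_gt0.
apply: (cvg_near_eq (h2 _ _ _)); near=> n => /=.
have n0 : 0 < n%:R :> R by rewrite ltr0n; near: n; exact: nbhs_infty_gt.
rewrite -num_tangled_wsum -/x -/M -/mu -/b powRN powRM ?(ltW mu0) ?(ltW n0) //.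
have := powR_gt0 b mu0; have := powR_gt0 b n0; have := exprn_gt0 n M0; rewrite /c.
move: (_ `^ _) (_ `^ _) (M ^+ n) => p q r r0 q0 p0.
by field; rewrite !gt_eqF.
Unshelve. all: by end_near. Qed.
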